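(* Let $\mathbf k$ be a field of characteristic zero and let $(A,\partial,\bar\partial,\mu)$ be a commutative bidifferential bigraded algebra over $\mathbf k$. There exists a minimal bicomplex $H$ (i.e. $\partial\bar\partial=0$ on $H$) endowed with a pluripotential $C_\infty$-algebra structure, and a pluripotential $\infty$-weak equivalence of pluripotential $C_\infty$-algebras $g\colon H\rightsquigarrow A$.
   Context: A bicomplex is a bigraded $\mathbf k$-vector space with linear maps $\partial$ of bidegree $(1,0)$ and $\bar\partial$ of bidegree $(0,1)$ with $\partial^2=\bar\partial^2=\partial\bar\partial+\bar\partial\partial=0$; morphisms are bidegree-preserving linear maps commuting with both. Signs follow the Koszul rule for total degree; tensor powers carry the Leibniz differentials; for a linear map $\phi$ of total degree $|\phi|$, $[\partial,\phi]=\partial\phi-(-1)^{|\phi|}\phi\partial$ and likewise for $\bar\partial$. $H_{BC}=\frac{\ker\partial\cap\ker\bar\partial}{\operatorname{Im}\partial\bar\partial}$, $H_A=\frac{\ker\partial\bar\partial}{\operatorname{Im}\partial+\operatorname{Im}\bar\partial}$; a pluripotential weak equivalence is a morphism of bicomplexes inducing isomorphisms on both. A commutative bidifferential bigraded algebra is a bicomplex with an associative product of bidegree $(0,0)$, graded commutative with respect to total degree, for which $\partial,\bar\partial$ are derivations. A pluripotential $A_\infty$-algebra is a bicomplex $(A,\partial,\bar\partial)$ with linear maps $\mu_n^{p,q}\colon A^{\otimes n}\to A$ of bidegree $(p,q)$, $n\ge2$, which are zero unless ($p+q=2-n$ and $p,q\le0$) or ($p+q=1-n$ and $p,q\le-1$),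 such that $$[\partial,\mu_n^{p,q}]=q\mu_n^{p+1,q}+\sum_{\substack{k+\ell=n+1\\ 1\le i\le k}}\ \sum_{\substack{p_1+p_2=p+1\\ q_1+q_2=q}}(-1)^{i(\ell+1)+n+\varepsilon}\mu_k^{p_1,q_1}(\mathrm{id}^{\otimes i-1}\otimes\mu_\ell^{p_2,q_2}\otimes\mathrm{id}^{\otimes k-i}),$$ $$[\bar\partial,\mu_n^{p,q}]=-p\mu_n^{p,q+1}+\sum_{\substack{k+\ell=n+1\\ 1\le i\le k}}\ \sum_{\substack{p_1+p_2=p\\ q_1+q_2=q+1}}(-1)^{i(\ell+1)+n+\varepsilon}\mu_k^{p_1,q_1}(\mathrm{id}^{\otimes i-1}\otimes\mu_\ell^{p_2,q_2}\otimes\mathrm{id}^{\otimes k-i}),$$ with $k,\ell\ge2$ and $\varepsilon=(p_1+q_1)(\ell+p_2+q_2)+(p+q+n)$. A pluripotential $\infty$-morphism $f\colon(A,\mu)\rightsquigarrow(B,\nu)$ is a family of linear maps $f_n^{p,q}\colon A^{\otimes n}\to B$, $n\ge1$, of bidegree $(p,q)$, zero unless ($p+q=1-n$ and $p,q\le0$) or ($p+q=-n$ and $p,q\le-1$), such that $$[\partial,f_n^{p,q}]=qf_n^{p+1,q}-\sum_{i_1+\cdots+i_k=n}\ \sum(-1)^{\theta+\varepsilon_1}\nu_k^{p_0,q_0}(f_{i_1}^{p_1,q_1}\otimes\cdots\otimes f_{i_k}^{p_k,q_k})-\sum_{\substack{k+\ell=n+1\\ r+s+1=k}}\ \sum(-1)^{r(1+\ell)+k+\varepsilon_2}f_k^{p_1,q_1}(\mathrm{id}^{\otimes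 r}\otimes\mu_\ell^{p_2,q_2}\otimes\mathrm{id}^{\otimes s}),$$ where the inner sums run over $p_0+\dots+p_k=p+1$, $q_0+\dots+q_k=q$, respectively $p_1+p_2=p+1$, $q_1+q_2=q$; and the same equation for $[\bar\partial,f_n^{p,q}]$ with first term $-pf_n^{p,q+1}$ and inner sums over indices with total $(p,q+1)$ instead of $(p+1,q)$. In the first outer sum $k\ge2$, $i_j\ge1$; in the second $k\ge1$, $\ell\ge2$. Here $\theta=\sum_{1\le r<s\le k}i_r(i_s+1)$, $\varepsilon_1=\sum_{j=1}^k\big(\sum_{r=0}^{j-1}(p_r+q_r)\big)(p_j+q_j+i_j+1)+p+q+n+1$, $\varepsilon_2=(p_1+q_1)(p_2+q_2+\ell)+p+q+n+1$. An $(i,j)$-shuffle is $\sigma\in\mathbb S_{i+j}$ with $\sigma(1)<\dots<\sigma(i)$ and $\sigma(i+1)<\dots<\sigma(i+j)$; $\tau_{i,j}=\sum_{\sigma}\mathrm{sign}(\sigma)\sigma\in\mathbf k[\mathbb S_{i+j}]$, sum over $(i,j)$-shuffles, acting on $A^{\otimes i+j}$ by permuting tensor factors with Koszul signs (so that $(a_1,\dots,a_i)\otimes(a_{i+1},\dots,a_{i+j})\mapsto\tau_{i,j}(a_1,\dots,a_{i+j})$ is the signed shuffle product). A pluripotential $C_\infty$-algebra is a pluripotential $A_\infty$-algebra with $\mu_{i+j}^{p,q}\circ\tau_{i,j}=0$ for all $i,j\ge1$ and $p,q\le0$. A pluripotential $\infty$-morphism of pluripotential $C_\infty$-algebras is a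 pluripotential $\infty$-morphism with $f_{i+j}^{p,q}\circ\tau_{i,j}=0$ for all $i,j\ge1$, $p,q\le0$; it is a weak equivalence if $f_1=f_1^{0,0}$ is a pluripotential weak equivalence. A commutative bidifferential bigraded algebra is a pluripotential $C_\infty$-algebra with $\mu_n^{p,q}=0$ for $n\ge3$.
   Formalization: The structure equations for μ_n^{p,q} and f_n^{p,q} are required only at the bidegrees where these maps may be nonzero; imposed also at p+q=-n (for morphisms p+q=-n-1) they would force all μ_n, n≥3, and f_2 to vanish, making the claim false. *)

(* Defs.v *)
From mathcomp Require Import all_boot all_order all_fingroup all_algebra.

Set Implicit Arguments.
Unset Strict Implicit.
Unset Printing Implicit Defensive.

Import Order.TTheory GRing.Theory Num.Theory.

Local Open Scope ring_scope.

(* Gradings are internal: a bigraded vector space is a vector space V with    *)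
(* subspaces V^{p,q}, (p, q) in Z x Z, of which it is the direct sum.  A      *)
(* linear map out of the n-th tensor power of V is a multilinear map in n     *)
(* arguments, written as a function on seq V of which only the values on      *)
(* sequences of size n matter.  Koszul signs depend on the degrees of the     *)
(* arguments, so identities between multilinear maps are stated on            *)
(* homogeneous arguments, which span.                                         *)

Section BigradedSpaces.
Variable k : fieldType.

Definition sg (z : int) : k := (-1) ^ z.

Definition bidegree := (int * int)%type.

Record is_bigrading (V : lmodType k) (gr : bidegree -> V -> Prop) : Prop :=
  IsBigrading {
    bigr_0 : forall d, gr d 0;
    bigr_lin : forall d (c : k) u v, gr d u -> gr d v -> gr d (c *: u + v);
    bigr_span : forall v, exists (ds : seq bidegree) (w : bidegree -> V),
      (forall d, gr d (w d)) /\ v = \sum_(d <- ds) w d;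
    bigr_indep : forall (ds : seq bidegree) (w : bidegree -> V),
      uniq ds -> (forall d, gr d (w d)) -> \sum_(d <- ds) w d = 0 ->
      forall d, d \in ds -> w d = 0 }.

Record bicomplex := Bicomplex {
  bc_space :> lmodType k;
  homog : bidegree -> bc_space -> Prop;
  homog_bigrading : is_bigrading homog;
  del : {linear bc_space -> bc_space};
  delbar : {linear bc_space -> bc_space};
  del_homog : forall p q x, homog (p, q) x -> homog (p + 1, q) (del x);
  delbar_homog : forall p q x, homog (p, q) x -> homog (p, q + 1) (delbar x);
  del_del : forall x, del (del x) = 0;
  delbar_delbar : forall x, delbar (delbar x) = 0;
  del_delbar : forall x, del (delbar x) + delbar (del x) = 0 }.
Arguments homog {b}.
Arguments del {b}.
Arguments delbar {b}.

Definition minimal (A : bicomplex) : Prop :=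
  forall x : A, del (delbar x) = 0.

Record is_bicomplex_morphism (A B : bicomplex) (f : A -> B) : Prop :=
  IsBicomplexMorphism {
    bcm_linear : linear f;
    bcm_homog : forall d x, homog d x -> homog d (f x);
    bcm_del : forall x, f (del x) = del (f x);
    bcm_delbar : forall x, f (delbar x) = delbar (f x) }.

Definition BC_cocycle (A : bicomplex) (x : A) : Prop :=
  del x = 0 /\ delbar x = 0.
Definition BC_coboundary (A : bicomplex) (x : A) : Prop :=
  exists y, x = del (delbar y).

Definition A_cocycle (A : bicomplex) (x : A) : Prop := del (delbar x) = 0.
Definition A_coboundary (A : bicomplex) (x : A) : Prop :=
  exists y z, x = del y + delbar z.

(* For subspaces Bd <= Z of V and Bd' <= Z' of W: f induces a well-defined    *)
(* bijection Z / Bd -> Z' / Bd', two elements of Z having the same class when *)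
(* their difference is in Bd.                                                 *)
Record induces_iso (V W : lmodType k) (Z Bd : V -> Prop) (Z' Bd' : W -> Prop)
    (f : V -> W) : Prop := InducesIso {
  iso_cocycle : forall x, Z x -> Z' (f x);
  iso_well_def : forall x y, Z x -> Z y -> Bd (x - y) -> Bd' (f x - f y);
  iso_inj : forall x y, Z x -> Z y -> Bd' (f x - f y) -> Bd (x - y);
  iso_surj : forall y, Z' y -> exists2 x, Z x & Bd' (f x - y) }.

Record pluripotential_weak_equivalence (A B : bicomplex) (f : A -> B) : Prop :=
  PluripotentialWeakEquivalence {
    pwe_morphism : is_bicomplex_morphism f;
    pwe_BC : induces_iso (@BC_cocycle A) (@BC_coboundary A)
                         (@BC_cocycle B) (@BC_coboundary B) f;
    pwe_A : induces_iso (@A_cocycle A) (@A_coboundary A)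
                        (@A_cocycle B) (@A_coboundary B) f }.

(* The product is not required to have a unit. *)
Record cbba := Cbba {
  cbba_bicomplex :> bicomplex;
  cmul : cbba_bicomplex -> cbba_bicomplex -> cbba_bicomplex;
  cmul_linear_l : forall b, linear (cmul^~ b);
  cmul_linear_r : forall a, linear (cmul a);
  cmul_homog : forall p q r s a b, homog (p, q) a -> homog (r, s) b ->
    homog (p + r, q + s) (cmul a b);
  cmulA : forall a b c, cmul a (cmul b c) = cmul (cmul a b) c;
  cmul_comm : forall p q r s a b, homog (p, q) a -> homog (r, s) b ->
    cmul a b = sg ((p + q) * (r + s)) *: cmul b a;
  cmul_del : forall p q a b, homog (p, q) a ->
    del (cmul a b) = cmul (del a) b + sg (p + q) *: cmul a (del b);
  cmul_delbar : forall p q a b, homog (p, q) a ->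
    delbar (cmul a b) = cmul (delbar a) b + sg (p + q) *: cmul a (delbar b) }.

(* ds lists the bidegrees of the homogeneous elements of xs. *)
Definition all_homog (A : bicomplex) (ds : seq bidegree) (xs : seq A) : Prop :=
  size ds = size xs /\
  forall j, (j < size xs)%N -> homog (nth (0, 0) ds j) (nth 0 xs j).

Definition bideg (ds : seq bidegree) : bidegree :=
  (\sum_(d <- ds) d.1, \sum_(d <- ds) d.2).

Definition tdeg (ds : seq bidegree) : int := (bideg ds).1 + (bideg ds).2.

Definition multilinear (A B : lmodType k) (n : nat) (phi : seq A -> B) : Prop :=
  forall (s t : seq A) (c : k) (x y : A), (size s + size t).+1 = n ->
  phi (s ++ (c *: x + y) :: t) = c *: phi (s ++ x :: t) + phi (s ++ y :: t).

Definition has_bidegree (A B : bicomplex) (n : nat) (p q : int)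
    (phi : seq A -> B) : Prop :=
  forall ds xs, size xs = n -> all_homog ds xs ->
  homog ((bideg ds).1 + p, (bideg ds).2 + q) (phi xs).

(* In the following definitions ds stands for the bidegrees of xs. *)

Definition leibniz (A : bicomplex) (D : A -> A) (B : lmodType k)
    (phi : seq A -> B) (ds : seq bidegree) (xs : seq A) : B :=
  \sum_(0 <= j < size xs)
     sg (tdeg (take j ds)) *: phi (set_nth 0 xs j (D (nth 0 xs j))).

(* [D, phi] for phi of total degree z, where D consists of DA and DB, both of *)
(* total degree 1.                                                            *)
Definition bracket (A B : bicomplex) (DA : A -> A) (DB : B -> B) (z : int)
    (phi : seq A -> B) (ds : seq bidegree) (xs : seq A) : B :=
  DB (phi xs) - sg z *: leibniz DA phi ds xs.

(* phi (id^r (x) psi (x) id^s) for psi of arity l and total degree z. *)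
Definition comp_at (A : bicomplex) (B : lmodType k) (phi : seq A -> B)
    (r l : nat) (z : int) (psi : seq A -> A) (ds : seq bidegree)
    (xs : seq A) : B :=
  sg (z * tdeg (take r ds)) *:
    phi (take r xs ++ psi (take l (drop r xs)) :: drop (r + l)%N xs).

(* The families below are indexed by the arity and the bidegree. *)
Definition operations (A B : lmodType k) := nat -> int -> int -> seq A -> B.

(* The list of the values of f_{i_1}^{p_1,q_1} (x) ... (x) f_{i_m}^{p_m,q_m}, *)
(* with ms = [:: i_1; ..; i_m], ps = [:: p_0; p_1; ..; p_m], and qs alike.    *)
Definition tensor_vals (A B : lmodType k) (f : operations A B) (ms : seq nat)
    (ps qs : seq int) (xs : seq A) : seq B :=
  [seq f (nth 0%N ms j) (nth 0 ps j.+1) (nth 0 qs j.+1)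
         (nth [::] (reshape ms xs) j) | j <- iota 0 (size ms)].

Definition tensor_koszul (ms : seq nat) (ps qs : seq int)
    (ds : seq bidegree) : int :=
  \sum_(0 <= j < size ms)
     (nth 0 ps j.+1 + nth 0 qs j.+1) * tdeg (take (sumn (take j ms)) ds).

End BigradedSpaces.
Arguments homog {k b}.
Arguments del {k b}.
Arguments delbar {k b}.

(* The lists of m natural numbers with sum n. *)
Definition weak_comps (m n : nat) : seq (seq nat) :=
  [seq [seq val i | i <- tval t] |
     t <- enum {: m.-tuple 'I_n.+1} & sumn [seq val i | i <- tval t] == n].

Definition comps (m n : nat) : seq (seq nat) :=
  [seq s <- weak_comps m n | all (leq 1) s].

(* The lists of m integers <= 0 with sum p; the operations vanish outside     *)
(* nonpositive bidegrees, so other splittings of p never contribute.          *)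
Definition splits (m : nat) (p : int) : seq (seq int) :=
  if p <= 0 then [seq [seq - a%:Z | a <- s] | s <- weak_comps m (absz p)]
  else [::].

Lemma mem_weak_comps m n s :
  (s \in weak_comps m n) = (size s == m) && (sumn s == n).
Proof.
apply/mapP/andP => [[t]|[/eqP sz_s /eqP sum_s]].
  by rewrite mem_filter => /andP[/eqP st _] ->; rewrite size_map size_tuple st.
have le_s i : i \in s -> (i <= n)%N.
  move: sum_s => <-; elim: s {sz_s} => //= j s IHs; rewrite inE.
  by case/predU1P=> [->|/IHs/leq_trans-> //]; rewrite ?leq_addr ?leq_addl.
have sz : size [seq (inord i : 'I_n.+1) | i <- s] == m by rewrite size_map sz_s.
have eqs : [seq val i | i <- [seq (inord i : 'I_n.+1) | i <- s]] = s.
  rewrite -map_comp -[RHS]map_id; apply/eq_in_map => i /le_s le_i /=.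
  by rewrite inordK.
exists (Tuple sz); last by rewrite /= eqs.
by rewrite mem_filter mem_enum andbT /= eqs sum_s.
Qed.

Lemma uniq_weak_comps m n : uniq (weak_comps m n).
Proof.
rewrite map_inj_uniq ?filter_uniq -?enumT ?enum_uniq // => t u /=.
by move/(inj_map val_inj)/val_inj.
Qed.

Lemma mem_splits m p s :
  (s \in splits m p) =
    [&& size s == m, all (fun x => x <= 0) s & \sum_(x <- s) x == p].
Proof.
have sumN (t : seq nat) :
    \sum_(x <- [seq - a%:Z | a <- t]) x = - (sumn t)%:Z :> int.
  elim: t => [|a t IHt] /=; first by rewrite big_nil oppr0.
  by rewrite big_cons IHt PoszD opprD.
have eqs : all (fun x : int => x <= 0) s -> s = [seq - a%:Z | a <- map absz s].
  move=> /allP s_le; rewrite -map_comp -[LHS]map_id; apply/eq_in_map => x xs /=.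
  by rewrite abszE ler0_norm ?opprK ?s_le.
rewrite /splits; case: ifPn => [p_le0|p_gt0]; last first.
  apply/esym/negP => /and3P[_ /eqs-> /eqP]; rewrite sumN => sum_s.
  by rewrite -sum_s oppr_le0 in p_gt0.
apply/mapP/and3P => [[t]|[/eqP sz_s s_le /eqP sum_s]].
  rewrite mem_weak_comps => /andP[/eqP sz_t /eqP sum_t] ->; split.
  - by rewrite size_map sz_t.
  - by apply/allP => _ /mapP[a _ ->]; rewrite oppr_le0.
  - by rewrite sumN sum_t abszE ler0_norm ?opprK.
exists (map absz s); last exact: eqs.
rewrite mem_weak_comps size_map sz_s eqxx /=.
by rewrite -sum_s [X in \sum_(x <- X) x](eqs s_le) sumN abszN absz_nat.
Qed.

Lemma splits0 : splits 2 0 = [:: [:: 0; 0]].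
Proof.
have u : uniq (splits 2 0).
  rewrite /splits map_inj_uniq.
    exact: uniq_weak_comps.
  by apply: inj_map => a b /oppr_inj[].
have m s : s \in splits 2 0 -> s = [:: 0; 0].
  rewrite mem_splits => /and3P[].
  case: s => [|a [|b []]] //= _ /and3P[a0 b0 _].
  rewrite !big_cons big_nil addr0 => /eqP ab.
  have a00 : a = 0 by apply/le_anti; rewrite a0 -(lerD2r b) ab add0r.
  by move: ab; rewrite a00 add0r => ->.
have i : [:: 0; 0] \in splits 2 0.
  by rewrite mem_splits /= !big_cons big_nil !addr0 eqxx.
case: (splits 2 0) u m i => [|x [|y t]] //=.
- by move=> _ m _; rewrite (m x) ?mem_head.
- move=> /andP[xt _] m _; move: xt.
  by rewrite (m x) ?mem_head // (m y) ?inE ?eqxx ?orbT.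
Qed.

Section Pluripotential.
Variable k : fieldType.

Definition alg_index (n : nat) (p q : int) : bool :=
  [&& (2 <= n)%N &
      [&& p + q == 2 - n%:Z, p <= 0 & q <= 0]
   || [&& p + q == 1 - n%:Z, p <= -1 & q <= -1]].

Definition mor_index (n : nat) (p q : int) : bool :=
  [&& (1 <= n)%N &
      [&& p + q == 1 - n%:Z, p <= 0 & q <= 0]
   || [&& p + q == - n%:Z, p <= -1 & q <= -1]].

(* The double sum in the structure equations of mu_n^{p,q}, with inner sum    *)
(* over indices of total (P, Q).                                              *)
Definition alg_sum (A : bicomplex k) (mu : operations A A)
    (n : nat) (p q P Q : int) (ds : seq bidegree) (xs : seq A) : A :=
  \sum_(2 <= m < n.+1) \sum_(2 <= l < n.+1 | (m + l == n.+1)%N)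
  \sum_(1 <= i < m.+1) \sum_(ps <- splits 2 P) \sum_(qs <- splits 2 Q)
    let: (p1, p2) := (nth 0 ps 0, nth 0 ps 1) in
    let: (q1, q2) := (nth 0 qs 0, nth 0 qs 1) in
    let eps := (p1 + q1) * (l%:Z + p2 + q2) + (p + q + n%:Z) in
    sg k ((i * (l + 1))%N%:Z + n%:Z + eps) *:
      comp_at (mu m p1 q1) i.-1 l (p2 + q2) (mu l p2 q2) ds xs.

(* The structure equations are required at the indices at which mu_n^{p,q}    *)
(* may be nonzero.  They are not meant at p + q = -n: there they would read   *)
(* 0 = q mu_n^{p+1,q} + ..., and would make all of mu_n, n >= 3, vanish.      *)
(* The equations of infinity-morphisms are read in the same way.              *)
Record pluripotential_Ainf (A : bicomplex k) (mu : operations A A) : Prop :=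
  PluripotentialAinf {
    pA_multilinear : forall n p q, (2 <= n)%N -> multilinear n (mu n p q);
    pA_bidegree : forall n p q, (2 <= n)%N -> has_bidegree n p q (mu n p q);
    pA_vanish : forall n p q xs, (2 <= n)%N -> ~~ alg_index n p q ->
      size xs = n -> mu n p q xs = 0;
    pA_del : forall n p q ds xs, alg_index n p q ->
      size xs = n -> all_homog ds xs ->
      bracket del del (p + q) (mu n p q) ds xs =
      q%:~R *: mu n (p + 1) q xs + alg_sum mu n p q (p + 1) q ds xs;
    pA_delbar : forall n p q ds xs, alg_index n p q ->
      size xs = n -> all_homog ds xs ->
      bracket delbar delbar (p + q) (mu n p q) ds xs =
      - p%:~R *: mu n p (q + 1) xs + alg_sum mu n p q p (q + 1) ds xs }.

(* The sums in the equations of f_n^{p,q}, with inner sums over indices of    *)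
(* total (P, Q).                                                              *)
Definition mor_sum1 (A B : bicomplex k) (nu : operations B B)
    (f : operations A B) (n : nat) (p q P Q : int)
    (ds : seq bidegree) (xs : seq A) : B :=
  \sum_(2 <= m < n.+1) \sum_(ms <- comps m n)
  \sum_(ps <- splits m.+1 P) \sum_(qs <- splits m.+1 Q)
    let i j := (nth 0%N ms j.-1)%:Z in
    let p_ j := nth 0 ps j in
    let q_ j := nth 0 qs j in
    let theta :=
      \sum_(1 <= s < m.+1) \sum_(1 <= r < s) i r * (i s + 1) in
    let eps1 :=
      \sum_(1 <= j < m.+1)
        (\sum_(0 <= r < j) (p_ r + q_ r)) * (p_ j + q_ j + i j + 1)
      + p + q + n%:Z + 1 in
    sg k (theta + eps1) *:
      (sg k (tensor_koszul ms ps qs ds) *: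
        nu m (p_ 0%N) (q_ 0%N) (tensor_vals f ms ps qs xs)).

Definition mor_sum2 (A B : bicomplex k) (mu : operations A A)
    (f : operations A B) (n : nat) (p q P Q : int)
    (ds : seq bidegree) (xs : seq A) : B :=
  \sum_(1 <= m < n.+1) \sum_(2 <= l < n.+1 | (m + l == n.+1)%N)
  \sum_(0 <= r < m) \sum_(ps <- splits 2 P) \sum_(qs <- splits 2 Q)
    let: (p1, p2) := (nth 0 ps 0, nth 0 ps 1) in
    let: (q1, q2) := (nth 0 qs 0, nth 0 qs 1) in
    let eps2 := (p1 + q1) * (p2 + q2 + l%:Z) + p + q + n%:Z + 1 in
    sg k ((r * (1 + l))%N%:Z + m%:Z + eps2) *:
      comp_at (f m p1 q1) r l (p2 + q2) (mu l p2 q2) ds xs.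

Record pluripotential_inf_morphism (A B : bicomplex k) (mu : operations A A)
    (nu : operations B B) (f : operations A B) : Prop :=
  PluripotentialInfMorphism {
    pM_multilinear : forall n p q, (1 <= n)%N -> multilinear n (f n p q);
    pM_bidegree : forall n p q, (1 <= n)%N -> has_bidegree n p q (f n p q);
    pM_vanish : forall n p q xs, (1 <= n)%N -> ~~ mor_index n p q ->
      size xs = n -> f n p q xs = 0;
    pM_del : forall n p q ds xs, mor_index n p q ->
      size xs = n -> all_homog ds xs ->
      bracket del del (p + q) (f n p q) ds xs =
      q%:~R *: f n (p + 1) q xs - mor_sum1 nu f n p q (p + 1) q ds xs
      - mor_sum2 mu f n p q (p + 1) q ds xs;
    pM_delbar : forall n p q ds xs, mor_index n p q ->
      size xs = n -> all_homog ds xs ->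
      bracket delbar delbar (p + q) (f n p q) ds xs =
      - p%:~R *: f n p (q + 1) xs - mor_sum1 nu f n p q p (q + 1) ds xs
      - mor_sum2 mu f n p q p (q + 1) ds xs }.

Definition is_shuffle (i j : nat) (s : 'S_(i + j)) : bool :=
  [forall a : 'I_(i + j), forall b : 'I_(i + j),
     (a < b)%N && ((b < i)%N || (i <= a)%N) ==> (s a < s b)%N].

Definition koszul_perm (n : nat) (s : 'S_n) (ds : seq bidegree) : int :=
  \sum_(a < n) \sum_(b < n | (a < b)%N && (s b < s a)%N)
    tdeg [:: nth (0, 0) ds a] * tdeg [:: nth (0, 0) ds b].

(* s moves the tensor factor in position a to position s a. *)
Definition perm_seq (T : Type) (x0 : T) (n : nat) (s : 'S_n) (xs : seq T) :
    seq T :=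
  [seq nth x0 xs (s^-1%g b) | b <- enum 'I_n].

Definition precomp_tau (A : bicomplex k) (B : lmodType k) (i j : nat)
    (phi : seq A -> B) (ds : seq bidegree) (xs : seq A) : B :=
  \sum_(s : 'S_(i + j) | is_shuffle s)
    ((-1) ^+ s * sg k (koszul_perm s ds)) *: phi (perm_seq 0 s xs).

Definition vanishes_on_shuffles (A B : bicomplex k) (f : operations A B) :
    Prop :=
  forall (i j : nat) (p q : int) (ds : seq bidegree) (xs : seq A),
  (1 <= i)%N -> (1 <= j)%N -> p <= 0 -> q <= 0 ->
  size xs = (i + j)%N -> all_homog ds xs ->
  precomp_tau i j (f (i + j)%N p q) ds xs = 0.

Definition pluripotential_Cinf (A : bicomplex k) (mu : operations A A) : Prop :=
  pluripotential_Ainf mu /\ vanishes_on_shuffles mu.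

Definition pluripotential_Cinf_morphism (A B : bicomplex k)
    (mu : operations A A) (nu : operations B B) (f : operations A B) : Prop :=
  pluripotential_inf_morphism mu nu f /\ vanishes_on_shuffles f.

Definition pluripotential_Cinf_weak_equivalence (A B : bicomplex k)
    (mu : operations A A) (nu : operations B B) (f : operations A B) : Prop :=
  pluripotential_Cinf_morphism mu nu f /\
  pluripotential_weak_equivalence (fun x => f 1%N 0 0 [:: x]).

Definition cbba_operations (A : cbba k) : operations A A := fun n p q xs =>
  if [&& n == 2%N, p == 0 & q == 0] then cmul (nth 0 xs 0) (nth 0 xs 1) else 0.

End Pluripotential.

Section CbbaOperations.
Variable k : fieldType.
Variable A : cbba k.
Local Notation mu := (@cbba_operations k A).

Lemma cmul0l (b : A) : cmul 0 b = 0.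
Proof.
by have := cmul_linear_l b (-1) 0 0; rewrite scaler0 addr0 scaleN1r addNr.
Qed.

Lemma cmul0r (a : A) : cmul a 0 = 0.
Proof.
by have := cmul_linear_r a (-1) 0 0; rewrite scaler0 addr0 scaleN1r addNr.
Qed.

Lemma cbba_operations0 n p q xs :
  [&& n == 2%N, p == 0 & q == 0] = false -> mu n p q xs = 0.
Proof. by rewrite /cbba_operations => ->. Qed.

Lemma comp_at_cbba0 m p1 q1 r l p2 q2 z ds xs : (r < 2)%N ->
  [&& m == 2%N, p1 == 0 & q1 == 0] &&
    [&& l == 2%N, p2 == 0 & q2 == 0] = false ->
  comp_at (mu m p1 q1) r l z (mu l p2 q2) ds xs = 0.
Proof.
rewrite /comp_at => r2; case h : [&& m == 2%N, p1 == 0 & q1 == 0] => /= h'.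
  rewrite (cbba_operations0 _ h') {h'}/cbba_operations h.
  have : (size (take r xs) < 2)%N.
    by rewrite size_take_min; apply: leq_ltn_trans r2; rewrite geq_minl.
  by case: (take r xs) => [|a []] //= _; rewrite ?cmul0l ?cmul0r scaler0.
by rewrite (cbba_operations0 _ h) scaler0.
Qed.

Lemma splits2_cases P s : s \in splits 2 P ->
  nth 0 s 0 + nth 0 s 1 = P.
Proof.
rewrite mem_splits => /and3P[].
case: s => [|a [|b []]] //= _ _.
by rewrite !big_cons big_nil addr0 => /eqP.
Qed.

Lemma alg_sum_cbba0 n p q P Q ds xs :
  [&& n == 3%N, P == 0 & Q == 0] = false ->
  alg_sum mu n p q P Q ds xs = 0.
Proof.
move=> h; rewrite /alg_sum.
apply: big1_seq => m _; apply: big1_seq => l /andP[/eqP ml _].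
apply: big1_seq => i /=; rewrite mem_index_iota => /andP[i1 im].
apply: big1_seq => ps /= /splits2_cases Pp.
apply: big1_seq => qs /= /splits2_cases Pq.
case m2 : (m == 2%N); last first.
  by rewrite /comp_at cbba_operations0 ?m2 // !scaler0.
rewrite comp_at_cbba0 ?scaler0 //.
  by move: im i1; rewrite (eqP m2); case: i => [|[|[|]]].
rewrite m2 /=; apply/negP.
case/and3P=> /andP[/eqP p1 /eqP q1] /eqP l2 /andP[/eqP p2 /eqP q2].
move: h; rewrite -Pp -Pq p1 p2 q1 q2 !addr0 !eqxx !andbT.
by rewrite -(eqn_add2r 1) !addn1 -ml l2 (eqP m2).
Qed.

Lemma alg_sum_cbba n p q P Q ds xs : size xs = n -> p + q + 1 = P + Q ->
  alg_sum mu n p q P Q ds xs = 0.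
Proof.
move=> sz pq; case c : [&& n == 3%N, P == 0 & Q == 0]; last first.
  exact: alg_sum_cbba0.
case/and3P: c pq => /eqP n3 /eqP-> /eqP-> pq; move: sz; rewrite n3.
case: xs => [|a [|b [|c []]]] // _.
rewrite /alg_sum splits0 unlock /= /comp_at /cbba_operations /= cmulA.
have -> : p + q = - 1 by apply: (addIr 1); rewrite pq addNr.
rewrite /sg !mul0r !expr0z !scale1r !addr0.
have -> : (1 * (2 + 1))%N%:Z + 3%:Z + (0 * 2%:Z + (- 1 + 3%:Z)) = 8%:Z by [].
have -> : (2 * (2 + 1))%N%:Z + 3%:Z + (0 * 2%:Z + (- 1 + 3%:Z)) = 11%:Z by [].
by rewrite -!exprnP -(signr_odd _ 8) -(signr_odd _ 11) /= scale1r
  scaleN1r subrr.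
Qed.

Lemma cbba_bracket (D : A -> A) ds xs :
  (forall p q a b, homog (p, q) a ->
    D (cmul a b) = cmul (D a) b + sg k (p + q) *: cmul a (D b)) ->
  size xs = 2%N -> all_homog ds xs -> bracket D D 0 (mu 2%N 0 0) ds xs = 0.
Proof.
move=> HD sz [szd h]; move: szd h; rewrite sz.
case: ds => [|[p1 q1] [|d2 []]] //= _; case: xs sz => [|a [|b []]] // _ h.
rewrite /bracket /leibniz /cbba_operations unlock /=.
rewrite (HD _ _ _ _ (h 0%N isT)) /tdeg /bideg unlock /=.
by rewrite /sg !addr0 expr0z !scale1r subrr.
Qed.

Lemma cbba_Cinf : pluripotential_Cinf mu.
Proof.
have lin n p q : multilinear n (mu n p q).
  move=> s t c x y; rewrite /cbba_operations.
  case: ifP => [/andP[/eqP-> _]|_] sz; last by rewrite scaler0 addr0.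
  case: s t sz => [|a [|b s]] [|b' [|c' t]] //=.
    by rewrite cmul_linear_l.
  by rewrite cmul_linear_r.
have brk (D : {linear A -> A}) n p q ds xs :
    (forall p q a b, homog (p, q) a ->
      D (cmul a b) = cmul (D a) b + sg k (p + q) *: cmul a (D b)) ->
    size xs = n -> all_homog ds xs -> bracket D D (p + q) (mu n p q) ds xs = 0.
  move=> HD sz h; case c : [&& n == 2%N, p == 0 & q == 0].
    case/and3P: c sz => /eqP-> /eqP-> /eqP-> sz; rewrite addr0.
    exact: cbba_bracket.
  rewrite /bracket /leibniz cbba_operations0 // raddf0 big1 ?scaler0 ?subr0 //.
  by move=> j _; rewrite cbba_operations0 ?scaler0.
split; first split.
- by move=> n p q _; apply: lin.
- move=> n p q _ ds xs sz [szd h]; rewrite /cbba_operations.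
  case: ifP => [/and3P[/eqP n2 /eqP-> /eqP->]|_]; last first.
    exact: (bigr_0 (homog_bigrading A)).
  move: sz; rewrite n2 => sz; move: szd h; rewrite sz.
  case: ds => [|[p1 q1] [|[p2 q2] []]] //= _ h.
  rewrite /bideg !big_cons !big_nil /= !addr0.
  by apply: cmul_homog; [apply: (h 0%N) | apply: (h 1%N)].
- move=> n p q xs n2 h sz; apply: cbba_operations0; apply: contraNF h.
  by case/and3P=> /eqP-> /eqP-> /eqP->.
- move=> n p q ds xs hi sz h; rewrite brk //; last exact: cmul_del.
  rewrite alg_sum_cbba ?addr0 //; last by rewrite addrAC.
  case c : [&& n == 2%N, p + 1 == 0 & q == 0]; last first.
    by rewrite cbba_operations0 ?scaler0.
  by case/and3P: c => _ _ /eqP->; rewrite scale0r.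
- move=> n p q ds xs hi sz h; rewrite brk //; last exact: cmul_delbar.
  rewrite alg_sum_cbba ?addr0 //; last by rewrite addrA.
  case c : [&& n == 2%N, p == 0 & q + 1 == 0]; last first.
    by rewrite cbba_operations0 ?scaler0.
  by case/and3P: c => _ /eqP-> _; rewrite mulr0z oppr0 scale0r.
move=> i j p q ds xs i1 j1 _ _ sz [szd h].
case c : [&& (i + j == 2)%N, p == 0 & q == 0]; last first.
  by apply: big1 => s _; rewrite cbba_operations0 ?scaler0.
case/and3P: c => /eqP ij /eqP-> /eqP->.
have [i1' j1'] : i = 1%N /\ j = 1%N.
  by case: i j i1 j1 ij {sz} => [|[|i]] [|[|j]] //= _ _; rewrite addnS.
subst i j; rewrite {i1 j1 ij} sz in szd h.
have ord2 (b : 'I_(1 + 1)) : b = 0 \/ b = 1.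
  by case: b => [[|[|]]] // ?; [left | right]; apply: val_inj.
have s2 (s : 'S_(1 + 1)) : s != 1%g -> s = tperm 0 1.
  move=> s1; have s0 : s 0 = 1.
    case: (ord2 (s 0)) => // s0; case/eqP: s1; apply/permP => b; rewrite perm1.
    case: (ord2 b) => -> //; case: (ord2 (s 1)) => // s1.
    by have /perm_inj : s 1 = s 0 by rewrite s0.
  apply/permP => b; case: (ord2 b) => ->; rewrite ?tpermL ?tpermR //.
  case: (ord2 (s 1)) => // s1'.
  by have /perm_inj : s 1 = s 0 by rewrite s0.
have shf (s : 'S_(1 + 1)) : is_shuffle s.
  by apply/forallP=> a; apply/forallP=> b;
    case: (ord2 a) (ord2 b) => [] -> [] ->.
have t1 : tperm (0 : 'I_(1 + 1)) 1 != 1%g.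
  by apply/eqP => /permP/(_ 0); rewrite tpermL perm1.
have enumE : enum 'I_(1 + 1) = [:: 0; 1].
  by apply: (inj_map val_inj); rewrite val_enum_ord.
rewrite /precomp_tau (bigD1 1%g) ?shf //= (bigD1 (tperm 0 1)) ?shf ?t1 //=.
rewrite big1 => [|s /andP[/andP[_ /s2->]]]; last by rewrite eqxx.
rewrite /cbba_operations /= /perm_seq enumE /= invg1 !perm1.
rewrite tpermV tpermL tpermR.
have lift01 : lift ord0 ord0 = 1 :> 'I_(1 + 1) by apply: val_inj.
have kosE (s : 'S_(1 + 1)) : koszul_perm s ds =
    if (s 1%R < s 0%R)%N
    then tdeg [:: nth (0, 0) ds 0] * tdeg [:: nth (0, 0) ds 1]
    else 0.
  rewrite /koszul_perm; under eq_bigr do rewrite big_mkcond.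
  rewrite !big_ord_recl !big_ord0 /= !lift01 (_ : ord0 = 0) /=;
    last exact: val_inj.
  by rewrite !addr0 !add0r.
rewrite !kosE !perm1 tpermL tpermR /= addr0.
rewrite odd_perm1 odd_tperm /= !expr0 expr1 /sg expr0z mulr1 scale1r.
rewrite /tdeg /bideg !unlock /= !addr0.
case: ds {kosE} szd h => [|[d1 e1] [|[d2 e2] []]] //= _ h.
rewrite (cmul_comm (h 0%N isT) (h 1%N isT)) /sg mulN1r scaleNr subrr //.
Qed.
End CbbaOperations.

(* Main.v *)
(** The bicomplex A is the direct sum of a minimal bicomplex H and of a part
    contracted by a homotopy h of bidegree (-1, -1): 1 - i pi = -[del, [delbar, h]],
    with i and pi the inclusion and the projection.  The operator
      K = delbar h - h delbar + h del - del h
    satisfies del K + K del = delbar K + K delbar = i pi - 1, but usual homotopy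
    transfer along K does not keep track of the bidegrees.  Adjoin an odd
    parameter: on pairs (x, y), del is replaced by
      (x, y) |-> (del x, q x - del y)   for x of bidegree (p, q),
    delbar likewise with the weight -p, and K by (x, y) |-> (K x, h x - K y).
    The latter is one and the same contracting homotopy for both differentials,
    so the operations produced by the transfer formulas, which involve only the
    product and the homotopy, satisfy the A-infinity equations and the equations
    of infinity-morphisms for both differentials.  Their two components are sums
    of operations of total degree 2 - n and 1 - n (or 1 - n and - n for the
    morphism); the weights give the terms q mu_n^{p+1,q} and - p mu_n^{p,q+1},
    and the bihomogeneous components are the required mu_n^{p,q} and f_n^{p,q}.

    The transfer formulas iterate deconcatenation, the homotopy and a product
    that is graded antisymmetric after suspension, so they vanish on shuffles. *)

From HB Require Import structures.
Require Import Defs.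
From mathcomp Require Import all_boot all_order all_fingroup all_algebra.
From mathcomp Require Import boolp classical_sets.
From mathcomp Require Import zify ring.
Set Implicit Arguments.
Unset Strict Implicit.
Unset Printing Implicit Defensive.
Import Order.TTheory GRing.Theory Num.Theory.
Local Open Scope ring_scope.

(** * Identities in abelian groups *)

(** The coefficients q and -p in the structure equations are eigenvalues of grading operators, which
    suggests deforming each differential by the odd parameter times such an operator. The
    contraction identity for the deformed differential then requires a correction of [K] whose
    commutator with the differential equals the commutator of the grading operator with [K]. Since
    [K] is the sum of a part of bidegree (-1, 0) and a part of bidegree (0, -1), each grading
    operator detects just one of them, and [h] itself is the correction in both directions. The
    parameter has square zero, so an operation contains at most one such correction, and its total
    degree is then one lower: the two components can be added and separated again by bidegree. The
    other obstacle is signs. The transfer is carried out on the suspension, where every sign comes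
    from moving an odd map past letters; the signs prescribed by the definitions are recovered at
    the end, by comparing exponents modulo 2. *)

Inductive zterm := ZVar of nat | ZZero | ZAdd of zterm & zterm | ZOpp of zterm.

Fixpoint zeval (V : zmodType) (env : seq V) (t : zterm) : V :=
  match t with
  | ZVar n => nth 0 env n
  | ZZero => 0
  | ZAdd t1 t2 => zeval env t1 + zeval env t2
  | ZOpp t1 => - zeval env t1
  end.

Fixpoint zcoef (t : zterm) (i : nat) : int :=
  match t with
  | ZVar n => (n == i)%:Z
  | ZZero => 0
  | ZAdd t1 t2 => zcoef t1 i + zcoef t2 i
  | ZOpp t1 => - zcoef t1 i
  end.

Lemma zevalE (V : zmodType) (env : seq V) t :
  zeval env t = \sum_(i < size env) nth 0 env i *~ zcoef t i.
Proof.
elim: t => /= [n||t1 -> t2 ->|t1 ->].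
- have [nsz|nsz] := ltnP n (size env); last first.
    rewrite nth_default // big1 // => i _.
    by rewrite gtn_eqF ?mulr0z // (leq_trans (ltn_ord i)).
  rewrite (bigD1 (Ordinal nsz)) //= eqxx mulr1z big1 ?addr0 // => i.
  by rewrite -val_eqE /= eq_sym => /negPf->; rewrite mulr0z.
- by rewrite big1 // => i _; rewrite mulr0z.
- by rewrite -big_split; apply: eq_bigr => i _; rewrite mulrzDr.
- by rewrite -sumrN; apply: eq_bigr => i _; rewrite mulrNz.
Qed.

(** Both sides are integer combinations of the atoms in [env], so an identity valid in all abelian
    groups is proved by computing coefficients. *)
Lemma zmodule_eq (V : zmodType) (env : seq V) t1 t2 :
  all (fun i => zcoef t1 i == zcoef t2 i) (iota 0 (size env)) ->
  zeval env t1 = zeval env t2.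
Proof.
move=> /allP t12; rewrite !zevalE; apply: eq_bigr => i _.
by have /eqP-> : zcoef t1 i == zcoef t2 i by apply: t12; rewrite mem_iota ltn_ord.
Qed.

(* Equality of atoms up to the inferred algebraic structures that occur in
   applications of linear maps. *)
Ltac zsame x y :=
  first [ constr_eq x y
        | let t := type of x in lazymatch t with Type => idtac | Set => idtac end
        | lazymatch x with
          | @GRing.Linear.sort _ _ _ _ ?f ?a =>
            lazymatch y with
            | @GRing.Linear.sort _ _ _ _ ?g ?b => zsame f g; zsame a b
            end
          | @GRing.scale _ _ ?f ?a =>
            lazymatch y with
            | @GRing.scale _ _ ?g ?b => zsame f g; zsame a b
            end
          | ?f ?a => lazymatch y with ?g ?b => zsame f g; zsame a b end
          end ].
Ltac zmember x l :=
  lazymatch l with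
  | nil => constr:(false)
  | ?y :: ?l' => match constr:(Set) with
    | _ => let _ := match constr:(Set) with _ => zsame x y end in constr:(true)
    | _ => zmember x l'
    end
  end.
Ltac zindex x l :=
  lazymatch l with
  | ?y :: ?l' => match constr:(Set) with
    | _ => let _ := match constr:(Set) with _ => zsame x y end in constr:(0%N)
    | _ => let n := zindex x l' in constr:(S n)
    end
  end.
Ltac zatoms l t :=
  lazymatch t with
  | (?a + ?b)%R => let l1 := zatoms l a in zatoms l1 b
  | (- ?a)%R => zatoms l a
  | 0%R => l
  | _ => let m := zmember t l in
         lazymatch m with true => l | false => constr:(t :: l) end
  end.
Ltac zreify l t :=
  lazymatch t with
  | (?a + ?b)%R => let a' := zreify l a in let b' := zreify l b in constr:(ZAdd a' b')
  | (- ?a)%R => let a' := zreify l a in constr:(ZOpp a')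
  | 0%R => constr:(ZZero)
  | _ => let n := zindex t l in constr:(ZVar n)
  end.
Ltac zmodule :=
  lazymatch goal with
  | |- @eq ?T ?x ?y =>
    let l0 := zatoms (@nil T) x in let l := zatoms l0 y in
    let x' := zreify l x in let y' := zreify l y in
    refine (@zmodule_eq _ l x' y' _); vm_compute; reflexivity
  end.
(** * Bigraded vector spaces *)

Definition mklinear (k : fieldType) (V W : lmodType k) (f : V -> W)
    (lf : linear f) : {linear V -> W} :=
  HB.pack f (GRing.isLinear.Build _ _ _ _ f lf).

Section LinearAlgebra.
Variables (k : fieldType) (V W : lmodType k).

(** Zorn's lemma gives a maximal subspace [C] meeting [U] trivially. If [x] were outside [U + C],
    the span of [C] and [x] would still meet [U] trivially. *)
Lemma complement_exists (U : V -> Prop) :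
  U 0 -> (forall (c : k) x y, U x -> U y -> U (c *: x + y)) ->
  exists C : V -> Prop,
    [/\ C 0, forall (c : k) x y, C x -> C y -> C (c *: x + y),
        forall x, U x -> C x -> x = 0
      & forall x, exists u c, [/\ U u, C c & x = u + c]].
Proof.
move=> U0 Ulin.
pose P (C : set V) := (forall (c : k) x y, C x -> C y -> C (c *: x + y)) /\
  forall x, U x -> C x -> x = 0.
have [F FP Ftot|C [[Clin CU] Cmax]] := @Zorn_bigcup V P.
  split=> [c x y [X FX Xx] [Y FY Yy]|x Ux [X FX Xx]]; last first.
    exact: (FP _ FX).2.
  have [XY|YX] := Ftot _ _ FX FY.
  - by exists Y => //; apply: (FP _ FY).1 => //; apply: XY.
  - by exists X => //; apply: (FP _ FX).1 => //; apply: YX.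
(* The empty set, being the union of the empty chain, also satisfies [P]; that [C] contains 0 has to
   come from maximality. *)
have C0 : C 0.
  apply: contrapT => nC0.
  have nC x : ~ C x.
    by move=> Cx; apply: nC0; have := Clin (-1) x x Cx Cx; rewrite scaleN1r addNr.
  apply: (Cmax [set 0]%classic).
    by split=> [x /nC//|] /(_ 0 erefl).
  by split=> [c x y -> ->|x _ ->//]; rewrite /set1 /= scaler0 addr0.
exists C; split=> // x; apply: contrapT => nx.
pose C' : set V := fun y => exists (a : k) c, C c /\ y = a *: x + c.
apply: (Cmax C').
  split=> [y Cy|/(_ x) CC]; first by exists 0, y; rewrite scale0r add0r.
  apply: nx; exists 0, x; rewrite add0r; split=> //.
  by apply: CC; exists 1, 0; rewrite scale1r addr0.
split=> [c y z [a [u [Cu ->]]] [b [v [Cv ->]]]|y Uy [a [c [Cc yE]]]].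
  exists (c * a + b), (c *: u + v); split; first exact: Clin.
  by rewrite scalerDr scalerA scalerDl addrACA.
have [a0|a0] := eqVneq a 0.
  by apply: CU => //; rewrite yE a0 scale0r add0r.
case: nx; exists (a^-1 *: y), (- a^-1 *: c); split.
- by rewrite -[X in U X]addr0; apply: Ulin.
- by rewrite -[X in C X]addr0; apply: Clin.
- by rewrite yE scalerDr scalerA mulVf // scale1r scaleNr addrK.
Qed.

End LinearAlgebra.

(** With complements [C] of the kernel and [D] of the image, [h y] is the unique [w] in [C] such
    that [y - L w] lies in [D]; uniqueness makes [h] linear. *)
Lemma generalized_inverse (k : fieldType) (V W : lmodType k)
    (L : {linear V -> W}) :
  exists h : {linear W -> V}, forall x, L (h (L x)) = L x.
Proof.
have [||C [C0 Clin CK CT]] := @complement_exists k V (fun x => L x = 0).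
- exact: raddf0.
- by move=> c x y Lx Ly; rewrite linearP Lx Ly scaler0 addr0.
have [||D [D0 Dlin DI DT]] := @complement_exists k W (fun y => exists x, y = L x).
- by exists 0; rewrite raddf0.
- by move=> c _ _ [x ->] [y ->]; exists (c *: x + y); rewrite linearP.
have [|h hP] := @choice W V (fun y w => C w /\ D (y - L w)).
  move=> y; have [_ [d [[x ->] Dd ->]]] := DT y.
  have [u [w [Lu Cw ->]]] := CT x.
  by exists w; split; rewrite // raddfD /= Lu add0r addrC addKr.
have hU y w : C w -> D (y - L w) -> h y = w.
  move=> Cw Dw; have [Ch Dh] := hP y; apply/eqP; rewrite -subr_eq0; apply/eqP.
  apply: CK; last by rewrite -scaleN1r addrC; apply: Clin.
  apply: DI; first by exists (h y - w).
  suff -> : L (h y - w) = -1 *: (y - L (h y)) + (y - L w) by apply: Dlin.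
  by rewrite scaleN1r raddfB opprB addrA subrK.
have hlin : linear h.
  move=> c x y; have [[Cx Dx] [Cy Dy]] := (hP x, hP y).
  apply: hU; first exact: Clin.
  rewrite linearP /= (_ : _ - _ = c *: (x - L (h x)) + (y - L (h y))).
    exact: Dlin.
  by rewrite scalerBr opprD addrACA.
exists (mklinear hlin) => x.
have [Ch Dh] := hP (L x); apply/esym/eqP; rewrite -subr_eq0; apply/eqP.
by apply: DI => //; exists (x - h (L x)); rewrite raddfB.
Qed.

Section Bigrading.
Variables (k : fieldType) (V : lmodType k) (gr : bidegree -> V -> Prop).
Hypothesis Vgr : is_bigrading gr.

Lemma bigrD d x y : gr d x -> gr d y -> gr d (x + y).
Proof. by move=> gx gy; rewrite -[x]scale1r; apply: bigr_lin. Qed.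

Lemma bigrZ d (c : k) x : gr d x -> gr d (c *: x).
Proof. by move=> gx; rewrite -[_ *: _]addr0; apply: bigr_lin (bigr_0 Vgr d). Qed.

Lemma bigrN d x : gr d x -> gr d (- x).
Proof. by move=> gx; rewrite -scaleN1r; apply: bigrZ. Qed.

Lemma bigrB d x y : gr d x -> gr d y -> gr d (x - y).
Proof. by move=> gx /bigrN; apply: bigrD. Qed.

Lemma bigr_decomp : exists (gsupp : V -> seq bidegree) (cmp : bidegree -> V -> V),
  forall x, [/\ uniq (gsupp x), forall d, gr d (cmp d x),
    forall d, d \notin gsupp x -> cmp d x = 0 & x = \sum_(d <- gsupp x) cmp d x].
Proof.
have [|f fP] := @choice V (seq bidegree * (bidegree -> V)) (fun x sw =>
  [/\ uniq sw.1, forall d, gr d (sw.2 d),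
    forall d, d \notin sw.1 -> sw.2 d = 0 & x = \sum_(d <- sw.1) sw.2 d]).
  move=> x; have [ds [w [gw ->]]] := bigr_span Vgr x.
  (* A bidegree may occur several times in [ds], each time with the same summand [w d], hence the
     multiplicity. *)
  exists (undup ds, fun d => w d *+ count_mem d ds); split=> /=.
  - exact: undup_uniq.
  - by move=> d; rewrite -scaler_nat; apply: bigrZ.
  - by move=> d; rewrite mem_undup => /count_memPn->.
  - rewrite -(big_undup_iterop_count _ ds); apply: eq_bigr => d _.
    by [].
by exists (fun x => (f x).1), (fun d x => (f x).2 d) => x; apply: fP.
Qed.

Definition gsupp : V -> seq bidegree := projT1 (cid bigr_decomp).
Definition gcomp : bidegree -> V -> V := projT1 (cid (projT2 (cid bigr_decomp))).

Lemma supp_compP x : [/\ uniq (gsupp x), forall d, gr d (gcomp d x),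
  forall d, d \notin gsupp x -> gcomp d x = 0 & x = \sum_(d <- gsupp x) gcomp d x].
Proof. exact: (projT2 (cid (projT2 (cid bigr_decomp)))). Qed.

Lemma comp_gr d x : gr d (gcomp d x).
Proof. by have [] := supp_compP x. Qed.

Lemma comp_sum x : x = \sum_(d <- gsupp x) gcomp d x.
Proof. by have [] := supp_compP x. Qed.

Lemma comp_sum_sub s x : uniq s -> {subset gsupp x <= s} ->
  x = \sum_(d <- s) gcomp d x.
Proof.
move=> us sub; have [ux _ c0 xE] := supp_compP x; rewrite {1}xE.
rewrite [RHS](bigID (mem (gsupp x))) /= [X in _ + X]big1 => [|d /c0//].
rewrite addr0 -[RHS]big_filter; apply: perm_big; apply: uniq_perm; rewrite ?filter_uniq //.
move=> d; rewrite mem_filter /=; case: (boolP (d \in gsupp x)) => //= dx.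
by rewrite sub.
Qed.

(** Independence of the homogeneous pieces makes the chosen components canonical, which is the
    reason for their linearity. *)
Lemma compU s w x : uniq s -> (forall d, gr d (w d)) ->
  (forall d, d \notin s -> w d = 0) -> x = \sum_(d <- s) w d ->
  forall d, gcomp d x = w d.
Proof.
move=> us gw w0 xE d; have [ux gx c0 _] := supp_compP x.
pose s' := undup (s ++ gsupp x).
have us' : uniq s' by apply: undup_uniq.
have sx : {subset gsupp x <= s'} by move=> e ex; rewrite mem_undup mem_cat ex orbT.
have xE' : x = \sum_(d <- s') w d.
  rewrite xE [RHS](bigID (mem s)) /= [X in _ + X]big1 // addr0 -[RHS]big_filter.
  apply: perm_big; apply: uniq_perm; rewrite ?filter_uniq // => e.
  by rewrite mem_filter mem_undup mem_cat /=; case: (e \in s).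
have [ds'|] := boolP (d \in s'); last first.
  by rewrite mem_undup mem_cat negb_or => /andP[/w0-> /c0->].
apply/eqP; rewrite -subr_eq0; apply/eqP.
apply: (bigr_indep Vgr (ds := s') (w := fun d => gcomp d x - w d)) => //.
  by move=> e; apply: bigrB.
by rewrite sumrB -(comp_sum_sub us' sx) -xE' subrr.
Qed.

Lemma comp_linear d : linear (gcomp d).
Proof.
move=> c x y; have [ux gx x0 _] := supp_compP x; have [uy gy y0 _] := supp_compP y.
pose s := undup (gsupp x ++ gsupp y).
have us : uniq s by apply: undup_uniq.
have sx : {subset gsupp x <= s} by move=> e ex; rewrite mem_undup mem_cat ex.
have sy : {subset gsupp y <= s} by move=> e ey; rewrite mem_undup mem_cat ey orbT.
apply: (compU (s := s) (w := fun d => c *: gcomp d x + gcomp d y)) => //.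
- by move=> e; apply: bigr_lin.
- by move=> e; rewrite mem_undup mem_cat negb_or => /andP[/x0-> /y0->]; rewrite scaler0 addr0.
by rewrite big_split /= -scaler_sumr -!comp_sum_sub.
Qed.

HB.instance Definition _ d := GRing.isLinear.Build _ _ _ _ (gcomp d) (@comp_linear d).

Lemma comp_homog d e x : gr d x -> gcomp e x = if e == d then x else 0.
Proof.
move=> gx; apply: (compU (s := [:: d]) (w := fun e => if e == d then x else 0)) => //.
- by move=> f; case: eqP => [->//|_]; apply: bigr_0.
- by move=> f; rewrite inE => /negPf->.
- by rewrite big_seq1 eqxx.
Qed.

Lemma comp_id d x : gr d x -> gcomp d x = x.
Proof. by move=> gx; rewrite (comp_homog _ gx) eqxx. Qed.

Lemma comp0 d e x : gr d x -> e != d -> gcomp e x = 0.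
Proof. by move=> gx /negPf ed; rewrite (comp_homog _ gx) ed. Qed.

Lemma gcomp_inj x y : (forall d, gcomp d x = gcomp d y) -> x = y.
Proof.
move=> xy; pose s := undup (gsupp x ++ gsupp y).
have us : uniq s by apply: undup_uniq.
rewrite (comp_sum_sub us (x := x)) => [|e ex]; last by rewrite mem_undup mem_cat ex.
rewrite [RHS](comp_sum_sub us) => [|e ex]; last by rewrite mem_undup mem_cat ex orbT.
by apply: eq_bigr.
Qed.

(** Turns a family of maps indexed by bidegrees into one map on all of [V]; signs and weights that
    depend on the degree are introduced in this way. *)
Definition dmap (W : lmodType k) (G : bidegree -> V -> W) (x : V) : W :=
  \sum_(d <- gsupp x) G d (gcomp d x).

Lemma dmap_linear (W : lmodType k) (G : bidegree -> V -> W) :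
  (forall d, linear (G d)) -> linear (dmap G).
Proof.
move=> Glin c x y; have G0 d : G d 0 = 0 by exact: (raddf0 (mklinear (Glin d))).
have sub s z : uniq s -> {subset gsupp z <= s} ->
    dmap G z = \sum_(d <- s) G d (gcomp d z).
  move=> us sub; have [uz _ c0 _] := supp_compP z.
  rewrite [RHS](bigID (mem (gsupp z))) /= [X in _ + X]big1 ?addr0; last first.
    by move=> d /c0->.
  rewrite -[RHS]big_filter; apply: perm_big; apply: uniq_perm; rewrite ?filter_uniq //.
  by move=> d; rewrite mem_filter /=; case: (boolP (d \in gsupp z)) => //= /sub->.
pose s := undup (gsupp x ++ gsupp y ++ gsupp (c *: x + y)).
have us : uniq s by apply: undup_uniq.
rewrite !(sub s) => //; try by move=> e ex; rewrite mem_undup !mem_cat ex ?orbT.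
rewrite scaler_sumr -big_split; apply: eq_bigr => d _ /=.
by rewrite linearP Glin.
Qed.

Lemma dmap_homog (W : lmodType k) (G : bidegree -> V -> W) d x :
  (forall d, G d 0 = 0) -> gr d x -> dmap G x = G d x.
Proof.
move=> G0 gx; have [ux _ c0 _] := supp_compP x; rewrite /dmap.
rewrite (bigID (eq_op^~ d)) /= [X in _ + X]big1 ?addr0 => [|e /comp0->//].
have [dx|] := boolP (d \in gsupp x).
  by rewrite -big_filter filter_pred1_uniq // big_seq1 comp_id.
move=> dx; have x0 : x = 0 by rewrite -(comp_id gx) c0.
by rewrite x0 G0 big1 // => e _; rewrite raddf0.
Qed.

Lemma homog_eq (W : lmodType k) (f g : V -> W) : linear f -> linear g ->
  (forall d x, gr d x -> f x = g x) -> forall x, f x = g x.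
Proof.
move=> lf lg fg x; rewrite (comp_sum x).
rewrite -[LHS]/(mklinear lf _) -[RHS]/(mklinear lg _) !raddf_sum.
by apply: eq_bigr => d _; apply/(fg d)/comp_gr.
Qed.
End Bigrading.

(** * Splitting off a minimal bicomplex *)

Section Splitting.
Variables (k : fieldType) (V : lmodType k) (d db h : {linear V -> V}).
Hypotheses (dd : forall x, d (d x) = 0) (dbdb : forall x, db (db x) = 0).
Hypothesis ddb : forall x, d (db x) + db (d x) = 0.

(* This is [d, [db, h]] for h of even total degree. *)
Definition dbl (h : V -> V) (x : V) : V :=
  d (db (h x)) - d (h (db x)) + db (h (d x)) - h (db (d x)).

Lemma dbdE x : db (d x) = - d (db x).
Proof. by apply/eqP; rewrite -addr_eq0 addrC ddb. Qed.

Ltac simp := rewrite ?(raddfB, raddfD, raddfN, raddf0, dd, dbdb, dbdE, opprK,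
  oppr0, subr0, sub0r, addr0, add0r) /=.

Lemma dbl_linear (f : {linear V -> V}) : linear (dbl f).
Proof.
exact: (linearP ((((d \o db \o f) \- (d \o f \o db)) \+ (db \o f \o d))
  \- (f \o db \o d))).
Qed.

Lemma dbl_d (f : {linear V -> V}) x : dbl f (d x) = d (dbl f x).
Proof. by rewrite /dbl; do !simp; rewrite addrC. Qed.

Lemma dbl_db (f : {linear V -> V}) x : dbl f (db x) = db (dbl f x).
Proof. by rewrite /dbl; do !simp. Qed.

Hypothesis LhL : forall x, d (db (h (d (db x)))) = d (db x).
Hypothesis hLh : forall x, h (d (db (h x))) = h x.

(* e0 need not be idempotent, but since h is a generalized inverse of d db,
   its third power is. *)
Definition e0 x := x - dbl h x.

Lemma e0_linear : linear e0.
Proof.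
move=> c x y; rewrite /e0 dbl_linear scalerBr.
by rewrite opprD addrACA.
Qed.
HB.instance Definition _ := GRing.isLinear.Build _ _ _ _ e0 e0_linear.
HB.instance Definition _ := GRing.isLinear.Build _ _ _ _ (dbl h) (dbl_linear h).

Lemma e0_d x : e0 (d x) = d (e0 x).
Proof. by rewrite /e0 dbl_d [RHS]raddfB. Qed.

Lemma e0_db x : e0 (db x) = db (e0 x).
Proof. by rewrite /e0 dbl_db [RHS]raddfB. Qed.

Lemma L_e0 x : d (db (e0 x)) = 0.
Proof. by rewrite /e0 /dbl; do !simp; rewrite LhL subrr. Qed.

Lemma h_e0 x : h (e0 x) = h (d (h (db x))) - h (db (h (d x))) - h (h (d (db x))).
Proof.
rewrite /e0 /dbl; do !simp; rewrite hLh.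
by rewrite !addrA subrr add0r.
Qed.

(** Every term on the right ends in [d (db x)], and [d (db (e0 x))] vanishes by [L_e0]. This is why
    one more [e0] gives 0. *)
Lemma h_e0e0 x : h (e0 (e0 x)) =
  h (db (h (d (h (d (db x)))))) - h (d (h (db (h (d (db x)))))).
Proof.
rewrite h_e0 L_e0 raddf0 raddf0 subr0 -e0_db -e0_d !h_e0; do !simp.
by rewrite addrC.
Qed.

Lemma h_e0e0e0 x : h (e0 (e0 (e0 x))) = 0.
Proof. by rewrite h_e0e0 L_e0 !raddf0 addr0. Qed.

Lemma dbl_e0e0e0 x : dbl h (e0 (e0 (e0 x))) = 0.
Proof.
have E (D : {linear V -> V}) y : (forall x, e0 (D x) = D (e0 x)) ->
    h (D (e0 (e0 (e0 y)))) = 0.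
  by move=> De; rewrite -!De h_e0e0e0.
rewrite /dbl h_e0e0e0 (E d _ e0_d) (E db _ e0_db) (E (db \o d)) ?raddf0 ?subr0 ?addr0 //.
by move=> y; rewrite /= e0_db e0_d.
Qed.

Lemma e0_e0e0e0 x : e0 (e0 (e0 (e0 x))) = e0 (e0 (e0 x)).
Proof. by rewrite {1}/e0 dbl_e0e0e0 subr0. Qed.

(** As [dbl h] is 1 - e0 and [e0] commutes with both differentials, the factorization 1 - e0^3 = (1
    - e0)(1 + e0 + e0^2) dictates this homotopy for the third power. *)
Definition h' x := h (x + e0 x + e0 (e0 x)).

Lemma dbl_h' x : dbl h' x = x - e0 (e0 (e0 x)).
Proof.
have E (D : {linear V -> V}) : (forall x, e0 (D x) = D (e0 x)) ->
    h' (D x) = h (D (x + e0 x + e0 (e0 x))).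
  by move=> De; rewrite /h' !De -!(raddfD D).
have -> : dbl h' x = dbl h (x + e0 x + e0 (e0 x)).
  rewrite /dbl (E d e0_d) (E db e0_db) (E (db \o d)) //.
  by move=> y; rewrite /= e0_db e0_d.
have dE y : dbl h y = y - e0 y by rewrite /e0 subKr.
pose e := (e0 : {linear V -> V}).
rewrite dE (raddfD e (x + e0 x) (e0 (e0 x))) (raddfD e x (e0 x)) /=.
by rewrite -(addrA x) opprD (addrA (x + _)) addrK.
Qed.
End Splitting.

Section BicomplexSplitting.
Variables (k : fieldType) (A : bicomplex k).
Local Notation gr := (homog_bigrading A).

Lemma homog_delbar_del p q (x : A) :
  homog (p, q) x -> homog (p + 1, q + 1) (del (delbar x)).
Proof. by move=> /delbar_homog/del_homog. Qed.

Lemma comp_del d (x : A) : gcomp gr d (del x) = del (gcomp gr (d.1 - 1, d.2) x).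
Proof.
move: x; apply: (homog_eq gr); [exact: (linearP (gcomp gr d \o del))| |].
  exact: (linearP (del \o gcomp gr (d.1 - 1, d.2))).
move=> [p q] x hx; rewrite (comp_homog gr _ (del_homog hx)) (comp_homog gr _ hx).
case: d => a b /=; rewrite !xpair_eqE subr_eq.
by case: ifP => //; rewrite raddf0.
Qed.

Lemma comp_delbar d (x : A) :
  gcomp gr d (delbar x) = delbar (gcomp gr (d.1, d.2 - 1) x).
Proof.
move: x; apply: (homog_eq gr); [exact: (linearP (gcomp gr d \o delbar))| |].
  exact: (linearP (delbar \o gcomp gr (d.1, d.2 - 1))).
move=> [p q] x hx; rewrite (comp_homog gr _ (delbar_homog hx)) (comp_homog gr _ hx).
case: d => a b /=; rewrite !xpair_eqE subr_eq.
by case: ifP => //; rewrite raddf0.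
Qed.

(** A generalized inverse of L = [del \o delbar] need not respect the grading, but its part [h1] of
    bidegree (-1, -1) is again one, because L is homogeneous. The composite [h1 \o L \o h1]
    satisfies the second identity as well. *)
Lemma del_delbar_inverse : exists h : {linear A -> A},
  [/\ forall p q x, homog (p, q) x -> homog (p - 1, q - 1) (h x),
      forall x, del (delbar (h (del (delbar x)))) = del (delbar x)
    & forall x, h (del (delbar (h x))) = h x].
Proof.
pose L : {linear A -> A} := del \o delbar.
have [h0 h0L] := generalized_inverse L.
pose G (d : bidegree) x := gcomp gr (d.1 - 1, d.2 - 1) (h0 x).
have Glin d : linear (G d).
  exact: (linearP (gcomp gr (d.1 - 1, d.2 - 1) \o h0)).
pose h1 := mklinear (dmap_linear gr Glin).
have h1E d x : homog d x -> h1 x = G d x.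
  by move=> hx; apply: (dmap_homog gr) hx => e; rewrite /G !raddf0.
have h1h p q x : homog (p, q) x -> homog (p - 1, q - 1) (h1 x).
  by move=> /h1E->; apply: comp_gr.
have h1L x : L (h1 (L x)) = L x.
  move: x; apply: (homog_eq gr); [exact: (linearP (L \o h1 \o L))|exact: linearP|].
  move=> [p q] x hx; rewrite (h1E (p + 1, q + 1)); last exact: homog_delbar_del.
  have := h0L x; rewrite /G /L /= !addrK => h0Lx.
  have := comp_delbar (p, q + 1) (h0 (del (delbar x))); rewrite /= addrK => <-.
  have := comp_del (p + 1, q + 1) (delbar (h0 (del (delbar x)))).
  rewrite /= addrK => <-; rewrite h0Lx; apply: comp_id; exact: homog_delbar_del.
exists (h1 \o L \o h1); split=> [p q x /h1h/homog_delbar_del/h1h|x|x] /=.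
- by rewrite !subrK.
- by rewrite -/(L _) -![del (delbar _)]/(L _) !h1L.
- by rewrite -![del (delbar _)]/(L _) !h1L.
Qed.

Lemma bicomplex_splitting : exists e h : {linear A -> A},
  [/\ [/\ forall d x, homog d x -> homog d (e x),
        forall x, e (del x) = del (e x) & forall x, e (delbar x) = delbar (e x)],
      forall x, e (e x) = e x, forall x, del (delbar (e x)) = 0,
      forall p q x, homog (p, q) x -> homog (p - 1, q - 1) (h x)
    & forall x, dbl del delbar h x = x - e x].
Proof.
have [h [hh LhL hLh]] := del_delbar_inverse.
have T1 := @del_del _ A; have T2 := @delbar_delbar _ A.
have T3 := @del_delbar _ A.
pose e1 : {linear A -> A} := e0 del delbar h.
have e1d x : e1 (del x) = del (e1 x) by apply: e0_d.
have e1db x : e1 (delbar x) = delbar (e1 x) by apply: e0_db.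
have e1h d x : homog d x -> homog d (e1 x).
  case: d => p q hx; rewrite /e1 /= /e0 /dbl.
  have h1 := homog_delbar_del (hh _ _ _ hx).
  have h2 := del_homog (hh _ _ _ (delbar_homog hx)).
  have h3 := delbar_homog (hh _ _ _ (del_homog hx)).
  have h4 := hh _ _ _ (delbar_homog (del_homog hx)).
  move: h1 h2 h3 h4; rewrite !subrK !addrK => h1 h2 h3 h4.
  by do ![apply: (bigrD gr)|apply: (bigrN gr)].
exists (e1 \o e1 \o e1), (h \o (idfun \+ e1 \+ (e1 \o e1))); split.
- by split=> [d x /e1h/e1h/e1h|x|x] //=; rewrite ?e1d ?e1db.
- by move=> x; rewrite /e1 /= !e0_e0e0e0 //.
- by move=> x; rewrite /e1 /= L_e0 //.
- move=> p q x hx; apply: hh; have hx1 := e1h _ _ hx.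
  exact: (bigrD gr (bigrD gr hx hx1) (e1h _ _ hx1)).
- move=> x; rewrite -[RHS](@dbl_h' _ _ del delbar h) //.
Qed.
End BicomplexSplitting.

(** * Homotopy transfer on words *)

Section Cuts.
Variables (T : Type) (V : zmodType).
Implicit Types (G : seq T -> seq T -> V) (u v w xs : seq T).

(** Deconcatenation followed by [G], both trivial cuts included. The recursive form gives
    coassociativity by induction, without indices. *)
Fixpoint cuts G xs : V :=
  if xs is x :: xs' then G [::] xs + cuts (fun u v => G (x :: u) v) xs'
  else G [::] [::].

Lemma eq_cuts G G' xs : (forall u v, u ++ v = xs -> G u v = G' u v) ->
  cuts G xs = cuts G' xs.
Proof.
elim: xs G G' => [|x xs IHxs] G G' GG' /=; first exact: GG'.
by rewrite GG' //; congr (_ + _); apply: IHxs => u v uv; apply: GG'; rewrite -uv.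
Qed.

Lemma cutsD G G' xs : cuts G xs + cuts G' xs = cuts (fun u v => G u v + G' u v) xs.
Proof. by elim: xs G G' => //= x xs IHxs G G'; rewrite addrACA IHxs. Qed.

Lemma cuts0 xs : cuts (fun _ _ => 0) xs = 0.
Proof. by elim: xs => //= x xs ->; rewrite addr0. Qed.

Lemma cuts_raddf (V' : zmodType) (f : {additive V -> V'}) G xs :
  f (cuts G xs) = \sum_(j < (size xs).+1) f (G (take j xs) (drop j xs)).
Proof.
elim: xs G => /= [|x xs IHxs] G; first by rewrite big_ord_recl big_ord0 addr0.
by rewrite big_ord_recl raddfD IHxs.
Qed.

Lemma cutsE G xs :
  cuts G xs = \sum_(j < (size xs).+1) G (take j xs) (drop j xs).
Proof.
elim: xs G => /= [|x xs IHxs] G; first by rewrite big_ord_recl big_ord0 addr0.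
by rewrite big_ord_recl IHxs.
Qed.

Lemma cuts_cat_cons G u x w : cuts G (u ++ x :: w) =
  cuts (fun u1 u2 => G u1 (u2 ++ x :: w)) u +
  cuts (fun w1 w2 => G (u ++ x :: w1) w2) w.
Proof. by elim: u G => //= y u IHu G; rewrite IHu addrA. Qed.

Lemma cuts_assoc (G : seq T -> seq T -> seq T -> V) xs :
  cuts (fun y w => cuts (fun u v => G u v w) y) xs =
  cuts (fun u z => cuts (fun v w => G u v w) z) xs.
Proof.
elim: xs G => //= x xs IHxs G.
by rewrite -IHxs -addrA cutsD.
Qed.

Lemma cuts_ends G x xs :
  (forall u v, u ++ v = x :: xs -> (0 < size u)%N -> (0 < size v)%N -> G u v = 0) ->
  cuts G (x :: xs) = G [::] (x :: xs) + G (x :: xs) [::].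
Proof.
move=> G0 /=; congr (_ + _).
rewrite cutsE big_ord_recr /= take_size drop_size big1 ?add0r // => j _.
by apply: G0; rewrite //= ?cat_take_drop // size_drop subn_gt0.
Qed.
End Cuts.

Lemma cuts_exchange (T T' : Type) (V : zmodType)
    (G : seq T -> seq T -> seq T' -> seq T' -> V) xs ys :
  cuts (fun u v => cuts (fun y z => G u v y z) ys) xs =
  cuts (fun y z => cuts (fun u v => G u v y z) xs) ys.
Proof.
rewrite !cutsE; under eq_bigr do rewrite cutsE; rewrite exchange_big /=.
by under [RHS]eq_bigr do rewrite cutsE.
Qed.

Lemma raddf_cuts (T : Type) (V V' : zmodType) (f : {additive V -> V'})
    (G : seq T -> seq T -> V) xs :
  f (cuts G xs) = cuts (fun u v => f (G u v)) xs.
Proof. by rewrite cuts_raddf cutsE. Qed.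

Lemma cuts_map (T T' : Type) (V : zmodType) (f : T -> T')
    (G : seq T' -> seq T' -> V) xs :
  cuts G (map f xs) = cuts (fun u v => G (map f u) (map f v)) xs.
Proof. by elim: xs G => //= x xs IHxs G; rewrite IHxs. Qed.

(** Unlike in [multilinear] no arity is fixed: words of all lengths are treated at once, as elements
    of the tensor coalgebra. *)
Definition mlinear (k : fieldType) (V W : lmodType k) (phi : seq V -> W) : Prop :=
  forall s t (c : k) x y,
  phi (s ++ (c *: x + y) :: t) = c *: phi (s ++ x :: t) + phi (s ++ y :: t).

Lemma mlinear_cons (k : fieldType) (V W : lmodType k) (phi : seq V -> W) x :
  mlinear phi -> mlinear (fun xs => phi (x :: xs)).
Proof. by move=> phil s t c y z; apply: (phil (x :: s)). Qed.

Section MultilinearFunctions.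
Variables (k : fieldType) (V W : lmodType k) (phi : seq V -> W).
Hypothesis phil : mlinear phi.

Lemma mlinearD s t x y : phi (s ++ (x + y) :: t) = phi (s ++ x :: t) + phi (s ++ y :: t).
Proof. by have := phil s t 1 x y; rewrite !scale1r. Qed.

Lemma mlinear0 s t : phi (s ++ 0 :: t) = 0.
Proof. by have := phil s t (-1) 0 0; rewrite !scaleN1r oppr0 addr0 addNr. Qed.

Lemma mlinearZ s t c x : phi (s ++ (c *: x) :: t) = c *: phi (s ++ x :: t).
Proof. by have := phil s t c x 0; rewrite addr0 mlinear0 addr0. Qed.

End MultilinearFunctions.

Section Transfer.
Variables (k : fieldType) (V W : lmodType k).
Variables (b : V -> V -> V) (i : {linear W -> V}) (pi : {linear V -> W}).
Variable K : {linear V -> V}.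
Hypotheses (bl : forall y, linear (b^~ y)) (br : forall x, linear (b x)).

Lemma b0l y : b 0 y = 0. Proof. exact: (raddf0 (mklinear (bl y))). Qed.
Lemma b0r x : b x 0 = 0. Proof. exact: (raddf0 (mklinear (br x))). Qed.
Lemma bDl x x' y : b (x + x') y = b x y + b x' y.
Proof. exact: (raddfD (mklinear (bl y))). Qed.
Lemma bDr x y y' : b x (y + y') = b x y + b x y'.
Proof. exact: (raddfD (mklinear (br x))). Qed.
Lemma bNl x y : b (- x) y = - b x y.
Proof. exact: (raddfN (mklinear (bl y))). Qed.
Lemma bNr x y : b x (- y) = - b x y.
Proof. exact: (raddfN (mklinear (br x))). Qed.
Lemma b_cutsl (T : Type) (G : seq T -> seq T -> V) xs y :
  b (cuts G xs) y = cuts (fun u v => b (G u v) y) xs.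
Proof. exact: (raddf_cuts (mklinear (bl y))). Qed.
Lemma b_cutsr (T : Type) (G : seq T -> seq T -> V) xs x :
  b x (cuts G xs) = cuts (fun u v => b x (G u v)) xs.
Proof. exact: (raddf_cuts (mklinear (br x))). Qed.

Definition on_letter (U : lmodType k) (f : W -> U) (xs : seq W) : U :=
  if xs is [:: x] then f x else 0.

(* The solution of F = i + K (b F F) on words, by recursion on the length. *)
Fixpoint transfer_rec (n : nat) (xs : seq W) : V :=
  on_letter i xs + (if n is n'.+1 then
    K (cuts (fun u v => if nilp u || nilp v then 0
                        else b (transfer_rec n' u) (transfer_rec n' v)) xs)
  else 0).

Definition trF (xs : seq W) : V := transfer_rec (size xs) xs.
Definition trP (xs : seq W) : V := cuts (fun u v => b (trF u) (trF v)) xs.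

(** The tests [nilp] leave only cuts into strictly shorter words, so any fuel bounding the length
    gives the same value. *)
Lemma transfer_rec_stable n m xs : (size xs <= n)%N -> (size xs <= m)%N ->
  transfer_rec n xs = transfer_rec m xs.
Proof.
have E0 xs' : (size xs' <= 0)%N -> forall G : seq W -> seq W -> V,
    K (cuts (fun u v => if nilp u || nilp v then 0 else G u v) xs') = 0.
  by case: xs' => //= _ G; rewrite raddf0.
elim: n m xs => [|n IHn] [|m] xs //= sn sm; first by rewrite E0.
  by rewrite E0.
congr (_ + K _); apply: eq_cuts => u v uv; case: ifP => // /norP[u0 v0].
move: sn sm; rewrite -uv size_cat => sn sm.
by congr (b _ _); apply: IHn; move: u0 v0; rewrite /nilp; lia.
Qed.

Lemma trF_nil : trF [::] = 0.
Proof. by rewrite /trF /= addr0. Qed.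

Lemma trFE xs : trF xs = on_letter i xs + K (trP xs).
Proof.
rewrite /trF (@transfer_rec_stable _ (size xs).+1) //=; congr (_ + K _).
apply: eq_cuts => u v uv; case: ifP => [/orP[]/nilP->|_].
- by rewrite trF_nil b0l.
- by rewrite trF_nil b0r.
by congr (b _ _); apply: transfer_rec_stable; rewrite // -uv size_cat ?leq_addr ?leq_addl.
Qed.

Lemma trP_nil : trP [::] = 0.
Proof. by rewrite /trP /= trF_nil b0l. Qed.

Lemma trP1 x : trP [:: x] = 0.
Proof. by rewrite /trP /= trF_nil b0l b0r addr0. Qed.

Lemma trF1 x : trF [:: x] = i x.
Proof. by rewrite trFE trP1 raddf0 addr0. Qed.

Lemma trF_ge2 xs : (1 < size xs)%N -> trF xs = K (trP xs).
Proof. by rewrite trFE; case: xs => [|x [|y xs]] //=; rewrite add0r. Qed.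

Lemma trP_ind (Q : seq W -> V -> Prop) (Q' : seq W -> V -> Prop) :
  (forall x, Q [:: x] (i x)) ->
  (forall xs y, (1 < size xs)%N -> Q' xs y -> Q xs (K y)) ->
  (forall xs, (forall u v, u ++ v = xs -> (0 < size u)%N -> (0 < size v)%N ->
      Q u (trF u) /\ Q v (trF v)) -> (1 < size xs)%N -> Q' xs (trP xs)) ->
  (forall xs, (0 < size xs)%N -> Q xs (trF xs)) /\
  (forall xs, (1 < size xs)%N -> Q' xs (trP xs)).
Proof.
move=> Q1 QK QP.
have QF n xs : (0 < size xs <= n)%N -> Q xs (trF xs).
  elim: n xs => [|n IHn] xs; first by case: (size xs).
  have [xs1 xs0|xs2 xsn] := leqP (size xs) 1.
    by case: xs xs0 xs1 => [|x []] //= _ _; rewrite trF1.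
  rewrite trF_ge2 //; apply: (QK) => //; apply: QP => // u v uv u0 v0.
  move: xsn; rewrite -uv size_cat => xsn.
  by split; apply: IHn; lia.
have QF' xs : (0 < size xs)%N -> Q xs (trF xs) by move=> xs0; apply: (QF (size xs)); rewrite xs0 /=.
by split=> // xs xs2; apply: QP => // u v _ u0 v0; split; apply: QF'.
Qed.

Lemma trF_mlinear : mlinear trF.
Proof.
suff H n s t c x y : (size s + size t < n)%N ->
    trF (s ++ (c *: x + y) :: t) = c *: trF (s ++ x :: t) + trF (s ++ y :: t).
  by move=> s t c x y; apply: (H (size s + size t).+1).
elim: n s t => // n IHn s t stn; rewrite !trFE scalerDr addrACA; congr (_ + _).
  case: s {stn} => [|z s]; last by case: s => [|z' s] /=; rewrite scaler0 addr0.
  by case: t => [|z t] /=; [rewrite linearP|rewrite scaler0 addr0].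
rewrite -linearP /=; congr (K _).
rewrite /trP !cuts_cat_cons scalerDr addrACA; congr (_ + _).
  pose f := mklinear (br 0).
  have -> c' (G : seq W -> seq W -> V) zs : c' *: cuts G zs = cuts (fun u v => c' *: G u v) zs.
    by rewrite !cutsE scaler_sumr.
  rewrite cutsD; apply: eq_cuts => u v uv.
  case: u uv => [|z u] uv; first by rewrite !trF_nil !b0l scaler0 addr0.
  rewrite IHn ?br //; move: stn; rewrite -uv /= size_cat; lia.
have -> c' (G : seq W -> seq W -> V) zs : c' *: cuts G zs = cuts (fun u v => c' *: G u v) zs.
  by rewrite !cutsE scaler_sumr.
rewrite cutsD; apply: eq_cuts => u v uv.
case: v uv => [|z v] uv; first by rewrite !trF_nil !b0r scaler0 addr0.
rewrite IHn ?bl //; move: stn; rewrite -uv size_cat /=; lia.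
Qed.

Lemma trP_mlinear : mlinear trP.
Proof.
move=> s t c x y; rewrite /trP !cuts_cat_cons scalerDr addrACA.
by congr (_ + _); rewrite !cutsE scaler_sumr -big_split; apply: eq_bigr => j _ /=;
  rewrite trF_mlinear ?bl ?br.
Qed.

Section Parity.
(** These are the signs (-1)^degree on the suspended spaces, for which [i] is even while [b] and [K]
    are odd. In associativity and in the Leibniz rule below, [sV] is the sign for passing an odd
    map. *)
Variables (sW : W -> W) (sV : V -> V).
Hypothesis sVl : linear sV.
Hypothesis si : forall x, sV (i x) = i (sW x).
Hypothesis sb : forall x y, sV (b x y) = - b (sV x) (sV y).
Hypothesis sK : forall x, sV (K x) = - K (sV x).

Lemma trF_parity_aux : (forall xs, (0 < size xs)%N -> sV (trF xs) = trF (map sW xs)) /\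
  (forall xs, (1 < size xs)%N -> sV (trP xs) = - trP (map sW xs)).
Proof.
apply: (@trP_ind (fun xs y => sV y = trF (map sW xs))
                 (fun xs y => sV y = - trP (map sW xs))) => [x|ys y s2 yE|ys IH _].
- by rewrite /= trF1 si.
- by rewrite sK yE raddfN opprK trF_ge2 ?size_map.
rewrite -[LHS]/(mklinear sVl _) raddf_cuts [in RHS]/trP cuts_map.
rewrite -[RHS]/((\- (@idfun V)) _) raddf_cuts.
apply: eq_cuts => u v uv; rewrite /= sb.
case: (posnP (size u)) => [/size0nil->|u0].
  by rewrite /= trF_nil -[sV 0]/(mklinear sVl 0) raddf0 !b0l.
case: (posnP (size v)) => [/size0nil->|v0].
  by rewrite /= trF_nil -[sV 0]/(mklinear sVl 0) raddf0 !b0r.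
by have [-> ->] := IH _ _ uv u0 v0.
Qed.

Lemma trF_parity xs : sV (trF xs) = trF (map sW xs).
Proof.
case: xs => [|x xs]; last exact: trF_parity_aux.1.
by rewrite /= trF_nil; exact: (raddf0 (mklinear sVl)).
Qed.

Variables (D : {linear V -> V}) (DW : {linear W -> W}).
Hypothesis bA : forall x y z, b (b x y) z + b (sV x) (b y z) = 0.
Hypothesis Db : forall x y, D (b x y) = - b (D x) y - b (sV x) (D y).
Hypothesis Di : forall x, D (i x) = i (DW x).
Hypothesis DK : forall x, D (K x) + K (D x) = i (pi x) - x.

Definition trm (xs : seq W) : W := on_letter DW xs + pi (trP xs).

(** This is [phi] composed with the coderivation of the tensor coalgebra determined by [m]; [sW] on
    [u] is the Koszul sign for moving an odd [m] past [u]. *)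
Definition bar (U : lmodType k) (phi : seq W -> U) (m : seq W -> W) xs : U :=
  cuts (fun u vw => cuts (fun v w => phi (map sW u ++ m v :: w)) vw) xs.

Lemma bar_on_letter (U : lmodType k) (f : {linear W -> U}) m xs :
  bar (on_letter f) m xs = f (m xs).
Proof.
rewrite /bar; case: xs => [//|x xs]; set G := fun u vw => _.
have -> : cuts G (x :: xs) = G [::] (x :: xs) + cuts (fun u v => G (x :: u) v) xs by [].
rewrite -[RHS]addr0; congr (_ + _).
  rewrite /G cutsE big_ord_recr big1 /= => [|j _].
    by rewrite take_size drop_size add0r.
  case: (drop j (x :: xs)) (size_drop j (x :: xs)) => //= H.
  by have := ltn_ord j; move: H => /=; lia.
rewrite cutsE big1 // => j _; rewrite /G /= cutsE big1 // => l _.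
by rewrite /on_letter; case: [seq _ | _ <- _].
Qed.

Lemma bar_add (U : lmodType k) (f g : seq W -> U) m xs :
  bar (fun xs => f xs + g xs) m xs = bar f m xs + bar g m xs.
Proof. by rewrite /bar cutsD; apply: eq_cuts => u v _; rewrite cutsD. Qed.

Lemma bar_linear (U U' : lmodType k) (f : {linear U -> U'}) phi m xs :
  bar (fun xs => f (phi xs)) m xs = f (bar phi m xs).
Proof. by rewrite /bar raddf_cuts; apply: eq_cuts => u v _; rewrite raddf_cuts. Qed.

Lemma bar_trF m xs : bar trF m xs = i (m xs) + K (bar trP m xs).
Proof.
rewrite -bar_linear -bar_on_letter -bar_add.
by apply: eq_cuts => u vw _; apply: eq_cuts => v w _; rewrite trFE.
Qed.

(** The cut made by [trP] falls before or after the letter [m v], which gives the two terms. In the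
    first one, [trF_parity] turns [sW] on the letters into [sV]. *)
Lemma bar_trP m xs : bar trP m xs =
  cuts (fun y z => b (sV (trF y)) (bar trF m z) + b (bar trF m y) (trF z)) xs.
Proof.
rewrite -cutsD /bar.
pose H1 u1 u2 vw := cuts (fun v w =>
  b (trF (map sW u1)) (trF (map sW u2 ++ m v :: w))) vw.
pose H2 u y w2 := cuts (fun v w1 =>
  b (trF (map sW u ++ m v :: w1)) (trF w2)) y.
transitivity (cuts (fun u vw => cuts (fun u1 u2 => H1 u1 u2 vw) u +
    cuts (fun y w2 => H2 u y w2) vw) xs).
  apply: eq_cuts => u vw _; rewrite cuts_exchange /H2 (cuts_assoc (fun v w1 w2 =>
    b (trF (map sW u ++ m v :: w1)) (trF w2))) cutsD.
  by apply: eq_cuts => v w _; rewrite /trP cuts_cat_cons cuts_map.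
rewrite -cutsD cuts_assoc -(cuts_assoc H2); congr (_ + _).
  apply: eq_cuts => u z _; rewrite b_cutsr; apply: eq_cuts => u2 vw _.
  by rewrite b_cutsr trF_parity.
apply: eq_cuts => y z _; rewrite b_cutsl; apply: eq_cuts => u v _.
by rewrite b_cutsl.
Qed.

Lemma cuts_trP_trF xs :
  cuts (fun y z => b (trP y) (trF z) + b (sV (trF y)) (trP z)) xs = 0.
Proof.
rewrite -cutsD.
under eq_cuts => u v _ do rewrite b_cutsl.
under [X in _ + X]eq_cuts => u v _ do rewrite b_cutsr.
rewrite cuts_assoc cutsD -[RHS](cuts0 _ xs); apply: eq_cuts => u v _.
by rewrite cutsD -[RHS](cuts0 _ v); apply: eq_cuts => y z _; apply: bA.
Qed.

(** The defect [E] of the equation satisfies E = K (b E F + b (sV F) E) on words, with no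
    inhomogeneous term. By induction on the length its only solution is 0. *)
Lemma transfer_morphism xs : D (trF xs) + trP xs = bar trF trm xs.
Proof.
pose E ys := D (trF ys) + trP ys - bar trF trm ys.
suff : E xs = 0 by move/eqP; rewrite subr_eq0 => /eqP.
have DPE ys : D (trP ys) + bar trP trm ys =
    - cuts (fun y z => b (E y) (trF z) + b (sV (trF y)) (E z)) ys.
  apply/eqP; rewrite -addr_eq0; apply/eqP.
  rewrite bar_trP {1}/trP raddf_cuts !cutsD -[RHS](cuts_trP_trF ys).
  apply: eq_cuts => u v _; rewrite /= Db /E !(bDl, bDr, bNl, bNr); zmodule.
have EE ys : E ys = K (cuts (fun y z => b (E y) (trF z) + b (sV (trF y)) (E z)) ys).
  rewrite -[cuts _ _]opprK -DPE /E bar_trF {1}trFE !(raddfN, raddfD) /=.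
  have -> : D (on_letter i ys) = i (on_letter DW ys).
    by case: ys => [|x [|y ys]] /=; rewrite ?raddf0 // Di.
  (* Here [K (D P)] is replaced by [i (pi P) - P - D (K P)]; the summand [i (pi P)] is the
     contribution of the transferred operations in [trm]. *)
  have := DK (trP ys) => /(canRL (addrK _)) ->.
  zmodule.
elim: (size xs).+1 {-2}xs (ltnSn (size xs)) => // n IHn ys.
rewrite ltnS => ysn; rewrite EE -[RHS](raddf0 K) -(cuts0 _ ys); congr (K _).
apply: eq_cuts => u v uv; move: ysn; rewrite -uv size_cat => ysn.
case: u v uv ysn => [|x u] [|y v] /= _ ysn; rewrite ?trF_nil ?b0r ?b0l.
- by rewrite -[sV 0]/(mklinear sVl 0) raddf0 b0l addr0.
- by rewrite -[sV 0]/(mklinear sVl 0) raddf0 IHn ?b0l ?addr0 // /=; lia.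
- by rewrite IHn ?b0r ?addr0 //=; lia.
- by rewrite !IHn ?b0l ?b0r ?addr0 //=; lia.
Qed.

Lemma trP_bar xs : D (trP xs) + bar trP trm xs = 0.
Proof.
rewrite bar_trP {1}/trP raddf_cuts cutsD -[RHS](cuts_trP_trF xs).
apply: eq_cuts => u v _; rewrite /= Db -!transfer_morphism !(bDl, bDr); zmodule.
Qed.

Lemma transfer_Ainf xs : (forall x, DW (pi x) = pi (D x)) ->
  DW (pi (trP xs)) + bar (fun ys => pi (trP ys)) trm xs = 0.
Proof. by move=> piD; rewrite piD bar_linear -raddfD trP_bar raddf0. Qed.

End Parity.

Section Scalar.
Variables (sW : W -> W) (sV : V -> V) (eW : W -> W) (eV : {linear V -> V}).
Hypothesis sVl : linear sV.
Hypothesis si : forall x, sV (i x) = i (sW x).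
Hypothesis sb : forall x y, sV (b x y) = - b (sV x) (sV y).
Hypothesis sK : forall x, sV (K x) = - K (sV x).
Hypothesis ebl : forall x y, b (eV x) y = - eV (b x y).
Hypothesis ebr : forall x y, b x (eV y) = - eV (b (sV x) y).
Hypothesis eK : forall x, K (eV x) = - eV (K x).
Hypothesis ei : forall x, i (eW x) = eV (i x).

(** [eW] and [eV] play the role of multiplication by an odd scalar. The transfer is linear over it,
    with the sign [sW] on the letters that the scalar passes on its way to the front. *)
Lemma trF_scalar u x w : trF (u ++ eW x :: w) = eV (trF (map sW u ++ x :: w)).
Proof.
elim: (size u + size w).+1 {-2}u {-2}w (ltnSn (size u + size w)) x => // n IHn {}u {}w.
rewrite ltnS => uwn x; rewrite !trFE raddfD /=; congr (_ + _).
  case: u {uwn} => [|z u] /=; last by case: u => [|z' u] /=; rewrite raddf0.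
  by case: w => [|z w] /=; [rewrite ei|rewrite raddf0].
rewrite -[RHS]opprK -eK -raddfN; congr (K _).
rewrite /trP !cuts_cat_cons !raddfD cuts_map !raddf_cuts; congr (_ + _).
  apply: eq_cuts => u1 u2 uE /=; case: u1 uE => [|z u1] uE.
    by rewrite /= trF_nil !b0l raddf0 oppr0.
  rewrite IHn ?ebr ?(trF_parity sVl si sb sK) //; move: uwn; rewrite -uE /= size_cat; lia.
apply: eq_cuts => w1 w2 wE /=; case: w2 wE => [|z w2] wE.
  by rewrite /= trF_nil !b0r raddf0 oppr0.
rewrite IHn ?ebl //; move: uwn; rewrite -wE /= size_cat /=; lia.
Qed.

Lemma trP_scalar u x w : trP (u ++ eW x :: w) = - eV (trP (map sW u ++ x :: w)).
Proof.
rewrite /trP !cuts_cat_cons !raddfD cuts_map !raddf_cuts; congr (_ + _).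
  apply: eq_cuts => u1 u2 uE /=.
  by rewrite trF_scalar ebr (trF_parity sVl si sb sK).
by apply: eq_cuts => w1 w2 _ /=; rewrite trF_scalar ebl.
Qed.
End Scalar.

End Transfer.

(** * Signs and shuffles *)

Section Sign.
Variable k : fieldType.
Lemma sg0 : sg k 0 = 1. Proof. by rewrite /sg expr0z. Qed.
Lemma sgD x y : sg k (x + y) = sg k x * sg k y.
Proof. by rewrite /sg expfzDr // oppr_eq0 oner_eq0. Qed.
Lemma sg1 : sg k 1 = -1. Proof. by []. Qed.
Lemma sgN x : sg k (- x) = sg k x.
Proof. by rewrite /sg -exprz_inv invrN1. Qed.
Lemma sgsg x : sg k x * sg k x = 1.
Proof. by rewrite -[X in _ * X]sgN -sgD subrr sg0. Qed.

Definition oddz (z : int) : bool := odd `|z|%N.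

Lemma sgE z : sg k z = (-1) ^+ oddz z.
Proof.
rewrite /sg /oddz signr_odd; case: z => n //=.
by rewrite NegzE -exprz_inv invrN1.
Qed.

Lemma oddzD x y : oddz (x + y) = oddz x (+) oddz y.
Proof. rewrite /oddz; lia. Qed.
Lemma oddzN x : oddz (- x) = oddz x.
Proof. by rewrite /oddz abszN. Qed.
Lemma oddzM x y : oddz (x * y) = oddz x && oddz y.
Proof. by rewrite /oddz abszM oddM. Qed.
Lemma oddz_nat (n : nat) : oddz n = odd n.
Proof. by []. Qed.

Lemma oddz1 : oddz 1 = true.
Proof. by []. Qed.

Lemma sg_eq x y : oddz x = oddz y -> sg k x = sg k y.
Proof. by rewrite !sgE => ->. Qed.
End Sign.

Definition forallb (P : bool -> bool) : bool := P true && P false.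

Lemma forallbP (P : bool -> bool) : forallb P -> forall b, P b.
Proof. by case/andP=> Pt Pf []. Qed.

(** Sign exponents are compared modulo 2 by running through all parities of their atoms. *)
Ltac parity_table :=
  apply/eqP;
  repeat match goal with
    | |- context [oddz ?x] => generalize (oddz x); refine (@forallbP _ _)
    | |- context [odd ?x] => generalize (odd x); refine (@forallbP _ _)
    | b : bool |- context [?b'] =>
      constr_eq b b'; generalize b; refine (@forallbP _ _)
    end;
  vm_compute; reflexivity.

Section Shuffles.
Variables (k : fieldType) (T : Type) (par : T -> int).

Definition wpar (u : seq T) : int := \sum_(x <- u) par x.

Lemma wpar_cons x u : wpar (x :: u) = par x + wpar u.
Proof. by rewrite /wpar big_cons. Qed.

Lemma wpar_cat u v : wpar (u ++ v) = wpar u + wpar v.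
Proof. by rewrite /wpar big_cat. Qed.

(** The signed shuffle product, with [G] as a continuation that collects the letters already chosen.
    A letter taken from the second word first passes all that remains of the first one. The inner
    [fix] lets the recursion decrease in either word. *)
Fixpoint shuffle (V : lmodType k) (u : seq T) : (seq T -> V) -> seq T -> V :=
  match u with
  | [::] => fun G v => G v
  | x :: u' =>
    let fix shuffle_x (G : seq T -> V) (v : seq T) : V :=
      match v with
      | [::] => G (x :: u')
      | y :: v' => shuffle u' (fun w => G (x :: w)) (y :: v') +
          sg k (par y * wpar (x :: u')) *: shuffle_x (fun w => G (y :: w)) v'
      end in shuffle_x
  end.

Section Shuffle.
Variable V : lmodType k.
Implicit Types (G : seq T -> V) (u v : seq T).

Lemma shuffle_nil_r G u : shuffle u G [::] = G u.
Proof. by case: u. Qed.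

Lemma shuffle_cons G x u y v : shuffle (x :: u) G (y :: v) =
  shuffle u (fun w => G (x :: w)) (y :: v) +
  sg k (par y * wpar (x :: u)) *: shuffle (x :: u) (fun w => G (y :: w)) v.
Proof. by []. Qed.

Lemma shuffle_ind (Q : seq T -> seq T -> Prop) :
  (forall v, Q [::] v) -> (forall u, Q u [::]) ->
  (forall x u y v, Q u (y :: v) -> Q (x :: u) v -> Q (x :: u) (y :: v)) ->
  forall u v, Q u v.
Proof.
move=> Q1 Q2 Q3; elim=> [|x u IHu] v; first exact: Q1.
by elim: v => [|y v IHv]; [apply: Q2|apply: Q3].
Qed.

Lemma eq_shuffle G G' u v : G =1 G' -> shuffle u G v = shuffle u G' v.
Proof.
move: u v G G'; apply: shuffle_ind => [v|u|x u y v IHu IHv] G G' GG'.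
- exact: GG'.
- by rewrite !shuffle_nil_r.
rewrite !shuffle_cons; congr (_ + _ *: _).
  by apply: IHu => w; apply: GG'.
by apply: IHv => w; apply: GG'.
Qed.

Lemma shuffleD G G' u v :
  shuffle u (fun w => G w + G' w) v = shuffle u G v + shuffle u G' v.
Proof.
move: u v G G'; apply: shuffle_ind => [v|u|x u y v IHu IHv] G G'; first by [].
  by rewrite !shuffle_nil_r.
by rewrite !shuffle_cons IHu IHv scalerDr addrACA.
Qed.

Lemma scaler_cuts (c : k) (G : seq T -> seq T -> V) xs :
  c *: cuts G xs = cuts (fun u v => c *: G u v) xs.
Proof. by rewrite !cutsE scaler_sumr. Qed.

Lemma cuts_cons (G : seq T -> seq T -> V) x xs : cuts G (x :: xs) =
  G [::] (x :: xs) + cuts (fun u v => G (x :: u) v) xs.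
Proof. by []. Qed.

(* Deconcatenation is a morphism for the shuffle product, so that trF and trP,
   being built from deconcatenation and an antisymmetric product, vanish on
   shuffles. *)
Lemma shuffle_cuts (G : seq T -> seq T -> V) u v :
  shuffle u (cuts G) v = cuts (fun u1 u2 => cuts (fun v1 v2 =>
    sg k (wpar u2 * wpar v1) *: shuffle u1 (fun w1 => shuffle u2 (G w1) v2) v1) v) u.
Proof.
move: u v G; apply: shuffle_ind => [v|u|x u y v IHu IHv] G.
- by rewrite /=; apply: eq_cuts => v1 v2 _; rewrite /wpar big_nil mul0r sg0 scale1r.
- rewrite shuffle_nil_r; apply: eq_cuts => u1 u2 _.
  by rewrite /= /wpar big_nil mulr0 sg0 scale1r !shuffle_nil_r.
rewrite shuffle_cons.
under eq_shuffle do rewrite cuts_cons.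
under [X in _ *: X]eq_shuffle do rewrite cuts_cons.
rewrite !shuffleD IHu IHv scalerDr addrACA -shuffle_cons.
pose X u1 u2 v1 v2 := sg k (wpar u2 * wpar v1) *:
  shuffle u1 (fun w1 => shuffle u2 (G w1) v2) v1.
pose Xx u1 u2 v1 v2 := sg k (wpar u2 * wpar v1) *:
  shuffle u1 (fun w1 => shuffle u2 (G (x :: w1)) v2) v1.
pose Xy u1 u2 v1 v2 := sg k (wpar u2 * wpar v1) *:
  shuffle u1 (fun w1 => shuffle u2 (G (y :: w1)) v2) v1.
have -> : cuts (fun u1 u2 => cuts (X u1 u2) (y :: v)) (x :: u) =
    (X [::] (x :: u) [::] (y :: v) + cuts (fun v1 v2 => X [::] (x :: u) (y :: v1) v2) v)
    + (cuts (fun u1 u2 => X (x :: u1) u2 [::] (y :: v)) u +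
       cuts (fun u1 u2 => cuts (fun v1 v2 => X (x :: u1) u2 (y :: v1) v2) v) u).
  by rewrite cutsD.
have -> : cuts (fun u1 u2 => cuts (Xx u1 u2) (y :: v)) u =
    cuts (fun u1 u2 => Xx u1 u2 [::] (y :: v)) u +
    cuts (fun u1 u2 => cuts (fun v1 v2 => Xx u1 u2 (y :: v1) v2) v) u.
  by rewrite cutsD.
have -> : sg k (par y * wpar (x :: u)) *: cuts (fun u1 u2 => cuts (Xy u1 u2) v) (x :: u) =
    cuts (fun v1 v2 => X [::] (x :: u) (y :: v1) v2) v +
    cuts (fun u1 u2 => cuts (fun v1 v2 =>
      sg k (par y * wpar (x :: u)) *: Xy (x :: u1) u2 v1 v2) v) u.
  rewrite cuts_cons scalerDr !scaler_cuts; congr (_ + _).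
    apply: eq_cuts => v1 v2 _; rewrite /X /Xy scalerA -sgD /=.
    by congr (sg k _ *: _); rewrite !wpar_cons; ring.
  by apply: eq_cuts => u1 u2 _; rewrite scaler_cuts.
have -> : cuts (fun u1 u2 => Xx u1 u2 [::] (y :: v)) u =
    cuts (fun u1 u2 => X (x :: u1) u2 [::] (y :: v)) u.
  by apply: eq_cuts => u1 u2 _; rewrite /Xx /X !shuffle_nil_r.
have -> : cuts (fun u1 u2 => cuts (fun v1 v2 => X (x :: u1) u2 (y :: v1) v2) v) u =
    cuts (fun u1 u2 => cuts (fun v1 v2 => Xx u1 u2 (y :: v1) v2) v) u +
    cuts (fun u1 u2 => cuts (fun v1 v2 =>
      sg k (par y * wpar (x :: u)) *: Xy (x :: u1) u2 v1 v2) v) u.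
  rewrite cutsD; apply: eq_cuts => u1 u2 uE; rewrite cutsD; apply: eq_cuts => v1 v2 _.
  rewrite /X shuffle_cons scalerDr; congr (_ + _).
  rewrite /Xy !scalerA -!sgD; congr (_ *: _); apply: sg_eq.
  rewrite -uE !wpar_cons wpar_cat !(oddzD, oddzM).
  parity_table.
have -> : X [::] (x :: u) [::] (y :: v) = shuffle (x :: u) (G [::]) (y :: v).
  by rewrite /X /wpar big_nil mulr0 sg0 scale1r.
zmodule.
Qed.

End Shuffle.

Lemma raddf_shuffle (V V' : lmodType k) (f : {linear V -> V'}) (G : seq T -> V) u v :
  f (shuffle u G v) = shuffle u (fun w => f (G w)) v.
Proof.
move: u v G; apply: shuffle_ind => [v|u|x u y v IHu IHv] G; first by [].
  by rewrite !shuffle_nil_r.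
by rewrite !shuffle_cons linearD linearZZ IHu IHv.
Qed.

End Shuffles.

Lemma mlinear_sg (k : fieldType) (T : Type) (V W : lmodType k) (phi : seq W -> V)
    (par : T -> int) (elt : T -> W) (sW : W -> W) u :
  mlinear phi -> (forall t, sW (elt t) = sg k (par t) *: elt t) ->
  phi (map sW (map elt u)) = sg k (wpar par u) *: phi (map elt u).
Proof.
move=> phil sE; elim: u phi phil => [|t u IHu] phi phil /=.
  by rewrite /wpar big_nil sg0 scale1r.
rewrite sE (mlinearZ phil [::]) (IHu (fun w => phi (elt t :: w))).
  by rewrite scalerA -sgD wpar_cons.
exact: mlinear_cons.
Qed.

(** * Vanishing of the transfer on shuffles *)

Section TransferShuffle.
Variables (k : fieldType) (V W : lmodType k).
Variables (b : V -> V -> V) (i : {linear W -> V}) (K : {linear V -> V}).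
Hypotheses (bl : forall y, linear (b^~ y)) (br : forall x, linear (b x)).
Variables (sW : W -> W) (sV : V -> V).
Hypothesis sVl : linear sV.
Hypothesis si : forall x, sV (i x) = i (sW x).
Hypothesis sb : forall x y, sV (b x y) = - b (sV x) (sV y).
Hypothesis sK : forall x, sV (K x) = - K (sV x).
Hypothesis bC : forall p q x y, sV x = sg k p *: x -> sV y = sg k q *: y ->
  b x y + sg k (p * q) *: b y x = 0.
Variables (T : Type) (par : T -> int) (elt : T -> W).
Hypothesis sE : forall t, sW (elt t) = sg k (par t) *: elt t.

Local Notation F := (trF b i K).
Local Notation P := (trP b i K).
Local Notation sh := (shuffle par).

(** By [shuffle_cuts] and induction only the cuts that separate [u] entirely from [v] survive. They
    give b (F u) (F v) and its signed transpose, which cancel by [bC]. The letter part of [F] does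
    not see a shuffle of nonempty words, whose length is at least 2. *)
Lemma shuffle_trF_trP u v : (0 < size u)%N -> (0 < size v)%N ->
  sh u (fun w => F (map elt w)) v = 0 /\ sh u (fun w => P (map elt w)) v = 0.
Proof.
elim: (size u + size v).+1 {-2}u {-2}v (ltnSn (size u + size v)) => // n IHn {}u {}v.
rewrite ltnS => uvn u0 v0.
suff P0 : sh u (fun w => P (map elt w)) v = 0.
  split=> //; under eq_shuffle do rewrite trFE //.
  rewrite shuffleD -raddf_shuffle P0 raddf0 addr0.
  case: u v u0 v0 {P0 uvn} => [|x u] [|y v] // _ _.
  rewrite shuffle_cons.
  have G0 (G : seq T -> V) u' v' : (forall w, (0 < size w)%N -> G w = 0) ->
      (0 < size u' + size v')%N -> sh u' G v' = 0.
    move: u' v' G; apply: shuffle_ind => [v'|u'|x' u' y' v' IHu IHv] G HG.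
    - by move=> s0; apply: HG.
    - by rewrite addn0 shuffle_nil_r; apply: HG.
    - move=> _; rewrite shuffle_cons IHu ?IHv ?scaler0 ?addr0 //=; try lia.
        by move=> w _; apply: HG.
      by move=> w _; apply: HG.
  rewrite !G0 ?scaler0 ?addr0 //= ?addnS ?addSn //; by case.
pose f u1 v1 := sh u1 (fun w => F (map elt w)) v1.
have -> : sh u (fun w => P (map elt w)) v = sh u (cuts (fun w1 w2 =>
    b (F (map elt w1)) (F (map elt w2)))) v.
  by apply: eq_shuffle => w; rewrite /trP cuts_map.
rewrite shuffle_cuts.
pose X u1 u2 v1 v2 := sg k (wpar par u2 * wpar par v1) *: b (f u1 v1) (f u2 v2).
have -> : cuts (fun u1 u2 => cuts (fun v1 v2 => sg k (wpar par u2 * wpar par v1) *: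
    sh u1 (fun w1 => sh u2 (fun w2 => b (F (map elt w1)) (F (map elt w2))) v2) v1) v) u
    = cuts (fun u1 u2 => cuts (X u1 u2) v) u.
  apply: eq_cuts => u1 u2 _; apply: eq_cuts => v1 v2 _; congr (_ *: _).
  rewrite -[b _ _]/(mklinear (bl (f u2 v2)) _) raddf_shuffle.
  by apply: eq_shuffle => w1; rewrite -(raddf_shuffle _ (mklinear (br _))).
have f00 : f [::] [::] = 0 by rewrite /f /= trF_nil.
have fn u' v' : (size u' + size v' < n)%N -> (0 < size u')%N -> (0 < size v')%N ->
    f u' v' = 0 by move=> h1 h2 h3; apply: (IHn _ _ h1 h2 h3).1.
have X0l u1 u2 v1 v2 : f u1 v1 = 0 -> X u1 u2 v1 v2 = 0.
  by move=> f0; rewrite /X f0 b0l // scaler0.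
have X0r u1 u2 v1 v2 : f u2 v2 = 0 -> X u1 u2 v1 v2 = 0.
  by move=> f0; rewrite /X f0 b0r // scaler0.
case: u u0 uvn => // x u _ uvn; case: v v0 uvn => // y v _ uvn.
rewrite cuts_ends => [|u1 u2 uE u10 u20]; last first.
  rewrite -[RHS](cuts0 _ (y :: v)); apply: eq_cuts => v1 v2 vE.
  have := congr1 size uE; have := congr1 size vE; rewrite !size_cat /= => sv su.
  have [v10|v10] := posnP (size v1); [apply: X0r|apply: X0l]; apply: fn => //=.
  - by move: uvn => /=; lia.
  - by move: sv v10 => /=; lia.
  - by move: uvn => /=; lia.
rewrite !cuts_ends.
- rewrite (X0l _ _ [::]) // add0r (X0r (x :: u) [::] (y :: v)) // addr0.
  rewrite /X /f !shuffle_nil_r.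
  rewrite -[shuffle _ [::] _ _]/(F (map elt (y :: v))).
  rewrite [wpar par [::]]/wpar big_nil mulr0 sg0 scale1r addrC.
  by apply: bC; rewrite (trF_parity _ _ sVl si sb sK) //
    (mlinear_sg _ (trF_mlinear i K bl br) sE).
- move=> v1 v2 vE v10 v20; apply: X0l; apply: fn => //=.
  by have := congr1 size vE; move: uvn; rewrite size_cat /=; lia.
- move=> v1 v2 vE v10 v20; apply: X0r; apply: fn => //=.
  by have := congr1 size vE; move: uvn; rewrite size_cat /=; lia.
Qed.
End TransferShuffle.

(** * Transfer data *)

Section FixedPoints.
Variables (k : fieldType) (A : bicomplex k) (e : {linear A -> A}).

(** The image of the idempotent is encoded as its fixed points, a submodule cut out by a boolean
    predicate, so that the subtype inherits the module structure. *)
Definition fixed : {pred A} := fun x => e x == x.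

Fact fixed_submod : submod_closed fixed.
Proof.
split=> [|c x y]; first by rewrite unfold_in /fixed /= raddf0.
by rewrite !unfold_in /fixed /= linearP => /eqP-> /eqP->.
Qed.
HB.instance Definition _ := GRing.isSubmodClosed.Build k A fixed fixed_submod.

Record fixed_points := FixedPoint { fixed_val :> A; fixedP : fixed_val \in fixed }.
HB.instance Definition _ := [isSub for fixed_val].
HB.instance Definition _ := [Choice of fixed_points by <:].
HB.instance Definition _ := [SubChoice_isSubLmodule of fixed_points by <:].

Lemma fixed_linear (x y : fixed_points) (c : k) : val (c *: x + y) = c *: val x + val y.
Proof. by rewrite linearP. Qed.

Section Restrict.
Variable f : {linear A -> A}.
Hypothesis fe : forall x, e (f x) = f (e x).
Fact restrict_fixed (x : fixed_points) : f (val x) \in fixed.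
Proof. by rewrite unfold_in /fixed /= fe; case: x => x /= /eqP->. Qed.
Definition restrict x := FixedPoint (restrict_fixed x).
Fact restrict_linear : linear restrict.
Proof. by move=> c x y; apply: val_inj; rewrite /= !linearP. Qed.
End Restrict.

Hypothesis e_homog : forall d x, homog d x -> homog d (e x).
Hypotheses (e_del : forall x, e (del x) = del (e x))
  (e_delbar : forall x, e (delbar x) = delbar (e x)) (ee : forall x, e (e x) = e x).
Local Notation gr := (homog_bigrading A).

Lemma comp_fixed d (x : fixed_points) : gcomp gr d (val x) \in fixed.
Proof.
rewrite unfold_in /fixed /=.
suff H (y : A) : e (gcomp gr d y) = gcomp gr d (e y) by rewrite H (eqP (fixedP x)).
move: y; apply: (homog_eq gr); [exact: (linearP (e \o gcomp gr d))|exact: (linearP (gcomp gr d \o e))|].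
move=> c y hy; rewrite !(comp_homog gr _ hy) (comp_homog gr _ (e_homog hy)).
by case: ifP; rewrite ?raddf0.
Qed.

Definition fixed_homog (d : bidegree) (x : fixed_points) : Prop := homog d (val x).

Fact fixed_bigrading : is_bigrading fixed_homog.
Proof.
split=> [d|d c x y hx hy|x|ds w us hw w0 d dds].
- exact: (bigr_0 gr).
- by rewrite /fixed_homog fixed_linear; apply: (bigr_lin gr).
- exists (gsupp gr (val x)), (fun d => FixedPoint (comp_fixed d x)); split.
    by move=> d; apply: comp_gr.
  by apply: val_inj; rewrite raddf_sum /=; apply: comp_sum.
apply: val_inj; apply: (bigr_indep gr us (w := fun d => val (w d))) => //.
by rewrite -raddf_sum w0.
Qed.

Definition fixed_bicomplex : bicomplex k.
Proof.
refine (@Bicomplex k fixed_points fixed_homog fixed_bigrading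
  (mklinear (restrict_linear e_del)) (mklinear (restrict_linear e_delbar)) _ _ _ _ _).
- by move=> p q x; apply: del_homog.
- by move=> p q x; apply: delbar_homog.
- by move=> x; apply: val_inj; apply: del_del.
- by move=> x; apply: val_inj; apply: delbar_delbar.
- by move=> x; apply: val_inj; rewrite raddfD; apply: del_delbar.
Defined.

Definition fixed_incl : fixed_bicomplex -> A := fixed_val.
Fact fixed_incl_linear : linear fixed_incl.
Proof. by move=> c x y; rewrite /fixed_incl [LHS]fixed_linear. Qed.
Fact fixed_proj_fixed x : e x \in fixed.
Proof. by rewrite unfold_in /fixed /= ee. Qed.
Definition fixed_proj (x : A) : fixed_bicomplex := FixedPoint (fixed_proj_fixed x).
Fact fixed_proj_linear : linear fixed_proj.
Proof. by move=> c x y; apply: val_inj; rewrite [RHS]fixed_linear /= linearP. Qed.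
End FixedPoints.

Record transfer_data (k : fieldType) (A : bicomplex k) := TransferData {
  td_space : bicomplex k;
  td_incl : {linear td_space -> A};
  td_proj : {linear A -> td_space};
  td_htpy : {linear A -> A};
  td_minimal : minimal td_space;
  td_incl_homog : forall d x, homog d x -> homog d (td_incl x);
  td_proj_homog : forall d x, homog d x -> homog d (td_proj x);
  td_htpy_homog : forall p q x, homog (p, q) x -> homog (p - 1, q - 1) (td_htpy x);
  td_incl_del : forall x, td_incl (del x) = del (td_incl x);
  td_incl_delbar : forall x, td_incl (delbar x) = delbar (td_incl x);
  td_proj_del : forall x, td_proj (del x) = del (td_proj x);
  td_proj_delbar : forall x, td_proj (delbar x) = delbar (td_proj x);
  td_projK : forall x, td_proj (td_incl x) = x;
  td_dbl : forall x, dbl del delbar td_htpy x = x - td_incl (td_proj x) }.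

Lemma transfer_data_exists (k : fieldType) (A : bicomplex k) : inhabited (transfer_data A).
Proof.
have [e [h [[eh ed edb] ee Le hh hE]]] := bicomplex_splitting A; constructor.
refine (@TransferData k A (fixed_bicomplex eh ed edb)
  (mklinear (@fixed_incl_linear k A e eh ed edb))
  (mklinear (@fixed_proj_linear k A e eh ed edb ee)) h
  _ _ _ _ _ _ _ _ _ _).
- move=> x; apply: val_inj; rewrite raddf0 -(Le (val x)) /=.
  by rewrite (eqP (fixedP x)).
- by [].
- by move=> d x /eh.
- exact: hh.
- by [].
- by [].
- by move=> x; apply: val_inj; apply: ed.
- by move=> x; apply: val_inj; apply: edb.
- by move=> x; apply: val_inj; apply: (eqP (fixedP x)).
- exact: hE.
Qed.

Section WeakEquivalence.
Variables (k : fieldType) (A : bicomplex k) (T : transfer_data A).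
Local Notation i := (td_incl T).
Local Notation pi := (td_proj T).
Local Notation h := (td_htpy T).

Lemma td_htpyE x : x - i (pi x) = del (delbar (h x)) - del (h (delbar x)) +
  delbar (h (del x)) - h (delbar (del x)).
Proof. by rewrite -td_dbl. Qed.

(** On a Bott-Chern cocycle only [del (delbar (h y))] survives in [td_htpyE]; on an Aeppli cocycle
    the last term vanishes and the others lie in the images of [del] and [delbar]. This gives
    surjectivity, and [td_projK] gives injectivity. *)
Lemma td_weak_equivalence : pluripotential_weak_equivalence i.
Proof.
have min x : del (delbar x) = 0 := @td_minimal _ _ T x.
split; split.
- exact: linearP.
- exact: td_incl_homog.
- exact: td_incl_del.
- exact: td_incl_delbar.
- by move=> x [dx dbx]; split; rewrite -?(td_incl_del, td_incl_delbar) ?dx ?dbx raddf0.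
- move=> x y _ _ [z xy]; exists (i z).
  by rewrite -td_incl_delbar -td_incl_del -xy raddfB.
- move=> x y _ _ [z]; rewrite -raddfB => /(congr1 pi).
  by rewrite td_projK td_proj_del td_proj_delbar => ->; exists (pi z).
- move=> y [dy dby]; exists (pi y).
    by split; rewrite -?(td_proj_del, td_proj_delbar) ?dy ?dby raddf0.
  exists (- h y); rewrite -opprB td_htpyE dy dby !raddf0.
  by rewrite !addr0 !raddfN.
- by move=> x Hx; rewrite /A_cocycle -td_incl_delbar -td_incl_del min raddf0.
- move=> x y _ _ [u [v xy]]; exists (i u), (i v).
  by rewrite -td_incl_delbar -td_incl_del -raddfD -xy raddfB.
- move=> x y _ _ [u [v]]; rewrite -raddfB => /(congr1 pi).
  by rewrite td_projK raddfD /= td_proj_del td_proj_delbar => ->; exists (pi u), (pi v).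
- move=> y Ly; exists (pi y); first exact: min.
  exists (- (delbar (h y) - h (delbar y))), (- h (del y)).
  have Ly' : delbar (del y) = 0 by rewrite dbdE ?Ly ?oppr0 //; apply: del_delbar.
  rewrite -opprB td_htpyE Ly' raddf0 !raddfN !raddfB /=.
  zmodule.
Qed.
End WeakEquivalence.

(** * Parity and weight operators *)

Section Operators.
Variables (k : fieldType) (B : bicomplex k).
Local Notation gr := (homog_bigrading B).

(** The boolean [dir] allows both families of structure equations to be proved at once; [true]
    stands for [delbar]. *)
Definition dweight (dir : bool) (d : bidegree) : int := if dir then - d.1 else d.2.
Definition dshift (dir : bool) : bidegree := if dir then (0, 1) else (1, 0).
Definition dif (dir : bool) : {linear B -> B} := if dir then delbar else del.

Fact parity_fact d : linear (fun x : B => sg k (d.1 + d.2) *: x).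
Proof. by move=> c x y; rewrite scalerDr !scalerA mulrC. Qed.
Fact weight_fact dir d : linear (fun x : B => (dweight dir d)%:~R *: x).
Proof. by move=> c x y; rewrite scalerDr !scalerA mulrC. Qed.

Definition parity : {linear B -> B} :=
  locked (mklinear (dmap_linear gr parity_fact)).
Definition weight dir : {linear B -> B} :=
  locked (mklinear (dmap_linear gr (@weight_fact dir))).

Lemma parity_homog d (x : B) : homog d x -> parity x = sg k (d.1 + d.2) *: x.
Proof. by rewrite /parity -lock => hx; apply: (dmap_homog gr) hx => e; rewrite scaler0. Qed.

Lemma weight_homog dir d (x : B) : homog d x -> weight dir x = (dweight dir d)%:~R *: x.
Proof. by rewrite /weight -lock => hx; apply: (dmap_homog gr) hx => e; rewrite scaler0. Qed.

Lemma parityK x : parity (parity x) = x.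
Proof.
move: x; apply: (homog_eq gr); [exact: (linearP (parity \o parity))|exact: (linearP idfun)|].
by move=> d x hx; rewrite (parity_homog hx) linearZZ (parity_homog hx) scalerA sgsg scale1r.
Qed.

Lemma parity_weight dir x : parity (weight dir x) = weight dir (parity x).
Proof.
move: x; apply: (homog_eq gr); [exact: (linearP (parity \o weight dir))|exact: (linearP (weight dir \o parity))|].
move=> d x hx; rewrite (weight_homog dir hx) (parity_homog hx) !linearZZ.
by rewrite (weight_homog dir hx) (parity_homog hx) !scalerA mulrC.
Qed.

Lemma dif_homog dir d (x : B) :
  homog d x -> homog (d.1 + (dshift dir).1, d.2 + (dshift dir).2) (dif dir x).
Proof. by case: dir; case: d => p q /=; rewrite addr0; [apply: delbar_homog|apply: del_homog]. Qed.
End Operators.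

Section OperatorShift.
Variables (k : fieldType) (B C : bicomplex k) (f : {linear B -> C}) (z : bidegree).
Hypothesis fz : forall d x, homog d x -> homog (d.1 + z.1, d.2 + z.2) (f x).

Lemma parity_shift x : parity C (f x) = sg k (z.1 + z.2) *: f (parity B x).
Proof.
move: x; apply: (homog_eq (homog_bigrading B)).
- exact: (linearP (parity C \o f)).
- exact: (linearP (sg k (z.1 + z.2) \*: (f \o parity B))).
move=> d x hx; rewrite (parity_homog hx) (parity_homog (fz hx)) linearZZ scalerA -sgD.
by congr (sg k _ *: _) => /=; ring.
Qed.

Lemma weight_shift dir x :
  weight C dir (f x) = f (weight B dir x) + (dweight dir z)%:~R *: f x.
Proof.
move: x; apply: (homog_eq (homog_bigrading B)).
- exact: (linearP (weight C dir \o f)).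
- exact: (linearP ((f \o weight B dir) \+ ((dweight dir z)%:~R \*: f))).
move=> d x hx; rewrite (weight_homog dir hx) (weight_homog dir (fz hx)) linearZZ.
by rewrite -scalerDl -intrD; congr (_%:~R *: _); case: dir => /=; ring.
Qed.
End OperatorShift.

Section Multiplication.
Variables (k : fieldType) (A : cbba k).
Local Notation gr := (homog_bigrading A).
Local Notation mul := (@cmul k A).

Lemma homog_eq2 (f g : A -> A -> A) :
  (forall y, linear (f^~ y)) -> (forall x, linear (f x)) ->
  (forall y, linear (g^~ y)) -> (forall x, linear (g x)) ->
  (forall d d' x y, homog d x -> homog d' y -> f x y = g x y) ->
  forall x y, f x y = g x y.
Proof.
move=> fl fr gl gr' fg x y; move: x; apply: (homog_eq gr (fl y) (gl y)) => d x hx.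
move: y; apply: (homog_eq gr (fr x) (gr' x)) => d' y hy; exact: fg hx hy.
Qed.

Definition cmull (y : A) : {linear A -> A} := mklinear (@cmul_linear_l k A y).
Definition cmulr (x : A) : {linear A -> A} := mklinear (@cmul_linear_r k A x).

Lemma cmulDl (x x' y : A) : mul (x + x') y = mul x y + mul x' y.
Proof. exact: (raddfD (cmull y)). Qed.
Lemma cmulDr (x y y' : A) : mul x (y + y') = mul x y + mul x y'.
Proof. exact: (raddfD (cmulr x)). Qed.
Lemma cmulZl c (x y : A) : mul (c *: x) y = c *: mul x y.
Proof. exact: (linearZZ (cmull y)). Qed.
Lemma cmulZr c (x y : A) : mul x (c *: y) = c *: mul x y.
Proof. exact: (linearZZ (cmulr x)). Qed.
Lemma cmulNl (x y : A) : mul (- x) y = - mul x y.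
Proof. exact: (raddfN (cmull y)). Qed.
Lemma cmulNr (x y : A) : mul x (- y) = - mul x y.
Proof. exact: (raddfN (cmulr x)). Qed.

Lemma parity_mul x y : parity A (mul x y) = mul (parity A x) (parity A y).
Proof.
move: x y; apply: homog_eq2 => [y|x|y|x|[p q] [p' q'] x y hx hy].
- exact: (linearP (parity A \o cmull y)).
- exact: (linearP (parity A \o cmulr x)).
- exact: (linearP (cmull (parity A y) \o parity A)).
- exact: (linearP (cmulr (parity A x) \o parity A)).
rewrite (parity_homog hx) (parity_homog hy) (parity_homog (cmul_homog hx hy)).
by rewrite cmulZl cmulZr scalerA -sgD; congr (sg k _ *: _) => /=; ring.
Qed.

Lemma dif_mul dir x y : dif A dir (mul x y) =
  mul (dif A dir x) y + mul (parity A x) (dif A dir y).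
Proof.
move: x y; apply: homog_eq2 => [y|x|y|x|[p q] [p' q'] x y hx hy].
- exact: (linearP (dif A dir \o cmull y)).
- exact: (linearP (dif A dir \o cmulr x)).
- exact: (linearP ((cmull y \o dif A dir) \+ (cmull (dif A dir y) \o parity A))).
- exact: (linearP (cmulr (dif A dir x) \+ (cmulr (parity A x) \o dif A dir))).
rewrite (parity_homog hx) cmulZl; case: dir => /=.
  exact: cmul_delbar.
exact: cmul_del.
Qed.

Lemma weight_mul dir x y : weight A dir (mul x y) =
  mul (weight A dir x) y + mul x (weight A dir y).
Proof.
move: x y; apply: homog_eq2 => [y|x|y|x|[p q] [p' q'] x y hx hy].
- exact: (linearP (weight A dir \o cmull y)).
- exact: (linearP (weight A dir \o cmulr x)).
- exact: (linearP ((cmull y \o weight A dir) \+ (cmull (weight A dir y)))).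
- exact: (linearP (cmulr (weight A dir x) \+ (cmulr x \o weight A dir))).
rewrite (weight_homog dir hx) (weight_homog dir hy) (weight_homog dir (cmul_homog hx hy)).
by rewrite cmulZl cmulZr -scalerDl -intrD; congr (_%:~R *: _); case: dir => /=; ring.
Qed.

(** The sign (-1)^(ab) equals (1 + (-1)^a + (-1)^b - (-1)^(a+b)) / 2. Graded commutativity thus
    becomes a bilinear identity in terms of [parity]; it will be applied to values of the transfer,
    which have a parity but no single bidegree. *)
Lemma cmul_parity2 x y : mul x y *+ 2 = mul y x + mul (parity A y) x +
  mul y (parity A x) - mul (parity A y) (parity A x).
Proof.
move: x y; apply: homog_eq2 => [y|x|y|x|[p q] [p' q'] x y hx hy].
- exact: (linearP (cmull y \+ cmull y)).
- exact: (linearP (cmulr x \+ cmulr x)).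
- exact: (linearP ((cmulr y \+ cmulr (parity A y) \+ (cmulr y \o parity A)) \-
    (cmulr (parity A y) \o parity A))).
- exact: (linearP ((cmull x \+ (cmull x \o parity A) \+ cmull (parity A x)) \-
    (cmull (parity A x) \o parity A))).
rewrite (parity_homog hx) (parity_homog hy) (cmul_comm hx hy) !(cmulZl, cmulZr) /=.
rewrite scalerA -scaler_nat scalerA -{2}[mul y x]scale1r -!scalerDl -scalerBl.
congr (_ *: _); rewrite !sgE !(oddzM, oddzD).
by repeat match goal with |- context [oddz ?x] => case: (oddz x) end;
  rewrite /= ?expr0 ?expr1; ring.
Qed.

Lemma cmul_parity a b x y : (2 : k) != 0 ->
  parity A x = sg k a *: x -> parity A y = sg k b *: y ->
  mul x y = sg k (a * b) *: mul y x.
Proof.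
move=> k2 px py; apply: (scalerI k2).
rewrite scaler_nat cmul_parity2 px py !(cmulZl, cmulZr) !scalerA.
rewrite -[X in X + _ + _ + _]scale1r -!scalerDl -scalerBl.
congr (_ *: _); rewrite !sgE !(oddzM, oddzD).
by repeat match goal with |- context [oddz ?x] => case: (oddz x) end;
  rewrite /= ?expr0 ?expr1; ring.
Qed.
End Multiplication.

(** * The algebra with an odd parameter *)

Lemma pair_linear (k : fieldType) (U W W' : lmodType k) (f : U -> W) (g : U -> W') :
  linear f -> linear g -> linear (fun x : U => (f x, g x) : W * W').
Proof. by move=> lf lg c x y; rewrite lf lg. Qed.

Lemma pair_ext (S S' : Type) (x y : S * S') : x.1 = y.1 -> x.2 = y.2 -> x = y.
Proof. by case: x y => [? ?] [? ?] /= -> ->. Qed.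

Definition hshift : bidegree := (-1, -1).

Section Hat.
Variables (k : fieldType) (A : cbba k) (T : transfer_data A).
Local Notation H := (td_space T).
Local Notation i := (td_incl T).
Local Notation pi := (td_proj T).
Local Notation mul := (@cmul k A).
Local Notation gA := (parity A).
Local Notation gH := (parity H).

(** The sign is changed so that the homotopy [K] built from it contracts to [i pi - 1], the form
    required by the transfer. *)
Definition thtpy : {linear A -> A} := locked (mklinear (linearP (\- td_htpy T))).
Local Notation h := thtpy.
Definition khtpy : {linear A -> A} :=
  locked (mklinear (linearP
    (((delbar \o h) \- (h \o delbar)) \+ ((h \o del) \- (del \o h))))).
Local Notation K := khtpy.

Lemma thtpyE x : h x = - td_htpy T x.
Proof. by rewrite /thtpy -lock. Qed.

Lemma khtpyE x : K x = delbar (h x) - h (delbar x) + (h (del x) - del (h x)).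
Proof. by rewrite /khtpy -lock. Qed.

Lemma thtpy_homog d x : homog d x -> homog (d.1 + hshift.1, d.2 + hshift.2) (h x).
Proof. by rewrite thtpyE; case: d => p q /(@td_htpy_homog _ _ T)/(bigrN (homog_bigrading A)). Qed.

Lemma dif_khtpy dir x : dif A dir (K x) + K (dif A dir x) = i (pi x) - x.
Proof.
have dE y : delbar (del y) = - del (delbar y) :> A.
  by apply: dbdE; apply: del_delbar.
have := td_htpyE T x => /(congr1 -%R); rewrite opprB => ->.
case: dir; rewrite /= !khtpyE !thtpyE /=;
  rewrite !(raddfD del, raddfN del, raddfD delbar, raddfN delbar) /=;
  rewrite !(del_del, delbar_delbar, dE) ?(raddfN (td_htpy T)) ?raddf0 /=; zmodule.
Qed.

Lemma parity_dif (B : bicomplex k) dir (x : B) : parity B (dif B dir x) = - dif B dir (parity B x).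
Proof.
by rewrite (parity_shift (dif_homog dir)); case: dir; rewrite /= ?addr0 ?add0r sg1 scaleN1r.
Qed.

Lemma parity_thtpy x : gA (h x) = h (gA x).
Proof.
by rewrite (parity_shift thtpy_homog) sgE /= scale1r.
Qed.

Lemma parity_khtpy x : gA (K x) = - K (gA x).
Proof.
have P1 := parity_dif true; have P2 := parity_dif false; move: P1 P2 => /= P1 P2.
rewrite !khtpyE !(raddfD gA, raddfN gA) /= !(P1, P2, parity_thtpy) !(raddfN h) /=; zmodule.
Qed.

(** The summand [delbar, h] of [K] has bidegree (-1, 0) and the summand - [del, h] has bidegree (0,
    -1), so each weight detects exactly one of them. This is the identity that puts [h] into the
    second component of [hK]. *)
Lemma weight_khtpy dir x : weight A dir (K x) - K (weight A dir x) =
  dif A dir (h x) - h (dif A dir x).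
Proof.
have wh y := weight_shift thtpy_homog dir y.
have wd y := weight_shift (dif_homog (B := A) false) dir y.
have wdb y := weight_shift (dif_homog (B := A) true) dir y.
rewrite !khtpyE !(raddfD (weight A dir), raddfN (weight A dir)) /=.
move: wh wd wdb => /= wh wd wdb.
rewrite !(wh, wd, wdb) !(raddfD h, raddfD del, raddfD delbar) /=.
rewrite !(linearZZ h, linearZZ del, linearZZ delbar) /=.
by case: dir {wh wd wdb}; rewrite /= ?opprK ?oppr0 ?mulrN1z ?mulr1z ?scale0r ?scaleN1r ?scale1r; zmodule.
Qed.

Local Notation AA := (A * A)%type.
Local Notation HH := (H * H)%type.

(** A pair is read as x.1 + eps x.2 with eps odd. This is the product with the sign (-1)^degree on
    the left factor, as suspension requires; that sign operator is the opposite of [hpar], and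
    [heps] is left multiplication by eps. *)
Definition hmul (x y : AA) : AA := (mul (gA x.1) y.1, mul x.1 y.2 - mul (gA x.2) y.1).
Definition hpar (B : bicomplex k) (x : B * B) : B * B := (- parity B x.1, parity B x.2).
Definition hK : {linear AA -> AA} := mklinear (pair_linear
  (linearP (K \o fst)) (linearP ((h \o fst) \- (K \o snd)))).
Definition hi : {linear HH -> AA} := mklinear (pair_linear
  (linearP (i \o fst)) (linearP (i \o snd))).
Definition hpi : {linear AA -> HH} := mklinear (pair_linear
  (linearP (pi \o fst)) (linearP (pi \o snd))).
Definition hD (B : bicomplex k) dir : {linear (B * B)%type -> (B * B)%type} :=
  mklinear (pair_linear (linearP (dif B dir \o fst))
    (linearP ((weight B dir \o fst) \- (dif B dir \o snd)))).
Definition heps (B : bicomplex k) : {linear (B * B)%type -> (B * B)%type} :=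
  mklinear (pair_linear (linearP (\0%R : B * B -> B)) (linearP (fst : B * B -> B))).

Lemma hmul_linear_l y : linear (hmul^~ y).
Proof.
move=> c x x'; apply: pair_ext; rewrite /= !(linearP gA) /= !(cmulDl, cmulZl) //.
by rewrite scalerDr scalerN opprD; zmodule.
Qed.

Lemma hmul_linear_r x : linear (hmul x).
Proof.
move=> c y y'; apply: pair_ext; rewrite /= !(cmulDr, cmulZr) //.
by rewrite scalerDr scalerN opprD; zmodule.
Qed.

Lemma hpar_linear (B : bicomplex k) : linear (@hpar B).
Proof.
move=> c x y; apply: pair_ext; rewrite /= !(linearP (parity B)) //=.
by rewrite scalerN opprD.
Qed.

Lemma hpar_i x : hpar (hi x) = hi (hpar x).
Proof.
have ig y : gA (i y) = i (gH y).
  rewrite (parity_shift (z := (0, 0))) ?addr0 ?sg0 ?scale1r // => d z.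
  by rewrite !addr0; case: d => p q; apply: td_incl_homog.
by apply: pair_ext; rewrite /= ?raddfN /= ig.
Qed.

Lemma hpar_mul x y : hpar (hmul x y) = - hmul (hpar x) (hpar y).
Proof.
apply: pair_ext; rewrite /= ?(raddfN gA, raddfB gA) /= !parity_mul ?(raddfN gA) /= !parityK.
  by rewrite cmulNl cmulNr opprK.
by rewrite !(cmulNl, cmulNr); zmodule.
Qed.

Lemma hpar_K x : hpar (hK x) = - hK (hpar x).
Proof.
apply: pair_ext; rewrite /= ?(raddfB gA) /= ?(raddfN K) ?(raddfN h) /= ?parity_khtpy //.
by rewrite parity_thtpy; zmodule.
Qed.

Lemma hmulA x y z : hmul (hmul x y) z + hmul (hpar x) (hmul y z) = 0.
Proof.
apply: pair_ext; rewrite /= !(raddfN gA, raddfB gA) /= !parity_mul !parityK.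
  by rewrite !cmulNl -cmulA subrr.
rewrite !(cmulNl, cmulNr, cmulDl, cmulDr) !cmulA; zmodule.
Qed.

Lemma hD_mul dir x y :
  hD A dir (hmul x y) = - hmul (hD A dir x) y - hmul (hpar x) (hD A dir y).
Proof.
apply: pair_ext; rewrite /= !(raddfN gA, raddfB gA, raddfN (dif A dir), raddfB (dif A dir)) /=.
  rewrite dif_mul !parityK parity_dif !cmulNl.
  zmodule.
rewrite weight_mul !dif_mul !parityK !parity_dif parity_weight.
rewrite !(cmulNl, cmulNr, cmulDl, cmulDr); zmodule.
Qed.

Lemma hD_i dir x : hD A dir (hi x) = hi (hD H dir x).
Proof.
have iw y : weight A dir (i y) = i (weight H dir y).
  rewrite (weight_shift (z := (0, 0))).
    by case: dir; rewrite /= ?oppr0 scale0r addr0.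
  by move=> d z; rewrite !addr0; case: d => p q; apply: td_incl_homog.
have id y : dif A dir (i y) = i (dif H dir y).
  by case: dir {iw} => /=; rewrite ?td_incl_del ?td_incl_delbar.
by apply: pair_ext; rewrite /= ?(raddfB i) /= ?id ?iw.
Qed.

Lemma hD_pi dir x : hD H dir (hpi x) = hpi (hD A dir x).
Proof.
have iw y : weight H dir (pi y) = pi (weight A dir y).
  rewrite (weight_shift (z := (0, 0))).
    by case: dir; rewrite /= ?oppr0 scale0r addr0.
  by move=> d z; rewrite !addr0; case: d => p q; apply: td_proj_homog.
have id y : dif H dir (pi y) = pi (dif A dir y).
  by case: dir {iw} => /=; rewrite ?td_proj_del ?td_proj_delbar.
by apply: pair_ext; rewrite /= ?(raddfB pi) /= ?id ?iw.
Qed.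

Lemma hD_K dir x : hD A dir (hK x) + hK (hD A dir x) = hi (hpi x) - x.
Proof.
apply: pair_ext; rewrite /= ?dif_khtpy //.
have := weight_khtpy dir x.1 => /(canRL (subrK _)) wK.
have := dif_khtpy dir x.2 => /(canRL (addrK _)) dK.
rewrite !(raddfB (dif A dir), raddfB K) /= wK dK; zmodule.
Qed.

Lemma heps_mull x y : hmul (heps A x) y = - heps A (hmul x y).
Proof.
by apply: pair_ext; rewrite /= ?raddf0 !cmul0l ?oppr0 ?sub0r.
Qed.

Lemma heps_mulr x y : hmul x (heps A y) = - heps A (hmul (hpar x) y).
Proof.
by apply: pair_ext; rewrite /= !cmul0r ?oppr0 ?subr0 ?raddfN /= ?parityK ?cmulNl ?opprK ?addr0.
Qed.

Lemma heps_K x : hK (heps A x) = - heps A (hK x).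
Proof. by apply: pair_ext; rewrite /= !raddf0 ?oppr0 ?sub0r. Qed.

Lemma heps_i x : hi (heps H x) = heps A (hi x).
Proof. by apply: pair_ext; rewrite /= ?raddf0. Qed.
End Hat.

(** * The two components of the transferred maps *)

Section HatEquations.
Variables (k : fieldType) (A : cbba k) (T : transfer_data A).
Local Notation H := (td_space T).
Local Notation i := (td_incl T).
Local Notation pi := (td_proj T).
Local Notation mul := (@cmul k A).
Local Notation gA := (parity A).
Local Notation gH := (parity H).
Local Notation AA := (A * A)%type.
Local Notation HH := (H * H)%type.
Local Notation h := (thtpy T).
Local Notation K := (khtpy T).
Local Notation hmul := (@hmul k A).
Local Notation hK := (hK T).
Local Notation hi := (hi T).
Local Notation hpi := (hpi T).

Definition cst (B : bicomplex k) (x : B) : B * B := (x, 0).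
Definition spar (x : H) : H := - gH x.

Local Notation trFh := (trF hmul hi hK).
Local Notation trPh := (trP hmul hi hK).
Local Notation bil := (@hmul_linear_l k A).
Local Notation bir := (@hmul_linear_r k A).

(* e selects the coefficient of the odd parameter. *)
Definition Fh (e : bool) (xs : seq H) : A :=
  if e then (trFh (map (@cst H) xs)).2 else (trFh (map (@cst H) xs)).1.
Definition Ph (e : bool) (xs : seq H) : A :=
  if e then (trPh (map (@cst H) xs)).2 else (trPh (map (@cst H) xs)).1.
Definition mh (e : bool) (xs : seq H) : H := pi (Ph e xs).

Lemma Fh_pair xs : trFh (map (@cst H) xs) = (Fh false xs, Fh true xs).
Proof. exact: surjective_pairing. Qed.
Lemma Ph_pair xs : trPh (map (@cst H) xs) = (Ph false xs, Ph true xs).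
Proof. exact: surjective_pairing. Qed.

Lemma cst_lin c (x y : H) : cst (c *: x + y) = c *: cst x + cst y.
Proof. by apply: pair_ext; rewrite //= scaler0 addr0. Qed.

Lemma hat_mlinear (U : lmodType k) (phi : seq HH -> U) :
  mlinear phi -> mlinear (fun xs => phi (map (@cst H) xs)).
Proof. by move=> phil s t c x y; rewrite !map_cat /= cst_lin phil. Qed.

Lemma Fh_mlinear e : mlinear (Fh e).
Proof.
move=> s t c x y; have := hat_mlinear (trF_mlinear hi hK bil bir) s t c x y.
by rewrite /Fh => ->; case: e.
Qed.

Lemma Ph_mlinear e : mlinear (Ph e).
Proof.
move=> s t c x y; have := hat_mlinear (trP_mlinear hi hK bil bir) s t c x y.
by rewrite /Ph => ->; case: e.
Qed.

Lemma mh_mlinear e : mlinear (mh e).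
Proof. by move=> s t c x y; rewrite /mh Ph_mlinear linearP. Qed.

Lemma Fh_nil e : Fh e [::] = 0.
Proof. by rewrite /Fh -![map _ _]/([::] : seq HH) trF_nil; case: e. Qed.

Lemma Fh1 e x : Fh e [:: x] = if e then 0 else i x.
Proof. by rewrite /Fh -![map _ _]/[:: cst x] (trF1 _ _ bil bir); case: e; rewrite //= raddf0. Qed.

Lemma Ph1 e x : Ph e [:: x] = 0.
Proof. by rewrite /Ph -![map _ _]/[:: cst x] (trP1 _ _ bil bir); case: e. Qed.

Lemma mh1 e x : mh e [:: x] = 0.
Proof. by rewrite /mh Ph1 raddf0. Qed.

Lemma mh_nil e : mh e [::] = 0.
Proof. by rewrite /mh /Ph -![map _ _]/([::] : seq HH) (trP_nil _ _ bil); case: e; rewrite raddf0. Qed.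

Lemma Fh_ge2 e xs : (1 < size xs)%N ->
  Fh e xs = if e then h (Ph false xs) - K (Ph true xs) else K (Ph false xs).
Proof. by move=> xs2; rewrite /Fh (trF_ge2 _ _ bil bir) ?size_map // Ph_pair; case: e. Qed.

Lemma Ph_cuts e xs : Ph e xs = cuts (fun u v =>
  if e then mul (Fh false u) (Fh true v) - mul (gA (Fh true u)) (Fh false v)
  else mul (gA (Fh false u)) (Fh false v)) xs.
Proof.
rewrite /Ph /trP cuts_map.
case: e.
  by rewrite -[LHS]/((snd : {linear AA -> A}) _) raddf_cuts; apply: eq_cuts => u v _;
    rewrite !Fh_pair.
by rewrite -[LHS]/((fst : {linear AA -> A}) _) raddf_cuts; apply: eq_cuts => u v _;
  rewrite !Fh_pair.
Qed.

Section Direction.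
Variable dir : bool.

(** The operations together with their unary parts: the deformed differential sends a constant
    letter [x] to [dif x] plus the parameter times [weight x]. The component [true] is the
    coefficient of an odd parameter in an odd map, hence even. *)
Definition mext (e : bool) (xs : seq H) : H :=
  on_letter (if e then weight H dir else dif H dir) xs + mh e xs.

Lemma trm_hat xs : trm hmul hi hpi hK (hD H dir) (map (@cst H) xs) =
  cst (mext false xs) + heps H (cst (mext true xs)).
Proof.
have -> : trm hmul hi hpi hK (hD H dir) (map (@cst H) xs) =
    on_letter (hD H dir) (map (@cst H) xs) + hpi (Ph false xs, Ph true xs).
  by rewrite /trm Ph_pair.
have -> : on_letter (hD H dir) (map (@cst H) xs) =
    (on_letter (dif H dir) xs, on_letter (weight H dir) xs).
  by case: xs => [|x [|y xs]] //; apply: pair_ext; rewrite //= raddf0 subr0.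
by apply: pair_ext; rewrite /= ?addr0 ?add0r.
Qed.

Lemma hpar_cst x : hpar (cst x) = cst (spar x).
Proof. by apply: pair_ext; rewrite //= raddf0. Qed.

Lemma map_hpar_cst u : map (@hpar k H) (map (@cst H) u) = map (@cst H) (map spar u).
Proof. by rewrite -!map_comp; apply: eq_map => x; rewrite /= hpar_cst. Qed.

Lemma spar_map u : map spar (map spar u) = u.
Proof.
rewrite -map_comp -[RHS]map_id; apply: eq_map => x /=.
by rewrite /spar raddfN /= parityK opprK.
Qed.

Lemma bar_hat (U : lmodType k) (phi : seq HH -> U) xs : mlinear phi ->
  bar (@hpar k H) phi (trm hmul hi hpi hK (hD H dir)) (map (@cst H) xs) =
  bar spar (phi \o map (@cst H)) (mext false) xs +
  cuts (fun u vw => cuts (fun v w => phi (map (@cst H) (map spar u) ++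
    heps H (cst (mext true v)) :: map (@cst H) w)) vw) xs.
Proof.
move=> phil; rewrite /bar cuts_map cutsD; apply: eq_cuts => u vw _.
rewrite cuts_map cutsD; apply: eq_cuts => v w _.
by rewrite map_hpar_cst trm_hat (mlinearD phil) /= map_cat.
Qed.

Lemma trF_hat_eps u x w : trFh (map (@cst H) (map spar u) ++ heps H (cst x) :: map (@cst H) w) =
  heps A (trFh (map (@cst H) (u ++ x :: w))).
Proof.
rewrite (trF_scalar bil bir (@hpar_linear k A) (@hpar_i k A T) (@hpar_mul k A) (@hpar_K k A T) (@heps_mull k A)
  (@heps_mulr k A) (@heps_K k A T) (@heps_i k A T)) map_hpar_cst spar_map map_cat //.
Qed.

Lemma trP_hat_eps u x w : trPh (map (@cst H) (map spar u) ++ heps H (cst x) :: map (@cst H) w) =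
  - heps A (trPh (map (@cst H) (u ++ x :: w))).
Proof.
rewrite (trP_scalar bil bir (@hpar_linear k A) (@hpar_i k A T) (@hpar_mul k A) (@hpar_K k A T) (@heps_mull k A)
  (@heps_mulr k A) (@heps_K k A T) (@heps_i k A T)) map_hpar_cst spar_map map_cat //.
Qed.

Lemma bar_fst (phi : seq H -> AA) s m xs :
  (bar s phi m xs).1 = bar s (fun ys => (phi ys).1) m xs.
Proof.
rewrite -[LHS]/((fst : {linear AA -> A}) _) raddf_cuts.
by apply: eq_cuts => u vw _; rewrite raddf_cuts.
Qed.

Lemma bar_snd (phi : seq H -> AA) s m xs :
  (bar s phi m xs).2 = bar s (fun ys => (phi ys).2) m xs.
Proof.
rewrite -[LHS]/((snd : {linear AA -> A}) _) raddf_cuts.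
by apply: eq_cuts => u vw _; rewrite raddf_cuts.
Qed.

(** These are the components of [transfer_morphism] on constant words. Moving the parameter to the
    front applies [spar] a second time to the letters that it passes; this undoes the first sign,
    whence [bar id] for the even operation. *)
Lemma Fh_eq xs :
  dif A dir (Fh false xs) + Ph false xs = bar spar (Fh false) (mext false) xs /\
  weight A dir (Fh false xs) - dif A dir (Fh true xs) + Ph true xs =
  bar spar (Fh true) (mext false) xs + bar id (Fh false) (mext true) xs.
Proof.
have := transfer_morphism bil bir (@hpar_linear k A) (@hpar_i k A T) (@hpar_mul k A) (@hpar_K k A T) (@hmulA k A)
  (@hD_mul k A dir) (@hD_i k A T dir) (@hD_K k A T dir) (map (@cst H) xs).
rewrite bar_hat; last exact: (trF_mlinear _ _ bil bir).
have -> : cuts (fun u vw => cuts (fun v w => trFh (map (@cst H) (map spar u) ++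
    heps H (cst (mext true v)) :: map (@cst H) w)) vw) xs =
    heps A (bar id (trFh \o map (@cst H)) (mext true) xs).
  rewrite /bar raddf_cuts; apply: eq_cuts => u vw _; rewrite raddf_cuts.
  by apply: eq_cuts => v w _; rewrite trF_hat_eps map_id.
rewrite Fh_pair Ph_pair => E; split.
  have /= := congr1 fst E; rewrite bar_fst addr0 => <-.
  by [].
by have /= := congr1 snd E; rewrite bar_snd bar_fst => <-.
Qed.

Lemma mh_eq xs :
  dif H dir (mh false xs) + bar spar (mh false) (mext false) xs = 0 /\
  weight H dir (mh false xs) - dif H dir (mh true xs) +
  bar spar (mh true) (mext false) xs - bar id (mh false) (mext true) xs = 0.
Proof.
have := transfer_Ainf bil bir (@hpar_linear k A) (@hpar_i k A T) (@hpar_mul k A) (@hpar_K k A T) (@hmulA k A)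
  (@hD_mul k A dir) (@hD_i k A T dir) (@hD_K k A T dir) (map (@cst H) xs) (@hD_pi k A T dir).
rewrite bar_linear bar_hat; last exact: (trP_mlinear _ _ bil bir).
have -> : cuts (fun u vw => cuts (fun v w => trPh (map (@cst H) (map spar u) ++
    heps H (cst (mext true v)) :: map (@cst H) w)) vw) xs =
    - heps A (bar id (trPh \o map (@cst H)) (mext true) xs).
  rewrite -[RHS]/(mklinear (linearP (\- heps A)) _) /bar raddf_cuts; apply: eq_cuts => u vw _; rewrite raddf_cuts.
  by apply: eq_cuts => v w _; rewrite trP_hat_eps map_id.
have barm e s m : bar s (mh e) m xs = pi (bar s (Ph e) m xs).
  by rewrite -bar_linear.
rewrite Ph_pair => E; split.
  have /= := congr1 fst E; rewrite subr0 bar_fst => <-.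
  by rewrite barm.
have /= := congr1 snd E; rewrite bar_snd bar_fst raddfB => <-.
by rewrite !barm addrA.
Qed.
End Direction.
End HatEquations.

(** * Bihomogeneous components *)

Lemma eq_big_support (V : zmodType) (I : eqType) (s1 s2 : seq I) (f : I -> V) :
  uniq s1 -> uniq s2 ->
  (forall j, j \in s1 -> j \notin s2 -> f j = 0) ->
  (forall j, j \in s2 -> j \notin s1 -> f j = 0) ->
  \sum_(j <- s1) f j = \sum_(j <- s2) f j.
Proof.
move=> u1 u2 f1 f2.
rewrite [LHS](bigID (mem s2)) [RHS](bigID (mem s1)) /=.
rewrite [X in _ + X = _]big_seq_cond [X in _ + X = _]big1; last first.
  by move=> j /andP[]; apply: f1.
rewrite [X in _ = _ + X]big_seq_cond [X in _ = _ + X]big1; last first.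
  by move=> j /andP[]; apply: f2.
rewrite !addr0 -big_filter -[RHS]big_filter; apply: perm_big.
by apply: uniq_perm; rewrite ?filter_uniq // => j; rewrite !mem_filter /= andbC.
Qed.

Section Degrees.
Implicit Types ds : seq bidegree.

Lemma bideg_nil : bideg [::] = (0, 0).
Proof. by rewrite /bideg !big_nil. Qed.

Lemma bideg_cons d ds : bideg (d :: ds) = (d.1 + (bideg ds).1, d.2 + (bideg ds).2).
Proof. by rewrite /bideg !big_cons. Qed.

Lemma bideg_cat ds ds' :
  bideg (ds ++ ds') = ((bideg ds).1 + (bideg ds').1, (bideg ds).2 + (bideg ds').2).
Proof. by rewrite /bideg !big_cat. Qed.

Lemma tdeg_nil : tdeg [::] = 0.
Proof. by rewrite /tdeg bideg_nil addr0. Qed.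

Lemma tdeg_cons d ds : tdeg (d :: ds) = d.1 + d.2 + tdeg ds.
Proof. by rewrite /tdeg bideg_cons /= addrACA. Qed.

(* The sign exponent of the desuspension: the j-th of n factors is moved past
   n - j suspensions. *)
Fixpoint decal ds : int :=
  if ds is d :: ds' then (size ds')%:Z * (d.1 + d.2) + decal ds' else 0.

Lemma decal_cat ds ds' :
  decal (ds ++ ds') = decal ds + (size ds')%:Z * tdeg ds + decal ds'.
Proof.
elim: ds => [|d ds IHds] /=; first by rewrite tdeg_nil mulr0 !add0r.
by rewrite IHds tdeg_cons size_cat PoszD; ring.
Qed.
End Degrees.

Section HomogExtension.
Variables (k : fieldType) (H : bicomplex k) (U : lmodType k).
Local Notation gr := (homog_bigrading H).

Lemma all_homog_cons d ds (x : H) xs :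
  all_homog (d :: ds) (x :: xs) <-> homog d x /\ all_homog ds xs.
Proof.
split=> [[/= [sz] h]|[hx [sz h]]].
  by split; [apply: (h 0%N)|split=> // j; apply: (h j.+1)].
by split=> [|[|j]] /=; [rewrite sz| |apply: h].
Qed.

Lemma all_homog_cat ds ds' (xs xs' : seq H) : all_homog ds xs -> all_homog ds' xs' ->
  all_homog (ds ++ ds') (xs ++ xs').
Proof.
elim: xs ds => [|x xs IHxs] [|d ds]; try by case.
by move=> /all_homog_cons[hx hxs] h'; apply/all_homog_cons; split=> //; apply: IHxs.
Qed.

Lemma all_homog_take n ds (xs : seq H) : all_homog ds xs -> all_homog (take n ds) (take n xs).
Proof.
elim: xs ds n => [|x xs IHxs] [|d ds] n; try by case.
by case: n => [|n] // /all_homog_cons[hx hxs]; apply/all_homog_cons; split=> //; apply: IHxs.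
Qed.

Lemma all_homog_drop n ds (xs : seq H) : all_homog ds xs -> all_homog (drop n ds) (drop n xs).
Proof.
elim: xs ds n => [|x xs IHxs] [|d ds] n; try by case.
by case: n => [|n]; [rewrite !drop0|move=> /all_homog_cons[hx hxs]; exact: (IHxs ds n)].
Qed.

(** An operation receives a word without its bidegrees, whereas the sign of the desuspension depends
    on them: every letter is decomposed, and the formula is extended multilinearly. *)
Fixpoint hext (G : seq bidegree -> seq H -> U) (xs : seq H) : U :=
  if xs is x :: xs' then
    dmap gr (fun d y => hext (fun ds ys => G (d :: ds) (y :: ys)) xs') x
  else G [::] [::].

Lemma hext_lin c (G1 G2 : seq bidegree -> seq H -> U) xs :
  hext (fun ds ys => c *: G1 ds ys + G2 ds ys) xs = c *: hext G1 xs + hext G2 xs.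
Proof.
elim: xs G1 G2 => //= x xs IHxs G1 G2.
rewrite /dmap scaler_sumr -big_split; apply: eq_bigr => d _ /=; exact: IHxs.
Qed.

Lemma eq_hext (G1 G2 : seq bidegree -> seq H -> U) xs :
  (forall ds ys, size ys = size xs -> all_homog ds ys -> G1 ds ys = G2 ds ys) ->
  hext G1 xs = hext G2 xs.
Proof.
elim: xs G1 G2 => [|x xs IHxs] G1 G2 GG /=; first exact: GG.
apply: eq_bigr => d _; apply: IHxs => ds ys sz h; apply: GG; rewrite /= ?sz //.
by apply/all_homog_cons; split=> //; apply: comp_gr.
Qed.

Lemma hext0 (xs : seq H) : hext (fun _ _ => 0) xs = 0.
Proof.
elim: xs => [//|x xs IHxs] /=; rewrite /dmap big1 // => d _; exact: IHxs.
Qed.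

Lemma hext_mlinear (G : seq bidegree -> seq H -> U) :
  (forall ds, mlinear (G ds)) -> mlinear (hext G).
Proof.
move=> Gl s; elim: s G Gl => [|z s IHs] G Gl t c x y /=.
  apply: dmap_linear => d a u v; rewrite -hext_lin; apply: eq_hext => ds ys _ _.
  exact: (Gl _ [::]).
rewrite /dmap scaler_sumr -big_split; apply: eq_bigr => d _ /=; apply: IHs => ds.
exact: mlinear_cons.
Qed.

Lemma hext_homog (G : seq bidegree -> seq H -> U) ds xs :
  (forall ds, mlinear (G ds)) -> all_homog ds xs -> hext G xs = G ds xs.
Proof.
move=> Gl; elim: xs ds G Gl => [|x xs IHxs] [|d ds] G Gl; try by case.
move=> /all_homog_cons[hx hxs] /=.
rewrite (dmap_homog gr (d := d)) //; last first.
  move=> d'; rewrite -[RHS](hext0 xs); apply: eq_hext => ds' ys _ _.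
  exact: (mlinear0 (Gl _) [::]).
by rewrite (IHxs ds) // => ds'; apply: mlinear_cons.
Qed.
End HomogExtension.

Section Family.
Variables (k : fieldType) (H B : bicomplex k) (G : bool -> seq H -> B).
Hypothesis Gl : forall e, mlinear (G e).
Local Notation gr := (homog_bigrading B).

(** The binomial coefficient adapts [decal] to the prescribed signs. Composing arities l and m gives
    n - 1 = (l - 1) + (m - 1), so the three binomial coefficients together contribute (l - 1)(m - 1)
    modulo 2. *)
Definition fsign (n : nat) ds : k := sg k ('C(n.-1, 2)%:Z + decal ds).

(* The bidegree separates the two components of G, so that they can be added;
   fsign is the sign of the desuspension. *)
Definition fam : operations H B := fun n p q xs =>
  hext (fun ds ys => fsign n ds *:
    gcomp gr ((bideg ds).1 + p, (bideg ds).2 + q) (G false ys + G true ys)) xs.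

Fact fam_body_mlinear n p q ds : mlinear (fun ys => fsign n ds *:
    gcomp gr ((bideg ds).1 + p, (bideg ds).2 + q) (G false ys + G true ys)).
Proof.
move=> s t c x y; rewrite !Gl addrACA -scalerDr linearP /= scalerDr !scalerA.
by rewrite mulrC.
Qed.

Lemma fam_mlinear n p q : mlinear (fam n p q).
Proof. by apply: hext_mlinear => ds; apply: fam_body_mlinear. Qed.

Lemma fam_homog n p q ds xs : all_homog ds xs -> fam n p q xs =
  fsign n ds *: gcomp gr ((bideg ds).1 + p, (bideg ds).2 + q) (G false xs + G true xs).
Proof. by move=> h; rewrite /fam (hext_homog _ h) // => ds'; apply: fam_body_mlinear. Qed.

Lemma fam_bidegree n p q : has_bidegree n p q (fam n p q).
Proof. by move=> ds xs _ h; rewrite (fam_homog n p q h); apply: (bigrZ gr); apply: comp_gr. Qed.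
End Family.

Section Support.
Variables (k : fieldType) (B : bicomplex k).
Local Notation gr := (homog_bigrading B).

Definition supported (C : bidegree -> bool) (x : B) : Prop :=
  forall d, ~~ C d -> gcomp gr d x = 0.

Lemma supportedB C x y : supported C x -> supported C y -> supported C (x - y).
Proof. by move=> hx hy d nC; rewrite raddfB /= hx // hy // subr0. Qed.

Lemma supportedD C x y : supported C x -> supported C y -> supported C (x + y).
Proof. by move=> hx hy d nC; rewrite raddfD /= hx // hy // addr0. Qed.

Lemma supported0 C : supported C 0.
Proof. by move=> d _; rewrite raddf0. Qed.

Lemma supported_cuts C (T : Type) (F : seq T -> seq T -> B) xs :
  (forall u v, u ++ v = xs -> supported C (F u v)) -> supported C (cuts F xs).
Proof.
move=> h d nC; rewrite raddf_cuts -[RHS](cuts0 _ xs); apply: eq_cuts => u v uv.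
exact: h uv d nC.
Qed.

Lemma supported_homog (C : bidegree -> bool) d x : homog d x -> C d -> supported C x.
Proof.
move=> hx Cd e nC; apply: comp0 hx _; apply: contraNneq nC => ->; exact: Cd.
Qed.

Lemma supported_comp (U : bicomplex k) (C : bidegree -> bool) (f : {linear B -> U}) x
    (b : bidegree) : supported C x ->
  (forall d y, C d -> homog d y -> gcomp (homog_bigrading U) b (f y) = 0) ->
  gcomp (homog_bigrading U) b (f x) = 0.
Proof.
move=> hx hf; rewrite (comp_sum gr x) !raddf_sum big1 // => d _.
have [Cd|nC] := boolP (C d); first by apply: hf Cd _; apply: comp_gr.
by rewrite hx // !raddf0.
Qed.
End Support.

Lemma supported_shift (k : fieldType) (B U : bicomplex k) (f : {linear B -> U}) z
    (C C' : bidegree -> bool) x :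
  (forall d y, homog d y -> homog (d.1 + z.1, d.2 + z.2) (f y)) ->
  (forall d, C d -> C' (d.1 + z.1, d.2 + z.2)) ->
  supported C x -> supported C' (f x).
Proof.
move=> fz CC hx e nC; apply: supported_comp hx _ => d y Cd hy.
apply: comp0 (fz _ _ hy) _; apply: contraNneq nC => ->; exact: CC.
Qed.

Lemma supported_mul (k : fieldType) (A : cbba k) (C1 C2 C3 : bidegree -> bool) (x y : A) :
  (forall d d', C1 d -> C2 d' -> C3 (d.1 + d'.1, d.2 + d'.2)) ->
  supported C1 x -> supported C2 y -> supported C3 (cmul x y).
Proof.
move=> CC hx hy e nC.
apply: (@supported_comp _ _ _ _ (cmull y) x e hx) => d x' Cd hx'.
apply: (@supported_comp _ _ _ _ (cmulr x') y e hy) => -[p' q'] y' Cd' hy'.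
case: d Cd hx' => p q Cd hx'; apply: comp0 (cmul_homog hx' hy') _.
by apply: contraNneq nC => ->; apply: CC Cd Cd'.
Qed.

(* The bidegrees a + (p, q) with p + q = - m - e and p, q <= - e. *)
Definition cone (a : bidegree) (m : int) (e : bool) (d : bidegree) : bool :=
  [&& d.1 + e%:Z <= a.1, d.2 + e%:Z <= a.2 & d.1 + d.2 + m + e%:Z == a.1 + a.2].

Section TransferSupport.
Variables (k : fieldType) (A : cbba k) (T : transfer_data A).
Local Notation H := (td_space T).
Local Notation h := (thtpy T).
Local Notation K := (khtpy T).

Lemma thtpy_supported a m x : supported (cone a m false) x ->
  supported (cone a (m + 1) true) (h x).
Proof.
apply: supported_shift (thtpy_homog T) _ => d; rewrite /cone /=; lia.
Qed.

Lemma khtpy_supported a m e x : supported (cone a m e) x ->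
  supported (cone a (m + 1) e) (K x).
Proof.
move=> hx; rewrite khtpyE.
have Dh (dir : bool) : supported (cone a (m + 1) e) (dif A dir (h x)).
  apply: (@supported_shift _ _ _ _ _ (fun d => cone a (m + 1) e (d.1 + (dshift dir).1, d.2 + (dshift dir).2))
    _ _ (dif_homog dir)) => //.
  apply: supported_shift (thtpy_homog T) _ hx => d; rewrite /cone; case: dir => /=; lia.
have hD (dir : bool) : supported (cone a (m + 1) e) (h (dif A dir x)).
  apply: (@supported_shift _ _ _ _ _ (fun d => cone a (m + 1) e (d.1 + hshift.1, d.2 + hshift.2))
    _ _ (thtpy_homog T)) => //.
  apply: supported_shift (dif_homog dir) _ hx => d; rewrite /cone; case: dir => /=; lia.
apply: supportedD; first exact: (supportedB (Dh true) (hD true)).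
exact: (supportedB (hD false) (Dh false)).
Qed.

Lemma parity_supported C x : supported C x -> supported C (parity A x).
Proof.
apply: (@supported_shift _ _ _ _ (0, 0)) => [d y hy|d]; rewrite ?addr0; last by case: d.
by rewrite (parity_homog hy); apply: (bigrZ (homog_bigrading A)); case: d hy.
Qed.

(** Each [K] lowers one of the two degrees by 1. The component [true] arises by putting [h], which
    lowers both degrees, in place of exactly one [K]. This produces the index ranges in the
    definition of pluripotential structures. *)
Lemma Fh_Ph_supported n ds (xs : seq H) : all_homog ds xs -> (0 < size xs <= n)%N ->
  (forall e, supported (cone (bideg ds) ((size xs)%:Z - 1) e) (Fh e xs)) /\
  ((1 < size xs)%N -> forall e, supported (cone (bideg ds) ((size xs)%:Z - 2) e) (Ph e xs)).
Proof.
elim: n ds xs => [|n IHn] ds xs hxs /andP[xs0 xsn]; first by move: xs0 xsn; lia.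
have PS : (1 < size xs)%N -> forall e, supported (cone (bideg ds) ((size xs)%:Z - 2) e) (Ph e xs).
  move=> xs2 e; rewrite Ph_cuts; apply: supported_cuts => u v uv.
  case: (posnP (size u)) => [/size0nil->|u0].
    by rewrite !Fh_nil ?raddf0 !cmul0l subr0; case: e; apply: supported0.
  case: (posnP (size v)) => [/size0nil->|v0].
    by rewrite !Fh_nil ?raddf0 !cmul0r subr0; case: e; apply: supported0.
  have szuv : (size u + size v = size xs)%N by rewrite -size_cat uv.
  have hu := all_homog_take (size u) hxs; have hv := all_homog_drop (size u) hxs.
  rewrite -uv take_size_cat // in hu; rewrite -uv drop_size_cat // in hv.
  have [Fu _] := IHn _ _ hu ltac:(lia); have [Fv _] := IHn _ _ hv ltac:(lia).
  have bd : bideg ds = ((bideg (take (size u) ds)).1 + (bideg (drop (size u) ds)).1,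
      (bideg (take (size u) ds)).2 + (bideg (drop (size u) ds)).2).
    by rewrite -bideg_cat cat_take_drop.
  have mulS (e1 e2 e3 : bool) x y : (e1 + e2 = e3 :> nat)%N ->
      supported (cone (bideg (take (size u) ds)) ((size u)%:Z - 1) e1) x ->
      supported (cone (bideg (drop (size u) ds)) ((size v)%:Z - 1) e2) y ->
      supported (cone (bideg ds) ((size xs)%:Z - 2) e3) (cmul x y).
    move=> e123; apply: supported_mul => d d'; rewrite bd /cone /= -szuv; lia.
  case: e.
    apply: supportedB; first exact: mulS (Fu false) (Fv true).
    exact: mulS (parity_supported (Fu true)) (Fv false).
  exact: mulS (parity_supported (Fu false)) (Fv false).
split=> // e; case: (ltnP 1 (size xs)) => [xs2|xs1].
  have S (e' : bool) x : supported (cone (bideg ds) ((size xs)%:Z - 2 + 1) e') x ->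
      supported (cone (bideg ds) ((size xs)%:Z - 1) e') x.
    by congr supported; congr cone; ring.
  rewrite Fh_ge2 //; apply: S; case: e.
    apply: supportedB; first by apply: thtpy_supported; apply: PS.
    by apply: khtpy_supported; apply: PS.
  by apply: khtpy_supported; apply: PS.
case: xs ds hxs xs0 xs1 {xsn PS} => [|x []] // [|d [|d1 ds1]]; try by case.
move=> /all_homog_cons[hx _] _ _; rewrite Fh1; case: e; first exact: supported0.
apply: (@supported_homog _ _ _ d); first exact: td_incl_homog.
by rewrite bideg_cons bideg_nil /cone /=; lia.
Qed.

Lemma Fh_supported e ds (xs : seq H) : all_homog ds xs -> (0 < size xs)%N ->
  supported (cone (bideg ds) ((size xs)%:Z - 1) e) (Fh e xs).
Proof. by move=> hxs xs0; have [] := @Fh_Ph_supported (size xs) _ _ hxs; rewrite ?xs0 /=. Qed.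

Lemma mh_supported e ds (xs : seq H) : all_homog ds xs -> (0 < size xs)%N ->
  supported (cone (bideg ds) ((size xs)%:Z - 2) e) (mh e xs).
Proof.
move=> hxs xs0; case: (ltnP 1 (size xs)) => [xs2|xs1]; last first.
  by case: xs xs0 xs1 {hxs} => [|x []] //; rewrite mh1 => _ _; apply: supported0.
apply: (@supported_shift _ _ _ (td_proj T) (0, 0)); last first.
- by have [|_] := @Fh_Ph_supported (size xs) _ _ hxs; rewrite ?xs0 //=; apply.
- by case=> p q; rewrite !addr0.
- by case=> p q y; rewrite !addr0; apply: td_proj_homog.
Qed.
End TransferSupport.

(** * Sums over cuts as sums over positions and arities *)

Section BarSums.
Variables (k : fieldType) (H U : lmodType k) (G : seq H -> U) (s : H -> H).
Hypothesis Gl : mlinear G.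

Lemma bar_letter (D : H -> H) xs : bar s G (on_letter D) xs =
  \sum_(0 <= j < size xs) G (map s (take j xs) ++ D (nth 0 xs j) :: drop j.+1 xs).
Proof.
have E u vw : cuts (fun v w => G (map s u ++ on_letter D v :: w)) vw =
    if vw is x :: t then G (map s u ++ D x :: t) else 0.
  case: vw => [|x t] /=; first exact: mlinear0.
  rewrite (mlinear0 Gl) add0r; case: t => [//|y t] /=.
  rewrite cutsE big1 ?addr0 // => j _; exact: mlinear0.
rewrite /bar; under eq_cuts => u vw _ do rewrite E.
rewrite cutsE big_ord_recr /= drop_size addr0 big_mkord; apply: eq_bigr => j _.
by rewrite (drop_nth 0).
Qed.

Lemma bar_ops (m : seq H -> H) xs : m [::] = 0 -> (forall x, m [:: x] = 0) ->
  bar s G m xs = \sum_(2 <= l < (size xs).+1) \sum_(0 <= r < (size xs).+1 - l)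
    G (map s (take r xs) ++ m (take l (drop r xs)) :: drop (r + l) xs).
Proof.
move=> m0 m1; pose X r l := G (map s (take r xs) ++ m (take l (drop r xs)) :: drop (r + l) xs).
rewrite /bar cutsE /= -(big_mkord (fun=> true)
  (fun r => cuts (fun v w => G (map s (take r xs) ++ m v :: w)) (drop r xs))).
transitivity (\sum_(0 <= r < (size xs).+1) \sum_(0 <= l < (size xs).+1 | (r + l <= size xs)%N) X r l).
  apply: eq_big_nat => r /andP[_ rn]; rewrite cutsE size_drop.
  rewrite /= -(big_mkord (fun=> true) (fun l => G (map s (take r xs) ++ m (take l (drop r xs)) :: drop l (drop r xs)))).
  rewrite [LHS](big_nat_widen _ _ (size xs).+1) /=; last by rewrite ltnS leq_subr.
  rewrite [LHS]big_mkcond [RHS]big_mkcond /=; apply: eq_big_nat => l _.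
  rewrite ltnS leq_subRL ?(ltnSE rn) //=; case: ifP => // _.
  by rewrite /X drop_drop addnC.
rewrite (exchange_big_dep_nat (fun=> true)) //=.
rewrite [RHS](big_nat_widenl _ 0) //= [RHS]big_mkcond /=; apply: eq_big_nat => l /andP[_ ln].
case: (leqP 2 l) => l2.
  rewrite [RHS](big_nat_widen _ _ (size xs).+1) /=; last exact: leq_subr.
  rewrite [LHS]big_mkcond [RHS]big_mkcond /=; apply: eq_big_nat => r _.
  by congr (if _ then _ else _); lia.
rewrite big1 // => r rl; rewrite /X.
suff -> : m (take l (drop r xs)) = 0 by exact: mlinear0.
have := size_take_min l (drop r xs); case: (take l (drop r xs)) => [|x [|y t]] //=; lia.
Qed.

Lemma bar_split (D : H -> H) (m : seq H -> H) xs : m [::] = 0 -> (forall x, m [:: x] = 0) ->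
  bar s G (fun ys => on_letter D ys + m ys) xs =
  \sum_(0 <= j < size xs) G (map s (take j xs) ++ D (nth 0 xs j) :: drop j.+1 xs) +
  \sum_(2 <= l < (size xs).+1) \sum_(0 <= r < (size xs).+1 - l)
    G (map s (take r xs) ++ m (take l (drop r xs)) :: drop (r + l) xs).
Proof.
move=> m0 m1; rewrite -bar_letter -bar_ops // /bar cutsD; apply: eq_cuts => u vw _.
by rewrite cutsD; apply: eq_cuts => v w _; rewrite mlinearD.
Qed.
End BarSums.

(** * The structure equations *)

Lemma uniq_splits m p : uniq (splits m p).
Proof.
rewrite /splits; case: ifP => // _; rewrite map_inj_uniq ?uniq_weak_comps //.
by apply: inj_map => a b /oppr_inj[].
Qed.

Lemma splits2P P s : s \in splits 2 P ->
  [/\ s = [:: P - nth 0 s 1; nth 0 s 1], P - nth 0 s 1 <= 0 & nth 0 s 1 <= 0].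
Proof.
rewrite mem_splits; case: s => [|a [|b []]] //= /andP[/and3P[a0 b0 _]].
by rewrite !big_cons big_nil addr0 => /eqP <-; rewrite addrK.
Qed.

Lemma splits2_mem (P a : int) : P - a <= 0 -> a <= 0 -> [:: P - a; a] \in splits 2 P.
Proof.
by move=> h1 h2; rewrite mem_splits /= h1 h2 !big_cons big_nil addr0 subrK eqxx.
Qed.

Section SplitsSum.
Variables (k : fieldType) (H B : bicomplex k) (g : {linear H -> B}) (y : H).
Variables (dm b : bidegree) (P Q : int).
Local Notation gH := (homog_bigrading H).
Local Notation gB := (homog_bigrading B).

(** Only nonpositive pairs are listed in [splits]. By the hypotheses, a component of [y] outside
    them either vanishes or does not reach the bidegree [b], so the sum over splittings recovers all
    of [g y] in this bidegree. *)
Lemma splits2_sum :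
  (forall p2 q2, (0 < p2) || (0 < q2) -> gcomp gH (dm.1 + p2, dm.2 + q2) y = 0) ->
  (forall p2 q2 y', homog (dm.1 + p2, dm.2 + q2) y' ->
     (0 < P - p2) || (0 < Q - q2) -> gcomp gB b (g y') = 0) ->
  \sum_(ps <- splits 2 P) \sum_(qs <- splits 2 Q)
    gcomp gB b (g (gcomp gH (dm.1 + nth 0 ps 1, dm.2 + nth 0 qs 1) y)) =
  gcomp gB b (g y).
Proof.
move=> hy hg; rewrite [in RHS](comp_sum gH y) !raddf_sum.
pose S := [seq (dm.1 + nth 0 ps 1, dm.2 + nth 0 qs 1) : bidegree | ps <- splits 2 P, qs <- splits 2 Q].
have uS : uniq S.
  apply: allpairs_uniq; rewrite ?uniq_splits // => -[ps qs] [ps' qs'].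
  move=> /allpairsP[[a c] [/= a1 c1 [-> ->]]] /allpairsP[[a' c'] [/= a1' c1' [-> ->]]] /=.
  case=> /addrI e1 /addrI e2; have [-> _ _] := splits2P a1; have [-> _ _] := splits2P c1.
  by have [-> _ _] := splits2P a1'; have [-> _ _] := splits2P c1'; rewrite /= e1 e2.
transitivity (\sum_(d <- S) gcomp gB b (g (gcomp gH d y))).
  by rewrite big_allpairs_dep.
have [us _ s0 _] := supp_compP gH y.
apply: eq_big_support => // d.
  by move=> _ /s0->; rewrite !raddf0.
move=> _ dS; case: d dS => d1 d2 dS.
have -> : (d1, d2) = (dm.1 + (d1 - dm.1), dm.2 + (d2 - dm.2)) :> bidegree.
  by rewrite !subrKC.
set p2 := d1 - dm.1; set q2 := d2 - dm.2.
case hpq : ((0 < p2) || (0 < q2)); first by rewrite hy // !raddf0.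
apply: hg; first exact: comp_gr.
apply: contraR dS; rewrite negb_or => /andP[h1 h2]; apply/allpairsP.
exists ([:: P - p2; p2], [:: Q - q2; q2]); split => /=.
- by apply: splits2_mem; lia.
- by apply: splits2_mem; lia.
- by rewrite !subrKC.
Qed.
End SplitsSum.

Lemma mlinear_spar (k : fieldType) (A : cbba k) (T : transfer_data A) (U : lmodType k)
    (phi : seq (td_space T) -> U) ds u w : mlinear phi -> all_homog ds u ->
  phi (map (@spar k A T) u ++ w) = sg k (tdeg ds + (size u)%:Z) *: phi (u ++ w).
Proof.
elim: u ds phi => [|x u IHu] [|d ds] phi phil; try by case.
  by rewrite tdeg_nil addr0 sg0 scale1r.
move=> /all_homog_cons[hx hu] /=.
have -> : spar x = sg k (d.1 + d.2 + 1) *: x.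
  by rewrite /spar (parity_homog hx) [in RHS]sgD sg1 mulrN1 scaleNr.
rewrite (mlinearZ phil [::]) (IHu _ (fun t => phi (x :: t)) _ hu); last exact: mlinear_cons.
by rewrite scalerA -sgD tdeg_cons; congr (sg k _ *: _); rewrite -addn1 PoszD; ring.
Qed.

Lemma odd_bin2D a b : odd 'C(a + b, 2) = odd 'C(a, 2) (+) odd 'C(b, 2) (+) (odd a && odd b).
Proof.
elim: b => [|b IHb]; first by rewrite addn0 andbF !addbF.
rewrite addnS !binS !bin1 !oddD IHb /=.
by case: (odd 'C(a, 2)); case: (odd 'C(b, 2)); case: (odd a); case: (odd b).
Qed.

Section CompositionTerm.
Variables (k : fieldType) (A : cbba k) (T : transfer_data A) (B : bicomplex k).
Local Notation H := (td_space T).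
Local Notation spar := (@spar k A T).
Variables (G : bool -> seq H -> B) (z : int) (M : bool -> seq H -> H).
Hypothesis Gl : forall e, mlinear (G e).
Hypothesis Ml : forall e, mlinear (M e).
Hypothesis Gs : forall e ds xs, all_homog ds xs -> (0 < size xs)%N ->
  supported (cone (bideg ds) ((size xs)%:Z - z) e) (G e xs).
Hypothesis Ms : forall e ds xs, all_homog ds xs -> (0 < size xs)%N ->
  supported (cone (bideg ds) ((size xs)%:Z - 2) e) (M e xs).
Local Notation gB := (homog_bigrading B).

Variables (ds : seq bidegree) (xs : seq H) (r l m : nat) (p q P Q : int) (e : bool).
Hypothesis hxs : all_homog ds xs.
Hypotheses (l0 : (0 < l)%N) (rl : (r + l <= size xs)%N) (ml : (m + l = (size xs).+1)%N).
Hypotheses (pq : p + q = z - (size xs)%:Z - e%:Z) (PQ : P + Q = p + q + 1).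

Let u := take r xs.
Let v := take l (drop r xs).
Let w := drop (r + l) xs.
Let b : bidegree := ((bideg ds).1 + P, (bideg ds).2 + Q).
Let X e1 e2 p2 q2 := gcomp gB b (G e1 (u ++ gcomp (homog_bigrading H)
  ((bideg (take l (drop r ds))).1 + p2, (bideg (take l (drop r ds))).2 + q2) (M e2 v) :: w)).
(** The common sign of all nonzero terms of type (e1, e2). Total degree forces e1 + e2 = e, so two
    components [true] never meet: the parameter has square zero. *)
Let kappa (e1 e2 : bool) : k := if (e1 + e2 == e)%N then
  fsign k (size xs) ds * sg k ((z + 1) * (1 + e2%:Z) + e1%:Z + e2%:Z +
    (1 + e2%:Z) * (tdeg (take r ds) + r%:Z)) else 0.

(** The exponent [S] is prescribed only modulo 2, because the equations of algebras and of morphisms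
    write the same sign differently. Once the sign no longer depends on the splitting, [splits2_sum]
    reassembles the components. *)
Lemma composition_term (S : int -> int -> int -> int -> int) :
  (forall p1 q1 p2 q2, oddz (S p1 q1 p2 q2) =
    oddz (r%:Z * (l%:Z + 1) + m%:Z + (p1 + q1) * (l%:Z + p2 + q2) + p + q + (size xs)%:Z)) ->
  \sum_(ps <- splits 2 P) \sum_(qs <- splits 2 Q)
    sg k (S (nth 0 ps 0) (nth 0 qs 0) (nth 0 ps 1) (nth 0 qs 1)) *:
      comp_at (fam G m (nth 0 ps 0) (nth 0 qs 0)) r l (nth 0 ps 1 + nth 0 qs 1)
        (fam M l (nth 0 ps 1) (nth 0 qs 1)) ds xs =
  fsign k (size xs) ds *: gcomp gB b
    (if e then sg k z *: G true (map spar u ++ M false v :: w) - G false (u ++ M true v :: w)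
     else - (sg k z *: G false (map spar u ++ M false v :: w))).
Proof.
move=> SE.
have hu : all_homog (take r ds) u := all_homog_take r hxs.
have hv : all_homog (take l (drop r ds)) v := all_homog_take l (all_homog_drop r hxs).
have hw : all_homog (drop (r + l) ds) w := all_homog_drop (r + l) hxs.
have su : size u = r by rewrite size_takel; lia.
have sv : size v = l by rewrite size_takel // size_drop; lia.
have [s sxs] : exists s, size xs = (r + l + s)%N by exists (size xs - (r + l))%N; lia.
have sw : size w = s by rewrite size_drop sxs addKn.
have dsE : ds = take r ds ++ take l (drop r ds) ++ drop (r + l) ds.
  by rewrite -{1}(cat_take_drop r ds) -{1}(cat_take_drop l (drop r ds)) drop_drop addnC.
set du := take r ds in hu dsE *; set dv := take l (drop r ds) in hv dsE *.
set dw := drop (r + l) ds in hw dsE *.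
have sdw : size dw = size w by case: hw.
have sdv : size dv = l by case: hv => ->.
have termE ps qs : ps \in splits 2 P -> qs \in splits 2 Q ->
    sg k (S (nth 0 ps 0) (nth 0 qs 0) (nth 0 ps 1) (nth 0 qs 1)) *:
      comp_at (fam G m (nth 0 ps 0) (nth 0 qs 0)) r l (nth 0 ps 1 + nth 0 qs 1)
        (fam M l (nth 0 ps 1) (nth 0 qs 1)) ds xs =
    \sum_(e1 : bool) \sum_(e2 : bool) kappa e1 e2 *: X e1 e2 (nth 0 ps 1) (nth 0 qs 1).
  move=> /splits2P[-> p1le p2le] /splits2P[-> q1le q2le] /=.
  set p2 := nth 0 ps 1; set q2 := nth 0 qs 1.
  pose d2 : bidegree := ((bideg dv).1 + p2, (bideg dv).2 + q2).
  rewrite /comp_at -/u -/v -/w (fam_homog Ml _ _ _ hv).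
  rewrite (mlinearZ (fam_mlinear Gl _ _ _)) raddfD (mlinearD (fam_mlinear Gl _ _ _)).
  have hL e2 : all_homog (du ++ d2 :: dw) (u ++ gcomp (homog_bigrading H) d2 (M e2 v) :: w).
    by apply: all_homog_cat => //; apply/all_homog_cons; split=> //; apply: comp_gr.
  rewrite -/d2 !(fam_homog Gl _ _ _ (hL _)).
  have -> : (((bideg (du ++ d2 :: dw)).1 + (P - p2),
      (bideg (du ++ d2 :: dw)).2 + (Q - q2)) : bidegree) = b.
    by rewrite /b [in RHS]dsE !bideg_cat bideg_cons /=; congr (_, _); ring.
  rewrite -scalerDr !raddfD /= !scalerA -!sgD.
  rewrite !big_bool /=.
  pose c := sg k (S (P - p2) (Q - q2) p2 q2 + (p2 + q2) * tdeg (take r ds) +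
    ('C(l.-1, 2)%:Z + decal dv + ('C(m.-1, 2)%:Z + decal (du ++ d2 :: dw)))).
  (* Where the term is nonzero, the supports of [M] and [G] determine p2 + q2 and P - p2 + (Q - q2)
     from the arities, e1 and e2. Only then does the exponent reduce to that of [kappa]. *)
  have cX e1 e2 : c *: X e1 e2 p2 q2 = kappa e1 e2 *: X e1 e2 p2 q2.
    have [->|X0] := eqVneq (X e1 e2 p2 q2) 0; first by rewrite !scaler0.
    have h2 : p2 + q2 = 2 - l%:Z - e2%:Z.
      apply/eqP; apply: contraR X0 => h2; rewrite /X -/dv -/d2 (Ms hv) ?sv //.
        by rewrite (mlinear0 (Gl _)) raddf0.
      by rewrite /cone /d2 /= !negb_and; apply/orP; right; apply/orP; right; lia.
    have sL : size (u ++ gcomp (homog_bigrading H) d2 (M e2 v) :: w) = m.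
      by rewrite size_cat /= su sw; lia.
    have h1 : P - p2 + (Q - q2) = z - m%:Z - e1%:Z.
      apply/eqP; apply: contraR X0 => h1; rewrite /X -/dv -/d2 (Gs (hL _)) ?sL //.
        by lia.
      rewrite /cone /b [in (bideg ds).1]dsE [in (bideg ds).2]dsE !bideg_cat bideg_cons /=.
      by rewrite !negb_and; apply/orP; right; apply/orP; right; lia.
    have e12 : (e1 + e2 = e)%N by lia.
    rewrite /kappa e12 eqxx; congr (_ *: _); rewrite /c /fsign -!sgD; apply: sg_eq.
    rewrite !oddzD SE -/du [in decal ds]dsE !decal_cat /= size_cat.
    have d2E : d2.1 + d2.2 = tdeg dv + (2 - l%:Z - e2%:Z).
      by rewrite -h2 /tdeg /=; ring.
    rewrite d2E sdw sdv sw h1 h2.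
    have mE : m = (r + s).+1 by lia.
    have qE : q = z - (size xs)%:Z - e1%:Z - e2%:Z - p by lia.
    have nE : (size xs).-1 = (l.-1 + m.-1)%N by lia.
    have lE : l = l.-1.+1 by lia.
    rewrite nE qE sxs -!(addrA l%:Z) h2 mE lE /=.
    move: (l.-1) (decal du) (decal dv) (decal dw) (tdeg du) (tdeg dv) => l' a1 a2 a3 t1 t2.
    have ob (e3 : bool) : oddz e3 = e3 by case: e3.
    rewrite !(oddzD, oddzM, oddzN, oddz_nat, oddD, odd_bin2D, ob) /= !oddD.
    by move: (e1) (e2) (e) e12 => [] [] [] //= _; parity_table.
  rewrite -[LHS]/(c *: X false false p2 q2 + c *: X true false p2 q2 +
    (c *: X false true p2 q2 + c *: X true true p2 q2)) !cX; zmodule.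
rewrite (eq_big_seq _ (fun ps hps => eq_big_seq _ (fun qs hqs => termE ps qs hps hqs))) /=.
have XE e1 e2 : \sum_(ps <- splits 2 P) \sum_(qs <- splits 2 Q) X e1 e2 (nth 0 ps 1) (nth 0 qs 1) =
    gcomp gB b (G e1 (u ++ M e2 v :: w)).
  have lg : linear (fun y => G e1 (u ++ y :: w)) by move=> c y y'; apply: Gl.
  apply: (@splits2_sum _ _ _ (mklinear lg) (M e2 v) (bideg dv) b P Q) => [p2 q2 h|p2 q2 y hy h].
    by apply: (Ms hv); rewrite ?sv // /cone /= !negb_and; lia.
  have hL : all_homog (du ++ ((bideg dv).1 + p2, (bideg dv).2 + q2) :: dw) (u ++ y :: w).
    by apply: all_homog_cat => //; apply/all_homog_cons.
  apply: (Gs hL); first by rewrite size_cat /=; lia.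
  rewrite /cone /b [in (bideg ds).1]dsE [in (bideg ds).2]dsE !bideg_cat bideg_cons /=.
  by rewrite !negb_and; lia.
have kE e1 e2 : \sum_(ps <- splits 2 P) \sum_(qs <- splits 2 Q)
    kappa e1 e2 *: X e1 e2 (nth 0 ps 1) (nth 0 qs 1) =
    kappa e1 e2 *: gcomp gB b (G e1 (u ++ M e2 v :: w)).
  by rewrite -XE scaler_sumr; apply: eq_bigr => ps _; rewrite scaler_sumr.
transitivity (\sum_(e1 : bool) \sum_(e2 : bool)
    kappa e1 e2 *: gcomp gB b (G e1 (u ++ M e2 v :: w))).
  under eq_bigr do rewrite exchange_big /=.
  rewrite exchange_big /=; apply: eq_bigr => e1 _.
  under eq_bigr do rewrite exchange_big /=.
  rewrite exchange_big /=; apply: eq_bigr => e2 _; exact: kE.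
rewrite !big_bool /= !(mlinear_spar _ (Gl _) hu) su /kappa.
rewrite -/du; case: (e); rewrite /= ?scale0r ?addr0 ?add0r.
  rewrite (raddfB (gcomp gB b)) /= !(linearZZ (gcomp gB b)) scalerBr -scaleNr !scalerA.
  congr (_ *: _ + _ *: _).
    rewrite -!mulrA; congr (_ * _); rewrite -sgD; apply: sg_eq.
    by rewrite !(oddzD, oddzM, oddz1, oddz_nat) /=; parity_table.
  rewrite -mulrN1; congr (_ * _); rewrite sgE.
  by rewrite !(oddzD, oddzM, oddz1, oddz_nat) /=; case: (oddz z).
rewrite (raddfN (gcomp gB b)) /= !(linearZZ (gcomp gB b)) scalerN -scaleNr !scalerA; congr (_ *: _).
rewrite ?mulNr -?mulrA -?mulrN; congr (_ * _); rewrite -?sgD !sgE !(oddzD, oddzM, oddz1, oddz_nat).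
by case: (oddz z); case: (_ (+) odd r); rewrite /= ?expr0 ?expr1 ?mulN1r ?mul1r ?opprK.
Qed.
End CompositionTerm.

Lemma comp_dif (k : fieldType) (B : bicomplex k) dir d (x : B) :
  gcomp (homog_bigrading B) (d.1 + (dshift dir).1, d.2 + (dshift dir).2) (dif B dir x) =
  dif B dir (gcomp (homog_bigrading B) d x).
Proof. by case: dir; rewrite /= ?comp_del ?comp_delbar /= ?addr0 ?addrK; case: d. Qed.

Lemma comp_weight (k : fieldType) (B : bicomplex k) dir d (x : B) :
  gcomp (homog_bigrading B) d (weight B dir x) =
  (dweight dir d)%:~R *: gcomp (homog_bigrading B) d x.
Proof.
move: x; apply: (homog_eq (homog_bigrading B)).
- exact: (linearP (gcomp (homog_bigrading B) d \o weight B dir)).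
- exact: (linearP ((dweight dir d)%:~R \*: gcomp (homog_bigrading B) d)).
move=> e x hx; rewrite (weight_homog dir hx) (linearZZ (gcomp (homog_bigrading B) d)).
by rewrite /= (comp_homog _ _ hx); case: eqP => [->|_] //; rewrite !scaler0.
Qed.

Section BracketFamily.
Variables (k : fieldType) (A : cbba k) (T : transfer_data A) (B : bicomplex k).
Local Notation H := (td_space T).
Local Notation spar := (@spar k A T).
Variables (G : bool -> seq H -> B) (z : int).
Hypothesis Gl : forall e, mlinear (G e).
Hypothesis Gs : forall e ds xs, all_homog ds xs -> (0 < size xs)%N ->
  supported (cone (bideg ds) ((size xs)%:Z - z) e) (G e xs).
Local Notation gB := (homog_bigrading B).

Variables (dir : bool) (ds : seq bidegree) (xs : seq H) (p q : int) (e : bool).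
Hypotheses (hxs : all_homog ds xs) (xs0 : (0 < size xs)%N).
Hypothesis pq : p + q = z - (size xs)%:Z - e%:Z.
Let P := p + (dshift dir).1.
Let Q := q + (dshift dir).2.
Let b : bidegree := ((bideg ds).1 + P, (bideg ds).2 + Q).

Lemma dshift_sum : (dshift dir).1 + (dshift dir).2 = 1.
Proof. by case: (dir). Qed.

Lemma all_homog_dif j : (j < size xs)%N ->
  all_homog (take j ds ++ ((nth (0, 0) ds j).1 + (dshift dir).1,
    (nth (0, 0) ds j).2 + (dshift dir).2) :: drop j.+1 ds)
    (take j xs ++ dif H dir (nth 0 xs j) :: drop j.+1 xs).
Proof.
move=> jn; apply: all_homog_cat; first exact: all_homog_take.
apply/all_homog_cons; split; last exact: all_homog_drop.
by apply: dif_homog; case: hxs => _; apply.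
Qed.

Lemma comp_other (y : B) e' a m c : supported (cone a (m - z) e') y ->
  a.1 + a.2 + z - m - e'%:Z != c.1 + c.2 -> gcomp gB c y = 0.
Proof.
move=> hy hc; apply: hy; apply: contraNN hc => /and3P[_ _ /eqP h]; apply/eqP.
by rewrite -h; ring.
Qed.

(** The component other than [e] has the wrong total degree and drops out. Applying the differential
    to the j-th letter changes [decal], and this change turns the Leibniz sign into the suspended
    sign [spar] on the letters before it. *)
Lemma bracket_fam :
  bracket (dif H dir) (dif B dir) (p + q) (fam G (size xs) p q) ds xs =
  fsign k (size xs) ds *: gcomp gB b (dif B dir (G e xs) + sg k (z + e%:Z) *:
    \sum_(0 <= j < size xs)
      G e (map spar (take j xs) ++ dif H dir (nth 0 xs j) :: drop j.+1 xs)).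
Proof.
have sds : size ds = size xs by case: hxs.
rewrite /bracket (fam_homog Gl _ _ _ hxs) (linearZZ (dif B dir)) -comp_dif /= -!addrA -/P -/Q -/b.
rewrite [in RHS]raddfD scalerDr; congr (_ + _).
  congr (_ *: _); have := dif_homog (B := B) dir.
  have E e' : e' != e -> gcomp gB b (dif B dir (G e' xs)) = 0.
    move=> ee'; have -> : b = ((bideg ds).1 + p + (dshift dir).1,
        (bideg ds).2 + q + (dshift dir).2) by rewrite /b /P /Q !addrA.
    rewrite (comp_dif dir ((bideg ds).1 + p, (bideg ds).2 + q)) (comp_other (Gs (e := e') hxs xs0)) ?raddf0 //=.
    by move: ee'; case: (e') (e) pq => [] [] //=; lia.
  by rewrite !raddfD /=; case: (e) E => E; [rewrite (E false)|rewrite (E true)]; rewrite ?addr0 ?add0r.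
rewrite /= (linearZZ (gcomp gB b)) (raddf_sum (gcomp gB b)) /leibniz !scaler_sumr -sumrN.
apply: eq_big_nat => j /andP[_ jn].
have hj := all_homog_dif jn.
have -> : set_nth 0 xs j (dif H dir (nth 0 xs j)) =
    take j xs ++ dif H dir (nth 0 xs j) :: drop j.+1 xs.
  by rewrite set_nthE jn.
rewrite (fam_homog Gl _ _ _ hj) (mlinear_spar _ (@Gl e) (all_homog_take j hxs)).
set t := _ ++ _ :: _ in hj *.
have dsE : ds = take j ds ++ nth (0, 0) ds j :: drop j.+1 ds.
  by rewrite -drop_nth ?sds // cat_take_drop.
set ds' := _ ++ _ :: _ in hj *.
have bE : (((bideg ds').1 + p, (bideg ds').2 + q) : bidegree) = b.
  rewrite /b [in RHS]dsE /ds' !bideg_cat !bideg_cons /= /P /Q; congr (_, _); ring.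
have st : size t = size xs.
  by rewrite /t size_cat /= size_takel ?size_drop; lia.
rewrite bE; have -> : gcomp gB b (G false t + G true t) = gcomp gB b (G e t).
  have E e' : e' != e -> gcomp gB b (G e' t) = 0.
    move=> ee'; apply: (comp_other (Gs (e := e') hj _)); rewrite ?st //.
    rewrite /b [in (bideg ds).1]dsE [in (bideg ds).2]dsE /ds' !bideg_cat !bideg_cons /= /P /Q.
    by have := dshift_sum; move: ee'; case: (e') (e) pq => [] [] //=; lia.
  by rewrite raddfD /=; case: (e) E => E; [rewrite (E false)|rewrite (E true)]; rewrite ?addr0 ?add0r.
rewrite /= (linearZZ (gcomp gB b)) !scalerA -scaleNr; congr (_ *: _).
rewrite /fsign -!mulrA -!sgD -mulN1r -(sg1 k) -sgD; apply: sg_eq.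
have -> : p + q = z - (size xs)%:Z - e%:Z by [].
rewrite size_takel ?(ltnW jn) // [in decal ds]dsE /ds' !decal_cat /= size_drop sds.
have -> : (nth (0, 0) ds j).1 + (dshift dir).1 + ((nth (0, 0) ds j).2 + (dshift dir).2) =
    (nth (0, 0) ds j).1 + (nth (0, 0) ds j).2 + 1 by rewrite -dshift_sum; ring.
have [s sE] : exists s, size xs = (j + s.+1)%N by exists (size xs - j.+1)%N; lia.
have -> : (size xs - j.+1 = s)%N by lia.
rewrite sE !(oddzD, oddzM, oddzN, oddz1, oddz_nat, oddD) /=.
parity_table.
Qed.
End BracketFamily.

Section FamilyEquation.
Variables (k : fieldType) (A : cbba k) (T : transfer_data A) (B : bicomplex k).
Local Notation H := (td_space T).
Local Notation spar := (@spar k A T).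
Local Notation mh := (@mh k A T).
Variables (G Qt : bool -> seq H -> B) (z : int) (dir : bool).
Hypothesis Gl : forall e, mlinear (G e).
Hypothesis Gs : forall e ds xs, all_homog ds xs -> (0 < size xs)%N ->
  supported (cone (bideg ds) ((size xs)%:Z - z) e) (G e xs).
Hypothesis G_false : forall xs, dif B dir (G false xs) + Qt false xs =
  - (sg k z *: bar spar (G false) (@mext k A T dir false) xs).
Hypothesis G_true : forall xs,
  weight B dir (G false xs) - dif B dir (G true xs) + Qt true xs =
  bar id (G false) (@mext k A T dir true) xs - sg k z *: bar spar (G true) (@mext k A T dir false) xs.
Local Notation gB := (homog_bigrading B).

(** One statement serves both structures: [G] is [mh], [Qt] is 0 and [z] is 2 for the algebra, while
    [G] is [Fh], [Qt] is [Ph] and [z] is 1 for the morphism. *)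
Lemma family_equation ds xs (p q : int) (e : bool) (S : nat -> nat -> nat -> int -> int -> int -> int -> int) :
  all_homog ds xs -> (0 < size xs)%N -> p + q = z - (size xs)%:Z - e%:Z ->
  (forall r l m p1 q1 p2 q2, (m + l = (size xs).+1)%N -> oddz (S r l m p1 q1 p2 q2) =
    oddz (r%:Z * (l%:Z + 1) + m%:Z + (p1 + q1) * (l%:Z + p2 + q2) + p + q + (size xs)%:Z)) ->
  let P := p + (dshift dir).1 in let Q := q + (dshift dir).2 in
  bracket (dif H dir) (dif B dir) (p + q) (fam G (size xs) p q) ds xs =
  (dweight dir (P, Q))%:~R *: fam G (size xs) P Q xs +
  fsign k (size xs) ds *: gcomp gB ((bideg ds).1 + P, (bideg ds).2 + Q)
    (if e then Qt true xs else - Qt false xs) +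
  \sum_(2 <= l < (size xs).+1) \sum_(0 <= r < (size xs).+1 - l)
    \sum_(ps <- splits 2 P) \sum_(qs <- splits 2 Q)
    sg k (S r l ((size xs).+1 - l)%N (nth 0 ps 0) (nth 0 qs 0) (nth 0 ps 1) (nth 0 qs 1)) *:
      comp_at (fam G ((size xs).+1 - l)%N (nth 0 ps 0) (nth 0 qs 0)) r l (nth 0 ps 1 + nth 0 qs 1)
        (fam mh l (nth 0 ps 1) (nth 0 qs 1)) ds xs.
Proof.
move=> hxs xs0 pq SE P Q.
rewrite (bracket_fam Gl Gs dir hxs xs0 pq) -/P -/Q.
set b : bidegree := (_, _).
pose X r l := if e then sg k z *: G true (map spar (take r xs) ++ mh false (take l (drop r xs)) :: drop (r + l) xs)
    - G false (take r xs ++ mh true (take l (drop r xs)) :: drop (r + l) xs)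
  else - (sg k z *: G false (map spar (take r xs) ++ mh false (take l (drop r xs)) :: drop (r + l) xs)).
transitivity ((dweight dir (P, Q))%:~R *: fam G (size xs) P Q xs +
  fsign k (size xs) ds *: gcomp gB b (if e then Qt true xs else - Qt false xs) +
  fsign k (size xs) ds *: gcomp gB b
    (\sum_(2 <= l < (size xs).+1) \sum_(0 <= r < (size xs).+1 - l) X r l)); last first.
  congr (_ + _); rewrite (raddf_sum (gcomp gB b)) scaler_sumr.
  apply: eq_big_nat => l /andP[l2 ln]; rewrite (raddf_sum (gcomp gB b)) scaler_sumr.
  apply: eq_big_nat => r /andP[_ rl]; apply/esym.
  apply: (@composition_term _ _ _ _ _ z mh Gl _ Gs _ _ _ _ _ _ p q P Q e hxs _ _ _ pq _ (S r l _)).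
  - by move=> e'; apply: mh_mlinear.
  - by move=> e' ds' ys hy y0; apply: mh_supported.
  - lia.
  - lia.
  - lia.
  - by rewrite /P /Q -(dshift_sum dir); ring.
  - by move=> *; apply: SE; lia.
rewrite -addrA -scalerDr -raddfD /=.
have m1 e' (x : H) : mh e' [:: x] = 0 by apply: mh1.
have m0 e' : mh e' [::] = 0 by apply: mh_nil.
have famE : fam G (size xs) P Q xs = fsign k (size xs) ds *: gcomp gB b (G false xs + G true xs).
  by rewrite (fam_homog Gl _ _ _ hxs).
case: e pq @X => pq X; rewrite /X.
  have -> : fam G (size xs) P Q xs = fsign k (size xs) ds *: gcomp gB b (G false xs).
    rewrite famE raddfD /= [X in _ + X](comp_other (Gs (e := true) hxs xs0)) ?addr0 //.
    by rewrite /b /P /Q; have := dshift_sum dir; move: pq => /=; lia.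
  have := G_true xs; rewrite !bar_split // => GE.
  have wE : \sum_(0 <= j < size xs) G false (map id (take j xs) ++ weight H dir (nth 0 xs j) :: drop j.+1 xs)
      = (dweight dir (bideg ds))%:~R *: G false xs.
    have -> : (dweight dir (bideg ds))%:~R *: G false xs =
        \sum_(0 <= j < size ds) (dweight dir (nth (0, 0) ds j))%:~R *: G false xs.
      rewrite -scaler_suml -rmorph_sum -(big_nth (0, 0) xpredT (dweight dir)); congr (_%:~R *: _).
      by rewrite /bideg /dweight; case: (dir); rewrite //= -sumrN.
    have [sds hj] := hxs; rewrite sds; apply: eq_big_nat => j /andP[_ jn].
    rewrite map_id (weight_homog dir (hj j jn)) (mlinearZ (Gl false)).
    by rewrite -drop_nth // cat_take_drop.
  rewrite wE in GE.
  have GE1 : dif B dir (G true xs) = weight B dir (G false xs) + Qt true xs -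
      ((dweight dir (bideg ds))%:~R *: G false xs +
       \sum_(2 <= l < (size xs).+1) \sum_(0 <= r < (size xs).+1 - l)
         G false (map id (take r xs) ++ mh true (take l (drop r xs)) :: drop (r + l) xs) -
       sg k z *: (\sum_(0 <= j < size xs) G true (map spar (take j xs) ++ dif H dir (nth 0 xs j) :: drop j.+1 xs) +
       \sum_(2 <= l < (size xs).+1) \sum_(0 <= r < (size xs).+1 - l)
         G true (map spar (take r xs) ++ mh false (take l (drop r xs)) :: drop (r + l) xs))).
    by rewrite -GE; zmodule.
  rewrite scalerA mulrC -scalerA -scalerDr; congr (_ *: _).
  have -> : \sum_(2 <= l < (size xs).+1) \sum_(0 <= r < (size xs).+1 - l)
      (sg k z *: G true (map spar (take r xs) ++ mh false (take l (drop r xs)) :: drop (r + l) xs)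
      - G false (take r xs ++ mh true (take l (drop r xs)) :: drop (r + l) xs)) =
      sg k z *: (\sum_(2 <= l < (size xs).+1) \sum_(0 <= r < (size xs).+1 - l)
         G true (map spar (take r xs) ++ mh false (take l (drop r xs)) :: drop (r + l) xs))
      - \sum_(2 <= l < (size xs).+1) \sum_(0 <= r < (size xs).+1 - l)
         G false (map id (take r xs) ++ mh true (take l (drop r xs)) :: drop (r + l) xs).
    rewrite scaler_sumr -sumrB; apply: eq_bigr => l _.
    by rewrite scaler_sumr -sumrB; apply: eq_bigr => r _; rewrite map_id.
  (* The weight of the target bidegree minus the weights of all letters is the weight of (P, Q),
     that is q for [del] and -p for [delbar]: the coefficient in the structure equations. *)
  have -> : (dweight dir (P, Q))%:~R *: gcomp gB b (G false xs) =
      gcomp gB b (weight B dir (G false xs) - (dweight dir (bideg ds))%:~R *: G false xs).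
    rewrite (raddfB (gcomp gB b)) /= comp_weight (linearZZ (gcomp gB b)) -scalerBl -intrB.
    by congr (_%:~R *: _); rewrite /b /dweight; case: (dir) => /=; ring.
  rewrite -(raddfD (gcomp gB b)) /=; congr (gcomp gB b _).
  rewrite GE1 [sg k (z + 1)]sgD sg1 mulrN1 scaleNr [sg k z *: (_ + _)]scalerDr.
  set a := \sum_(0 <= j < size xs) _; set s1 := \sum_(2 <= l < _) _; set s2 := \sum_(2 <= l < _) _.
  zmodule.
(* For [e = false] the total degree P + Q is one more than the largest one in which [G] lives, so
   the term with the weight is zero. *)
have -> : fam G (size xs) P Q xs = 0.
  rewrite famE raddfD /= !(comp_other (Gs hxs xs0)) ?addr0 ?scaler0 //;
    by rewrite /b /P /Q; have := dshift_sum dir; move: pq => /=; lia.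
have := G_false xs; rewrite !bar_split // => GE.
rewrite scaler0 add0r; congr (_ *: gcomp gB b _).
have -> : \sum_(2 <= l < (size xs).+1) \sum_(0 <= r < (size xs).+1 - l)
      - (sg k z *: G false (map spar (take r xs) ++ mh false (take l (drop r xs)) :: drop (r + l) xs))
    = - (sg k z *: \sum_(2 <= l < (size xs).+1) \sum_(0 <= r < (size xs).+1 - l)
       G false (map spar (take r xs) ++ mh false (take l (drop r xs)) :: drop (r + l) xs)).
  rewrite scaler_sumr -sumrN; apply: eq_bigr => l _.
  by rewrite scaler_sumr -sumrN; apply: eq_bigr => r _.
move/(canRL (addrK _)): GE => ->; rewrite addr0 scalerDr.
set a := \sum_(0 <= j < size xs) _; set s1 := \sum_(2 <= l < _) _.
zmodule.
Qed.
End FamilyEquation.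

Lemma parity_cone (k : fieldType) (B : bicomplex k) a m e (x : B) :
  supported (cone a m e) x -> parity B x = sg k (a.1 + a.2 - m - e%:Z) *: x.
Proof.
move=> hx; apply: (gcomp_inj (Vgr := homog_bigrading B)) => d.
rewrite (linearZZ (gcomp (homog_bigrading B) d)) /=.
have -> : gcomp (homog_bigrading B) d (parity B x) = sg k (d.1 + d.2) *: gcomp (homog_bigrading B) d x.
  move: x {hx}; apply: (homog_eq (homog_bigrading B)).
  - exact: (linearP (gcomp (homog_bigrading B) d \o parity B)).
  - exact: (linearP (sg k (d.1 + d.2) \*: gcomp (homog_bigrading B) d)).
  move=> d' x hx; rewrite (parity_homog hx) (linearZZ (gcomp (homog_bigrading B) d)) /=.
  by rewrite (comp_homog _ _ hx); case: eqP => [->|_] //; rewrite !scaler0.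
have [/and3P[_ _ /eqP dE]|nC] := boolP (cone a m e d); last by rewrite hx // !scaler0.
by congr (sg k _ *: _); rewrite -dE; ring.
Qed.

Lemma comp_mulr (k : fieldType) (A : cbba k) (b d : bidegree) (x y : A) : homog d y ->
  gcomp (homog_bigrading A) b (cmul x y) =
  cmul (gcomp (homog_bigrading A) (b.1 - d.1, b.2 - d.2) x) y.
Proof.
move=> hy; move: x; apply: (homog_eq (homog_bigrading A)).
- exact: (linearP (gcomp (homog_bigrading A) b \o cmull y)).
- exact: (linearP (cmull y \o gcomp (homog_bigrading A) (b.1 - d.1, b.2 - d.2))).
case: d hy => p' q' hy [p q] x hx.
rewrite (comp_homog _ _ (cmul_homog hx hy)) (comp_homog _ _ hx).
case: b => b1 b2; rewrite !xpair_eqE /= !subr_eq.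
by case: ifP => //; rewrite cmul0l.
Qed.

Lemma big_comps2 (V : zmodType) n (X : seq nat -> V) :
  \sum_(ms <- comps 2 n) X ms = \sum_(1 <= j < n) X [:: j; (n - j)%N].
Proof.
rewrite -(big_map (fun j => [:: j; (n - j)%N]) xpredT X); apply: perm_big.
apply: uniq_perm.
- by rewrite filter_uniq // uniq_weak_comps.
- by rewrite map_inj_uniq ?iota_uniq // => a b [].
move=> s; rewrite mem_filter mem_weak_comps; apply/idP/mapP => [|[j]].
  case: s => [|a [|b [|c s]]] /=; rewrite ?andbF // => /andP[/and3P[a1 b1 _] /eqP sn].
  by exists a; rewrite ?mem_index_iota; [lia|congr [:: _; _]; lia].
by rewrite mem_index_iota => jn -> /=; lia.
Qed.

(** The first entry is a degree of the outer operation, which can only be 0 for the product of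
    [A]. *)
Lemma big_splits3 (V : zmodType) P (X : seq int -> V) :
  (forall s, nth 0 s 0 != 0 -> X s = 0) ->
  \sum_(ps <- splits 3 P) X ps = \sum_(ps <- splits 2 P) X (0 :: ps).
Proof.
move=> X0; rewrite -(big_map (cons 0) xpredT X); apply: eq_big_support.
- exact: uniq_splits.
- by rewrite map_inj_uniq ?uniq_splits // => a b [].
- move=> s sP sn; apply: X0; apply: contra sn => /eqP s0; apply/mapP.
  move: sP; rewrite mem_splits; case: s s0 => [|a s] //= -> /and3P[sz /= sa sb].
  exists s => //; rewrite mem_splits; move: sz sa sb; rewrite eqSS big_cons add0r.
  by move=> -> + -> => /= ->.
move=> s /mapP[t tP ->] /negP[].
by move: tP; rewrite !mem_splits big_cons add0r /= eqSS.
Qed.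

Arguments Fh : simpl never.
Arguments Ph : simpl never.
Arguments mh : simpl never.

(** * The quadratic term of the morphism equations *)

Section ProductTerm.
Variables (k : fieldType) (A : cbba k) (T : transfer_data A).
Local Notation H := (td_space T).
Local Notation Fh := (@Fh k A T).
Local Notation Ph := (@Ph k A T).
Local Notation F_ := (fam Fh).
Local Notation gA := (homog_bigrading A).
Local Notation mul := (@cmul k A).
Variables (ds : seq bidegree) (xs : seq H) (p q P Q : int) (e : bool).
Hypothesis hxs : all_homog ds xs.
Hypotheses (pq : p + q = 1 - (size xs)%:Z - e%:Z) (PQ : P + Q = p + q + 1).
Let b : bidegree := ((bideg ds).1 + P, (bideg ds).2 + Q).

Let kappa j (e1 e2 : bool) : k := if (e1 + e2 == e)%N then
  fsign k (size xs) ds * sg k ((1 + e2%:Z) * (tdeg (take j ds) + 1 + j%:Z + e1%:Z) + e2%:Z) else 0.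
Let Y j e1 e2 p2 q2 := gcomp gA b (mul (Fh e1 (take j xs))
  (gcomp gA ((bideg (drop j ds)).1 + p2, (bideg (drop j ds)).2 + q2) (Fh e2 (drop j xs)))).

(** The exponent is theta + eps1 for two factors and p_0 = q_0 = 0, increased by the Koszul exponent
    of the tensor product. As for compositions, the supports reduce it to a sign independent of the
    splitting. *)
Lemma product_term_sign j ps qs : (0 < j < size xs)%N -> ps \in splits 2 P -> qs \in splits 2 Q ->
  let p1 := nth 0 ps 0 in let p2 := nth 0 ps 1 in
  let q1 := nth 0 qs 0 in let q2 := nth 0 qs 1 in
  sg k (j%:Z * ((size xs - j)%N%:Z + 1) + (p1 + q1) * (p2 + q2 + (size xs - j)%N%:Z + 1)
    + p + q + (size xs)%:Z + 1 + (p2 + q2) * tdeg (take j ds)) *: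
    mul (F_ j p1 q1 (take j xs)) (F_ (size xs - j)%N p2 q2 (drop j xs)) =
  \sum_(e1 : bool) \sum_(e2 : bool) kappa j e1 e2 *: Y j e1 e2 p2 q2.
Proof.
move=> /andP[j0 jn] /splits2P[-> p1le p2le] /splits2P[-> q1le q2le] /=.
set p2 := nth 0 ps 1; set q2 := nth 0 qs 1.
have hu := all_homog_take j hxs; have hv := all_homog_drop j hxs.
have sds : size ds = size xs by case: hxs.
set u := take j xs in hu *; set v := drop j xs in hv *.
set du := take j ds in hu *; set dv := drop j ds in hv *.
have dsE : ds = du ++ dv by rewrite cat_take_drop.
have su : size u = j by rewrite size_takel // ltnW.
have sv : size v = (size xs - j)%N by rewrite size_drop.
have sdv : size dv = (size xs - j)%N by rewrite size_drop sds.
rewrite (fam_homog (@Fh_mlinear k A T) _ _ _ hu) (fam_homog (@Fh_mlinear k A T) _ _ _ hv).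
have compD a x y : gcomp gA a (x + y) = gcomp gA a x + gcomp gA a y by exact: raddfD.
rewrite cmulZl cmulZr !compD !scalerA !cmulDl !cmulDr.
pose c := sg k (j%:Z * ((size xs - j)%N%:Z + 1) + (P - p2 + (Q - q2)) * (p2 + q2 + (size xs - j)%N%:Z + 1)
  + p + q + (size xs)%:Z + 1 + (p2 + q2) * tdeg du) * fsign k j du * fsign k (size xs - j) dv.
pose a1 : bidegree := ((bideg du).1 + (P - p2), (bideg du).2 + (Q - q2)).
pose a2 : bidegree := ((bideg dv).1 + p2, (bideg dv).2 + q2).
have YE e1 e2 : mul (gcomp gA a1 (Fh e1 u)) (gcomp gA a2 (Fh e2 v)) = Y j e1 e2 p2 q2.
  rewrite /Y -/u -/v -/dv -/a2 (comp_mulr _ _ (comp_gr gA a2 _)); congr (mul (gcomp gA _ _) _).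
  by rewrite /b /a1 /a2 [in RHS]dsE !bideg_cat /=; congr (_, _); ring.
have cY e1 e2 : c *: Y j e1 e2 p2 q2 = kappa j e1 e2 *: Y j e1 e2 p2 q2.
  have [->|Y0] := eqVneq (Y j e1 e2 p2 q2) 0; first by rewrite !scaler0.
  rewrite -YE in Y0.
  have h2 : p2 + q2 = 1 - (size xs - j)%N%:Z - e2%:Z.
    apply/eqP; apply: contraR Y0 => h2; rewrite [gcomp gA a2 _](Fh_supported hv) ?cmul0r ?sv ?subn_gt0 //.
    by rewrite /cone /a2 /= !negb_and; apply/orP; right; apply/orP; right; lia.
  have h1 : P - p2 + (Q - q2) = 1 - j%:Z - e1%:Z.
    apply/eqP; apply: contraR Y0 => h1; rewrite [gcomp gA a1 _](Fh_supported hu) ?cmul0l ?su //.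
    by rewrite /cone /a1 /= !negb_and; apply/orP; right; apply/orP; right; lia.
  have e12 : (e1 + e2 = e)%N by lia.
  rewrite /kappa e12 eqxx; congr (_ *: _); rewrite /c /fsign -!sgD; apply: sg_eq.
  have [s sxs] : exists s, size xs = (j + s.+1)%N by exists (size xs - j.+1)%N; lia.
  have [j' jE] : exists j', j = j'.+1 by exists j.-1; lia.
  have qE : q = 1 - (size xs)%:Z - e1%:Z - e2%:Z - p by lia.
  have -> : 'C((size xs).-1, 2) = 'C(j' + s.+1, 2) by congr 'C(_, 2); lia.
  have -> : 'C((size xs - j).-1, 2) = 'C(s, 2) by congr 'C(_, 2); lia.
  rewrite -/du [in decal ds]dsE decal_cat sdv h1 h2 qE.
  have -> : (size xs - j = s.+1)%N by lia.
  rewrite sxs jE /=.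
  rewrite !(oddzD, oddzM, oddzN, oddz1, oddz_nat, oddD, odd_bin2D, binS, bin1) /= ?oddD.
  by move: (e1) (e2) (e) e12 => [] [] [] //= _; parity_table.
have -> : \sum_(e1 : bool) \sum_(e2 : bool) kappa j e1 e2 *: Y j e1 e2 p2 q2 =
    c *: Y j true true p2 q2 + c *: Y j true false p2 q2 +
    (c *: Y j false true p2 q2 + c *: Y j false false p2 q2).
  by rewrite !big_bool !cY.
rewrite -!YE -/a1 -/a2 mulrA -/c !scalerDr; zmodule.
Qed.

Lemma product_term j : (0 < j < size xs)%N ->
  \sum_(ps <- splits 2 P) \sum_(qs <- splits 2 Q)
    sg k (j%:Z * ((size xs - j)%N%:Z + 1) +
      (nth 0 ps 0 + nth 0 qs 0) * (nth 0 ps 1 + nth 0 qs 1 + (size xs - j)%N%:Z + 1)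
      + p + q + (size xs)%:Z + 1 + (nth 0 ps 1 + nth 0 qs 1) * tdeg (take j ds)) *:
    mul (F_ j (nth 0 ps 0) (nth 0 qs 0) (take j xs))
        (F_ (size xs - j)%N (nth 0 ps 1) (nth 0 qs 1) (drop j xs)) =
  - (fsign k (size xs) ds *: gcomp gA b (if e
    then mul (Fh false (take j xs)) (Fh true (drop j xs)) -
         mul (parity A (Fh true (take j xs))) (Fh false (drop j xs))
    else - mul (parity A (Fh false (take j xs))) (Fh false (drop j xs)))).
Proof.
move=> jn; have /andP[j0 jn'] := jn.
have hu := all_homog_take j hxs; have hv := all_homog_drop j hxs.
have su : size (take j xs) = j by rewrite size_takel // ltnW.
have sv : size (drop j xs) = (size xs - j)%N by rewrite size_drop.
have dsE : ds = take j ds ++ drop j ds by rewrite cat_take_drop.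
rewrite (eq_big_seq _ (fun ps hps => eq_big_seq _ (fun qs hqs =>
  product_term_sign jn hps hqs))) /=.
have YE e1 e2 : \sum_(ps <- splits 2 P) \sum_(qs <- splits 2 Q)
    Y j e1 e2 (nth 0 ps 1) (nth 0 qs 1) = gcomp gA b (mul (Fh e1 (take j xs)) (Fh e2 (drop j xs))).
  apply: (@splits2_sum _ _ _ (cmulr (Fh e1 (take j xs))) _ (bideg (drop j ds)) b P Q)
    => [p2 q2 h|p2 q2 y hy h].
    by apply: (Fh_supported hv); rewrite ?sv ?subn_gt0 // /cone /= !negb_and; lia.
  rewrite /= (comp_mulr _ _ hy) (Fh_supported hu) ?cmul0l ?su //.
  by rewrite /cone /b [in (bideg ds).1]dsE [in (bideg ds).2]dsE !bideg_cat /= !negb_and; lia.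
transitivity (\sum_(e1 : bool) \sum_(e2 : bool)
    kappa j e1 e2 *: gcomp gA b (mul (Fh e1 (take j xs)) (Fh e2 (drop j xs)))).
  under eq_bigr do rewrite exchange_big /=.
  rewrite exchange_big; apply: eq_bigr => e1 _.
  under eq_bigr do rewrite exchange_big /=.
  rewrite exchange_big; apply: eq_bigr => e2 _; rewrite -YE scaler_sumr.
  by apply: eq_bigr => ps _; rewrite scaler_sumr.
have compD x y : gcomp gA b (x + y) = gcomp gA b x + gcomp gA b y by exact: raddfD.
have compN x : gcomp gA b (- x) = - gcomp gA b x by exact: raddfN.
have compZ c x : gcomp gA b (c *: x) = c *: gcomp gA b x by exact: linearZZ.
have Fu0 e' := Fh_supported (e := e') hu; rewrite !(parity_cone (Fu0 _ _)) ?su //.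
rewrite !cmulZl /kappa.
have sum4 (X : bool -> bool -> A) : \sum_(e1 : bool) \sum_(e2 : bool) X e1 e2 =
    X true true + X true false + (X false true + X false false) by rewrite !big_bool.
rewrite sum4.
case: (e); rewrite /= ?scale0r ?addr0 ?add0r ?(compD, compN, compZ).
  rewrite scalerBr opprB scalerA -[LHS]/(_ *: _ + _ *: _) -[X in _ = _ - X]scale1r -scaleNr.
  rewrite [in RHS]scaleNr scale1r -!scaleNr; congr (_ *: _ + _ *: _).
    rewrite -/(tdeg (take j ds)); congr (_ * _); apply: sg_eq.
    by rewrite !(oddzD, oddzM, oddzN, oddz1, oddz_nat) /=; parity_table.
  rewrite -mulrN1 -(sg1 k); congr (_ * _); apply: sg_eq.
  by rewrite !(oddzD, oddzM, oddzN, oddz1, oddz_nat) /=; parity_table.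
rewrite scalerN opprK scalerA -/(tdeg (take j ds)); congr (_ * _ *: _); apply: sg_eq.
by rewrite !(oddzD, oddzM, oddzN, oddz1, oddz_nat) /=; parity_table.
Qed.
End ProductTerm.

Lemma big_nat_only (V : zmodType) a b j (X : nat -> V) : (a <= j < b)%N ->
  (forall i, i != j -> X i = 0) -> \sum_(a <= i < b) X i = X j.
Proof.
move=> jab X0; rewrite (bigD1_seq j) ?mem_index_iota ?iota_uniq //= big1 ?addr0 //.
Qed.

Section ProductSum.
Variables (k : fieldType) (A : cbba k) (T : transfer_data A).
Local Notation H := (td_space T).
Local Notation Fh := (@Fh k A T).
Local Notation Ph := (@Ph k A T).
Local Notation F_ := (fam Fh).
Local Notation gA := (homog_bigrading A).
Local Notation nu := (@cbba_operations k A).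

(** With only a binary product on the target, the sum over compositions of n runs over the cuts of
    the word into two nonempty parts, as [Ph] does. *)
Lemma mor_sum1_eq ds (xs : seq H) (p q P Q : int) (e : bool) : all_homog ds xs ->
  (0 < size xs)%N -> p + q = 1 - (size xs)%:Z - e%:Z -> P + Q = p + q + 1 ->
  mor_sum1 nu F_ (size xs) p q P Q ds xs =
  - (fsign k (size xs) ds *: gcomp gA ((bideg ds).1 + P, (bideg ds).2 + Q)
      (if e then Ph true xs else - Ph false xs)).
Proof.
move=> hxs xs0 pq PQ.
case: (ltnP 1 (size xs)) => [xs2|xs1]; last first.
  rewrite /mor_sum1 big_geq //.
  by case: xs xs0 xs1 {hxs pq} => [|x []] // _ _; rewrite !Ph1 oppr0 if_same raddf0 scaler0 oppr0.
rewrite /mor_sum1 (big_nat_only (j := 2)) => [||m m2]; rewrite ?ltnS //; last first.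
  apply: big1 => ms _; apply: big1 => ps _; apply: big1 => qs _ /=.
  by rewrite cbba_operations0 ?(negbTE m2) // !scaler0.
rewrite big_comps2.
have -> : - (fsign k (size xs) ds *: gcomp gA ((bideg ds).1 + P, (bideg ds).2 + Q)
      (if e then Ph true xs else - Ph false xs)) =
   \sum_(1 <= j < size xs) - (fsign k (size xs) ds *: gcomp gA ((bideg ds).1 + P, (bideg ds).2 + Q) (if e
    then cmul (Fh false (take j xs)) (Fh true (drop j xs)) -
         cmul (parity A (Fh true (take j xs))) (Fh false (drop j xs))
    else - cmul (parity A (Fh false (take j xs))) (Fh false (drop j xs)))).
  rewrite sumrN -scaler_sumr -raddf_sum; congr (- (_ *: gcomp gA _ _)).
  rewrite !Ph_cuts !cutsE.
  rewrite -(big_mkord xpredT (fun j => cmul (Fh false (take j xs)) (Fh true (drop j xs)) -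
         cmul (parity A (Fh true (take j xs))) (Fh false (drop j xs)))).
  rewrite -(big_mkord xpredT (fun j => cmul (parity A (Fh false (take j xs))) (Fh false (drop j xs)))).
  rewrite !big_nat_recr //= drop_size !Fh_nil !cmul0r subr0 !addr0.
  rewrite !(big_ltn xs0) !take0 !Fh_nil !raddf0 !cmul0l subr0 !add0r.
  by case: (e); rewrite ?sumrN.
apply: eq_big_nat => j jn.
rewrite -(product_term hxs pq PQ jn).
rewrite big_splits3 => [|ps ps0]; last first.
  apply: big1 => qs _ /=; rewrite cbba_operations0 ?(negbTE ps0) ?andbF // !scaler0 //.
apply: eq_bigr => ps _.
rewrite big_splits3 => [|qs qs0]; last first.
  by rewrite /= cbba_operations0 ?(negbTE qs0) ?andbF // !scaler0.
apply: eq_bigr => qs _ /=.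
rewrite scalerA -sgD /cbba_operations /= /tensor_vals /tensor_koszul /= .

rewrite [take _ (drop _ _)]take_oversize ?size_drop //; congr (sg k _ *: _).
rewrite unlock /= take0 tdeg_nil addn0; ring.
Qed.
End ProductSum.

Lemma sum_complement (V : zmodType) a n (X : nat -> nat -> V) :
  \sum_(a <= m < n.+1) \sum_(2 <= l < n.+1 | (m + l == n.+1)%N) X m l =
  \sum_(2 <= l < n.+1) (if (a <= n.+1 - l)%N then X (n.+1 - l)%N l else 0).
Proof.
under eq_bigr do rewrite big_mkcond.
rewrite exchange_big_nat; apply: eq_big_nat => l /andP[l2 ln].
case: ifP => al; last first.
  by rewrite big_nat big1 // => m mn; case: eqP => // ?; lia.
rewrite (big_nat_only (j := (n.+1 - l)%N)) => [||m mn].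
- by rewrite subnK ?eqxx // ltnW.
- by rewrite al; lia.
- by case: eqP => // ?; lia.
Qed.

(** * The A-infinity equations and the morphism equations *)

Section Structures.
Variables (k : fieldType) (A : cbba k) (T : transfer_data A).
Local Notation H := (td_space T).
Local Notation Fh := (@Fh k A T).
Local Notation Ph := (@Ph k A T).
Local Notation mh := (@mh k A T).
Local Notation gA := (homog_bigrading A).

Lemma mlinear_multilinear (U W : lmodType k) (phi : seq U -> W) n : mlinear phi -> multilinear n phi.
Proof. by move=> phil s t c x y _; apply: phil. Qed.

Lemma fam_mh1 p q (x : H) : fam mh 1 p q [:: x] = 0.
Proof.
rewrite -[RHS](hext0 H [:: x]) /fam; apply: eq_hext => ds [|y []] // _ _.
by rewrite !mh1 addr0 raddf0 scaler0.
Qed.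

Lemma alg_sum_eq ds (xs : seq H) p q P Q : all_homog ds xs ->
  alg_sum (fam mh) (size xs) p q P Q ds xs =
  \sum_(2 <= l < (size xs).+1) \sum_(0 <= r < (size xs).+1 - l)
    \sum_(ps <- splits 2 P) \sum_(qs <- splits 2 Q)
    sg k ((r.+1 * (l + 1))%N%:Z + (size xs)%:Z + ((nth 0 ps 0 + nth 0 qs 0) *
      (l%:Z + nth 0 ps 1 + nth 0 qs 1) + (p + q + (size xs)%:Z))) *:
      comp_at (fam mh ((size xs).+1 - l)%N (nth 0 ps 0) (nth 0 qs 0)) r l (nth 0 ps 1 + nth 0 qs 1)
        (fam mh l (nth 0 ps 1) (nth 0 qs 1)) ds xs.
Proof.
move=> hxs; rewrite /alg_sum sum_complement; apply: eq_big_nat => l /andP[l2 ln].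
case: ifP => [l'|l']; first by rewrite big_add1.
(* [alg_sum] has no outer operation of arity 1; the corresponding term of the sum on the right
   vanishes, because [mh] is zero on single letters. *)
have -> : ((size xs).+1 - l = 1)%N by lia.
rewrite big_nat1 big1 // => ps _; rewrite big1 // => qs _.
rewrite /comp_at !take0 drop0 add0n drop_oversize; last by lia.
by rewrite fam_mh1 !scaler0.
Qed.

Lemma mor_sum2_eq ds (xs : seq H) p q P Q :
  mor_sum2 (fam mh) (fam Fh) (size xs) p q P Q ds xs =
  - \sum_(2 <= l < (size xs).+1) \sum_(0 <= r < (size xs).+1 - l)
    \sum_(ps <- splits 2 P) \sum_(qs <- splits 2 Q)
    sg k ((r * (1 + l))%N%:Z + ((size xs).+1 - l)%N%:Z + ((nth 0 ps 0 + nth 0 qs 0) *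
      (nth 0 ps 1 + nth 0 qs 1 + l%:Z) + p + q + (size xs)%:Z)) *:
      comp_at (fam Fh ((size xs).+1 - l)%N (nth 0 ps 0) (nth 0 qs 0)) r l (nth 0 ps 1 + nth 0 qs 1)
        (fam mh l (nth 0 ps 1) (nth 0 qs 1)) ds xs.
Proof.
rewrite /mor_sum2 sum_complement -sumrN; apply: eq_big_nat => l /andP[l2 ln].
rewrite subn_gt0 ln -sumrN; apply: eq_bigr => r _; rewrite -sumrN; apply: eq_bigr => ps _.
rewrite -sumrN; apply: eq_bigr => qs _; rewrite -scaleNr -mulrN1 -(sg1 k) -sgD.
by rewrite addrA.
Qed.

Lemma alg_indexP n p q : alg_index n p q -> (0 < n)%N /\ exists e : bool, p + q = 2 - n%:Z - e%:Z.
Proof.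
case/andP=> n2 /orP[] /and3P[/eqP pq _ _]; split; try lia.
  by exists false; rewrite pq subr0.
by exists true; lia.
Qed.

Lemma mor_indexP n p q : mor_index n p q -> (0 < n)%N /\ exists e : bool, p + q = 1 - n%:Z - e%:Z.
Proof.
case/andP=> n2 /orP[] /and3P[/eqP pq _ _]; split; try lia.
  by exists false; rewrite pq subr0.
by exists true; lia.
Qed.

Lemma fam_vanish (B : bicomplex k) (G : bool -> seq H -> B) z n p q xs :
  (forall e ds xs, all_homog ds xs -> (0 < size xs)%N ->
    supported (cone (bideg ds) ((size xs)%:Z - z) e) (G e xs)) ->
  (0 < n)%N -> ~~ (((p + q == z - n%:Z) && ((p <= 0) && (q <= 0))) ||
    ((p + q == z - 1 - n%:Z) && ((p <= -1) && (q <= -1)))) ->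
  size xs = n -> fam G n p q xs = 0.
Proof.
move=> Gs n0 npq sxs; rewrite /fam -[RHS](hext0 (H := H) B xs); apply: eq_hext => ds ys sys hys.
rewrite raddfD /= !(Gs _ _ _ hys) ?addr0 ?scaler0 ?sys ?sxs //; rewrite /cone /=; lia.
Qed.

Lemma transferred_Ainf : pluripotential_Ainf (fam mh).
Proof.
have eqn dir n p q ds xs : alg_index n p q -> size xs = n -> all_homog ds xs ->
    bracket (dif H dir) (dif H dir) (p + q) (fam mh n p q) ds xs =
    (dweight dir (p + (dshift dir).1, q + (dshift dir).2))%:~R *:
      fam mh n (p + (dshift dir).1) (q + (dshift dir).2) xs +
    alg_sum (fam mh) n p q (p + (dshift dir).1) (q + (dshift dir).2) ds xs.
  move=> /alg_indexP[n0 [e pq]] sxs hxs; rewrite -sxs in n0 pq *.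
  rewrite (@family_equation _ _ _ _ _ (fun _ _ => 0) 2 dir (@mh_mlinear _ _ _) (@mh_supported _ _ _)
    _ _ ds xs p q e (fun r l m p1 q1 p2 q2 => (r.+1 * (l + 1))%N%:Z + (size xs)%:Z + ((p1 + q1) *
      (l%:Z + p2 + q2) + (p + q + (size xs)%:Z)))) //.
  - by rewrite oppr0 if_same raddf0 scaler0 addr0 (alg_sum_eq _ _ _ _ hxs).
  - move=> ys; rewrite addr0; have [h _] := mh_eq (T := T) dir ys.
    by apply/eqP; rewrite -subr_eq0 opprK sgE scale1r h.
  - move=> ys; rewrite addr0; have [_ h] := mh_eq (T := T) dir ys.
    by apply/eqP; rewrite -subr_eq0 -h sgE scale1r; apply/eqP; zmodule.
  move=> r l m p1 q1 p2 q2 ml; rewrite !(oddzD, oddzM, oddz1, oddz_nat) /=.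
  have -> : odd m = odd (size xs) (+) odd l (+) true by lia.
  rewrite ?oddM ?oddD /= ?oddD; parity_table.
split.
- by move=> n p q _; apply: mlinear_multilinear; apply: fam_mlinear; apply: mh_mlinear.
- by move=> n p q _; apply: fam_bidegree; apply: mh_mlinear.
- move=> n p q xs n2 npq; apply: (fam_vanish (@mh_supported _ _ _)); first lia.
  by move: npq; rewrite /alg_index n2.
- move=> n p q ds xs pq sxs hxs; have := eqn false n p q ds xs pq sxs hxs.
  by rewrite /= addr0.
- move=> n p q ds xs pq sxs hxs; have := eqn true n p q ds xs pq sxs hxs.
  by rewrite /= addr0 /dweight /= mulrNz.
Qed.

Lemma transferred_morphism :
  pluripotential_inf_morphism (fam mh) (@cbba_operations k A) (fam Fh).
Proof.
have eqn dir n p q ds xs : mor_index n p q -> size xs = n -> all_homog ds xs ->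
    bracket (dif H dir) (dif A dir) (p + q) (fam Fh n p q) ds xs =
    (dweight dir (p + (dshift dir).1, q + (dshift dir).2))%:~R *:
      fam Fh n (p + (dshift dir).1) (q + (dshift dir).2) xs -
    mor_sum1 (@cbba_operations k A) (fam Fh) n p q (p + (dshift dir).1) (q + (dshift dir).2) ds xs -
    mor_sum2 (fam mh) (fam Fh) n p q (p + (dshift dir).1) (q + (dshift dir).2) ds xs.
  move=> /mor_indexP[n0 [e pq]] sxs hxs; rewrite -sxs in n0 pq *.
  rewrite (@family_equation _ _ _ _ _ Ph 1 dir (@Fh_mlinear _ _ _) (@Fh_supported _ _ _)
    _ _ ds xs p q e (fun r l m p1 q1 p2 q2 => (r * (1 + l))%N%:Z + m%:Z + ((p1 + q1) *
      (p2 + q2 + l%:Z) + p + q + (size xs)%:Z))) //.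
  - rewrite mor_sum2_eq opprK (mor_sum1_eq hxs n0 pq) ?opprK //.
    by rewrite -(dshift_sum dir); ring.
  - by move=> ys; have [h _] := Fh_eq (T := T) dir ys; rewrite h sg1 scaleN1r opprK.
  - by move=> ys; have [_ h] := Fh_eq (T := T) dir ys; rewrite h sg1 scaleN1r opprK addrC.
  move=> r l m p1 q1 p2 q2 ml; rewrite !(oddzD, oddzM, oddz1, oddz_nat) /=.
  rewrite ?oddM ?oddD /= ?oddD; parity_table.
split.
- by move=> n p q _; apply: mlinear_multilinear; apply: fam_mlinear; apply: Fh_mlinear.
- by move=> n p q _; apply: fam_bidegree; apply: Fh_mlinear.
- move=> n p q xs n2 npq; apply: (fam_vanish (@Fh_supported _ _ _)); first lia.
  by move: npq; rewrite /mor_index n2; lia.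
- move=> n p q ds xs pq sxs hxs; have := eqn false n p q ds xs pq sxs hxs.
  by rewrite /= addr0.
- move=> n p q ds xs pq sxs hxs; have := eqn true n p q ds xs pq sxs hxs.
  by rewrite /= addr0 /dweight /= mulrNz.
Qed.

Lemma fam_Fh1 (x : H) : fam Fh 1 0 0 [:: x] = td_incl T x.
Proof.
move: x; apply: (homog_eq (homog_bigrading H)).
- by move=> c x y; apply: (fam_mlinear (@Fh_mlinear _ _ _) 1 0 0 [::] [::]).
- exact: linearP.
move=> d x hx.
have h1 : all_homog [:: d] [:: x] by apply/all_homog_cons.
rewrite (fam_homog (@Fh_mlinear _ _ _) _ _ _ h1) !Fh1 bideg_cons bideg_nil /= !addr0.
rewrite /fsign /= mul0r !addr0 sg0 scale1r.
have hi : homog d (td_incl T x) by case: d hx {h1} => a b; apply: td_incl_homog.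
by rewrite (comp_homog _ _ hi); case: d {hx hi h1} => a b; rewrite eqxx.
Qed.
End Structures.

(** * Shuffle permutations *)

Section Inversions.
Variables (n : nat) (s : 'S_n).

Definition inversion (a b : 'I_n) : bool := (a < b)%N && (s b < s a)%N.

(* The permutation s changes the sign of a Vandermonde determinant both by
   its sign and by one factor -1 for each inversion. *)
Lemma odd_inversions : odd (\sum_a \sum_(b | inversion a b) 1)%N = s.
Proof.
pose v : 'rV[int]_n := \row_j j%:Z.
pose w : 'rV[int]_n := \row_j (s j)%:Z.
have E : \det (Vandermonde n w) = (-1) ^+ s * \det (Vandermonde n v).
  have -> : Vandermonde n w = col_perm s (Vandermonde n v).
    by apply/matrixP => a b; rewrite !mxE.
  by rewrite col_permE det_mulmx det_perm odd_permV mulrC.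
rewrite !det_Vandermonde in E.
have sgprod (X : 'I_n -> 'I_n -> int) :
    sgz (\prod_(a < n) \prod_(b < n | (a < b)%N) X a b) =
    \prod_(a < n) \prod_(b < n | (a < b)%N) sgz (X a b).
  rewrite (big_morph (@sgz int) (id1 := 1) (op1 := *%R)) //; last exact: sgzM.
  by apply: eq_bigr => a _; rewrite (big_morph (@sgz int) (id1 := 1) (op1 := *%R)) //; apply: sgzM.
have := congr1 (@sgz int) E; rewrite sgzM !sgprod.
have -> : \prod_(a < n) \prod_(b < n | (a < b)%N) sgz (v 0 b - v 0 a) = 1.
  rewrite big1 // => a _; rewrite big1 // => b ab; rewrite !mxE; lia.
have -> : \prod_(a < n) \prod_(b < n | (a < b)%N) sgz (w 0 b - w 0 a) =
    (-1) ^+ (\sum_a \sum_(b | inversion a b) 1)%N.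
  rewrite -prodrXr; apply: eq_bigr => a _; rewrite -prodrXr.
  rewrite [LHS]big_mkcond [RHS]big_mkcond; apply: eq_bigr => b _; rewrite /inversion !mxE.
  case: (ltnP a b) => //= ab; have : s a != s b by rewrite (inj_eq perm_inj); apply: contraTneq ab => ->; rewrite ltnn.
  by rewrite -val_eqE /=; case: ltngtP => //= sab _; lia.
rewrite mulr1 -[in X in X = _]signr_odd.
by case: (odd _); case: (s : bool).
Qed.

(** For every [a], the difference s a - a is the number of inversions with [a] on the left minus the
    number with [a] on the right. Modulo 2 this expresses the change of [decal] under [s] through
    inversions. *)
Lemma sum_inversions (f : 'I_n -> int) :
  \sum_a f a * (s a)%:Z + \sum_a \sum_(b | inversion a b) (f a + f b) =
  \sum_a f a * a%:Z + 2 * \sum_a \sum_(b | inversion a b) f a.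
Proof.
have swap : \sum_a \sum_(b | inversion a b) f b = \sum_a \sum_(b | inversion b a) f a.
  by rewrite (exchange_big_dep xpredT).
have count (a : 'I_n) : \sum_(b < n) (nat_of_bool (b < a)%N)%:Z = a%:Z.
  transitivity (\sum_(b < n | (b < a)%N) 1 : int).
    by rewrite [RHS]big_mkcond; apply: eq_bigr => b _; case: ifP.
  by rewrite -(big_ord_widen n (fun=> 1) (ltnW (ltn_ord a))) sumr_const card_ord natz.
have scount a : \sum_b (nat_of_bool (s b < s a)%N)%:Z = (s a)%:Z.
  by rewrite -[RHS]count [RHS](reindex_inj (@perm_inj _ s)).
have E a : (s a)%:Z + \sum_(b | inversion b a) 1 = a%:Z + \sum_(b | inversion a b) 1.
  rewrite -(scount a) -(count a) [X in _ + X = _]big_mkcond [X in _ = _ + X]big_mkcond -!big_split /=.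
  apply: eq_bigr => b _; rewrite /inversion.
  case: (ltngtP a b) => [ab|ba|/val_inj ->]; rewrite ?ltnn //=.
    have : s a != s b by rewrite (inj_eq perm_inj); apply: contraTneq ab => ->; rewrite ltnn.
    by rewrite -val_eqE /=; case: ltngtP.
  have : s a != s b by rewrite (inj_eq perm_inj); apply: contraTneq ba => ->; rewrite ltnn.
  by rewrite -val_eqE /=; case: ltngtP.
have sumE a (P : pred 'I_n) : \sum_(b | P b) f a = f a * \sum_(b | P b) 1.
  by rewrite mulr_sumr; under [RHS]eq_bigr do rewrite mulr1.
have -> : \sum_a \sum_(b | inversion a b) (f a + f b) =
    \sum_a \sum_(b | inversion a b) f a + \sum_a \sum_(b | inversion b a) f a.
  by rewrite -swap -big_split; apply: eq_bigr => a _; rewrite big_split.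
rewrite mulr_sumr -!big_split; apply: eq_bigr => a _ /=; rewrite !sumE.
have -> : (s a)%:Z = a%:Z + \sum_(b | inversion a b) 1 - \sum_(b | inversion b a) 1.
  by rewrite -E addrK.
ring.
Qed.
End Inversions.

Fixpoint shuffles (u : seq nat) : seq nat -> seq (seq nat) :=
  match u with
  | [::] => fun v => [:: v]
  | x :: u' =>
    let fix shuffles_x (v : seq nat) : seq (seq nat) :=
      match v with
      | [::] => [:: x :: u']
      | y :: v' => map (cons x) (shuffles u' (y :: v')) ++ map (cons y) (shuffles_x v')
      end in shuffles_x
  end.

Lemma shuffles_cons x u y v : shuffles (x :: u) (y :: v) =
  map (cons x) (shuffles u (y :: v)) ++ map (cons y) (shuffles (x :: u) v).
Proof. by []. Qed.

Lemma shuffles_nil_r u : shuffles u [::] = [:: u].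
Proof. by case: u. Qed.

Lemma mem_map_cons (x t : nat) w (l : seq (seq nat)) :
  (t :: w \in map (cons x) l) = (t == x) && (w \in l).
Proof.
apply/mapP/andP => [[w' w'l [-> ->]]|[/eqP-> wl]]; [by rewrite eqxx|by exists w].
Qed.

Lemma nil_map_cons (x : nat) (l : seq (seq nat)) : ([::] \in map (cons x) l) = false.
Proof. by apply/mapP => -[]. Qed.

(** Describing a shuffle by its two subwords, and not by the recursion, permits the comparison with
    the monotonicity conditions of [is_shuffle]. *)
Lemma mem_shuffles (p : pred nat) u v w : all p u -> all (predC p) v ->
  (w \in shuffles u v) = (filter p w == u) && (filter (predC p) w == v).
Proof.
have filter0 q (t : seq nat) : all (predC q) t -> filter q t = [::].
  by elim: t => //= y t IHt /andP[/negbTE-> /IHt].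
move: u v w; apply: shuffle_ind => [v w _ nv|u w pu _|x u y v IHu IHv w].
- rewrite inE; apply/eqP/andP => [->|[/eqP pw /eqP <-]].
    by rewrite (all_filterP nv) filter0 ?eqxx.
  by elim: w pw => //= t w IHw; case: (p t) => //= /IHw <-.
- rewrite shuffles_nil_r inE; apply/eqP/andP => [->|[/eqP <- /eqP]].
    rewrite (all_filterP pu) eqxx filter0 //; apply: sub_all pu => t /= ->//.
  by elim: w => //= t w IHw; case: (p t) => //= /IHw <-.
rewrite shuffles_cons mem_cat => pxu nyv.
have /andP[px pu] := pxu; have /andP[/= ny nv] := nyv.
case: w => [|t w]; first by rewrite !nil_map_cons.
rewrite !mem_map_cons IHu // IHv //=.
have [pt|npt] := boolP (p t); rewrite /= ?eqseq_cons.
  by rewrite [t == y](contraNF _ ny) ?orbF ?andbA // => /eqP<-.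
by rewrite [t == x](contraNF _ npt) //= => [|/eqP->//]; rewrite andbCA.
Qed.

Lemma perm_shuffles u v w : w \in shuffles u v -> perm_eq w (u ++ v).
Proof.
move: u v w; apply: shuffle_ind => [v w|u w|x u y v IHu IHv w].
- by rewrite inE => /eqP->.
- by rewrite shuffles_nil_r inE cats0 => /eqP->.
rewrite shuffles_cons mem_cat => /orP[] /mapP[w' w'l ->].
  by rewrite /= perm_cons IHu.
by rewrite -[y :: v]cat1s perm_sym perm_catCA /= perm_cons perm_sym IHv.
Qed.

Lemma uniq_shuffles (p : pred nat) u v : all p u -> all (predC p) v -> uniq (shuffles u v).
Proof.
move: u v; apply: shuffle_ind => [v //|u|x u y v IHu IHv pxu nyv].
  by rewrite shuffles_nil_r.
have /andP[px pu] := pxu; have /andP[ny nv] := nyv.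
rewrite shuffles_cons cat_uniq !map_inj_uniq ?IHu ?IHv // => [|a b [->]|a b [->]] //.
rewrite andbT; apply/hasPn => w /mapP[w' _ ->]; rewrite /= mem_map_cons.
by apply/negP => /andP[/eqP yx _]; move: ny; rewrite /= yx px.
Qed.

Section WordSign.
Variable par : nat -> int.

(** The exponent of the Koszul sign for sorting [w], one product of parities for each pair out of
    order. *)
Fixpoint wsign (w : seq nat) : int :=
  if w is t :: w' then par t * (\sum_(x <- w' | (x < t)%N) par x) + wsign w' else 0.

Lemma wsign_cons_min t w : all (ltn t) w -> wsign (t :: w) = wsign w.
Proof.
move=> /allP tw; rewrite /= big1_seq ?mulr0 ?add0r // => x /andP[xt /tw] /=.
by rewrite ltnNge ltnW.
Qed.

Lemma wsign_sorted w : pairwise ltn w -> wsign w = 0.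
Proof. by elim: w => //= t w IHw /andP[tw /IHw]; rewrite -/(wsign (t :: w)) wsign_cons_min. Qed.

(** As [u ++ v] is increasing, the pairs out of order in a shuffle are those where a letter of [v]
    precedes one of [u], exactly the pairs counted by the recursive signs. *)
Lemma shuffle_shuffles (k : fieldType) (V : lmodType k) (G : seq nat -> V) u v :
  pairwise ltn (u ++ v) ->
  shuffle par u G v = \sum_(w <- shuffles u v) sg k (wsign w) *: G w.
Proof.
move: u v G; apply: shuffle_ind => [v G /= lv|u G|x u y v IHu IHv G luv].
- by rewrite big_seq1 wsign_sorted // sg0 scale1r.
- by rewrite cats0 => lu; rewrite shuffle_nil_r shuffles_nil_r big_seq1 wsign_sorted // sg0 scale1r.
rewrite shuffle_cons shuffles_cons big_cat !big_map; congr (_ + _).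
  have /= /andP[xl l] := luv; rewrite IHu //; apply: eq_big_seq => w /perm_shuffles wE.
  by congr (sg k _ *: _); rewrite -[RHS]/(wsign (x :: w)) wsign_cons_min // (perm_all _ wE).
have l : pairwise ltn ((x :: u) ++ v).
  by apply: subseq_pairwise luv; rewrite cat_subseq // subseq_cons.
rewrite IHv // scaler_sumr; apply: eq_big_seq => w /perm_shuffles wE.
rewrite scalerA -sgD /= (perm_big _ wE) big_cat /= -/(x :: u).
congr (sg k (_ * _ + _) *: _).
move: luv; rewrite pairwise_cat => /and3P[xuy _ /= /andP[yv _]].
rewrite [X in _ = _ + X]big1_seq ?addr0; last first.
  by move=> t /andP[ty /(allP yv)] /=; rewrite ltnNge ltnW.
rewrite /wpar [LHS]big_seq_cond [RHS]big_seq_cond; apply: eq_bigl => t.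
rewrite andbT; case tu : (t \in x :: u) => //=; apply/esym.
by move/allrelP: xuy => /(_ t y tu); rewrite mem_head; apply.
Qed.
End WordSign.

Lemma wsign_map (par : nat -> int) n (f : 'I_n -> nat) :
  wsign par [seq f b | b <- enum 'I_n] =
  \sum_(b < n) \sum_(c < n | (b < c)%N && (f c < f b)%N) par (f b) * par (f c).
Proof.
elim: n f => [|n IHn] f.
  by rewrite big_ord0 (size0nil (size_enum_ord 0)).
rewrite enum_ordSl /= -map_comp IHn big_ord_recl; congr (_ + _).
  rewrite [in RHS]big_mkcond big_ord_recl /= add0r.
  rewrite big_map big_enum_cond /= mulr_sumr [LHS]big_mkcond.
  by apply: eq_bigr => c _ /=; case: ifP.
apply: eq_bigr => b _; rewrite [in RHS]big_mkcond big_ord_recl /= add0r [LHS]big_mkcond.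
by apply: eq_bigr => c _ /=; rewrite /bump !leq0n !add1n ltnS.
Qed.

Section PermWord.
Variables (n : nat) (s : 'S_n).

(** One-line notation for the inverse of [s], counted from 0: it lists which original position is
    read at each place of the permuted word. *)
Definition pword : seq nat := [seq val (s^-1%g b) | b <- enum 'I_n].

Lemma perm_seq_pword (T : Type) (x0 : T) xs : perm_seq x0 s xs = map (nth x0 xs) pword.
Proof. by rewrite /perm_seq /pword -map_comp. Qed.

Lemma size_pword : size pword = n.
Proof. by rewrite size_map size_enum_ord. Qed.

Lemma perm_pword : perm_eq pword (iota 0 n).
Proof.
rewrite /pword (map_comp val) -val_enum_ord; apply: perm_map.
apply: uniq_perm; [by rewrite (map_inj_uniq perm_inj) enum_uniq|exact: enum_uniq|].
move=> b; rewrite mem_enum; apply/mapP; exists (s b); rewrite ?mem_enum //.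
by rewrite permK.
Qed.

Lemma wsign_pword (par : nat -> int) : wsign par pword =
  \sum_a \sum_(b | inversion s a b) par a * par b.
Proof.
rewrite /pword wsign_map (reindex_inj (@perm_inj _ s)) /=.
under eq_bigr => b _ do rewrite (reindex_inj (@perm_inj _ s)) /=.
rewrite (exchange_big_dep xpredT) //=; apply: eq_bigr => a _.
by apply: eq_big => [b|b _]; rewrite /inversion !permK; [rewrite andbC|rewrite mulrC].
Qed.

Lemma decal_nth (ds : seq bidegree) : size ds = n ->
  decal ds = \sum_(a < n) (n%:Z - a%:Z - 1) * tdeg [:: nth (0, 0) ds a].
Proof.
move=> <-; elim: ds => [|d ds IHds] /=; first by rewrite big_ord0.
rewrite big_ord_recl IHds /= tdeg_cons tdeg_nil !addr0; congr (_ * _ + _); first by rewrite -addn1 PoszD; ring.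
by apply: eq_bigr => a _; rewrite /= /bump leq0n; congr (_ * _); lia.
Qed.

(** Suspension adds 1 to each parity. Over the inversions, (f a + 1)(f b + 1) expands into the
    Koszul exponent, the sum of f a + f b, which is the change of [decal] modulo 2, and the number
    of inversions, which has the parity of [s]. *)
Lemma oddz_pword (ds : seq bidegree) : size ds = n ->
  oddz (koszul_perm s ds) (+) oddz (decal (perm_seq (0, 0) s ds)) (+) odd_perm s =
  oddz (decal ds) (+) oddz (wsign (fun t => tdeg [:: nth (0, 0) ds t] + 1) pword).
Proof.
move=> sds; pose f (a : 'I_n) := tdeg [:: nth (0, 0) ds a].
have szp : size (perm_seq (0, 0) s ds) = n by rewrite perm_seq_pword size_map size_pword.
have dE : decal (perm_seq (0, 0) s ds) = \sum_a (n%:Z - (s a)%:Z - 1) * f a.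
  rewrite decal_nth // (reindex_inj (@perm_inj _ s)); apply: eq_bigr => a _.
  rewrite /f perm_seq_pword (nth_map 0%N) ?size_pword // (nth_map (s a)) ?size_enum_ord //.
  by rewrite nth_ord_enum permK.
have wE : wsign (fun t => tdeg [:: nth (0, 0) ds t] + 1) pword =
    koszul_perm s ds + \sum_a \sum_(b | inversion s a b) (f a + f b) +
    (\sum_a \sum_(b | inversion s a b) 1)%N%:Z.
  rewrite wsign_pword (raddf_sum Posz) -!big_split; apply: eq_bigr => a _.
  rewrite (raddf_sum Posz) -!big_split; apply: eq_bigr => b _ /=.
  by rewrite -/(f a) -/(f b); ring.
have := sum_inversions s f; set I2 := \sum_a \sum_(b | _) (f a + f b) in wE *.
move=> IE; have ddE : decal ds + I2 = decal (perm_seq (0, 0) s ds) + 2 * \sum_a \sum_(b | inversion s a b) f a.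
  have -> : decal (perm_seq (0, 0) s ds) =
      decal ds + \sum_a f a * a%:Z - \sum_a f a * (s a)%:Z.
    rewrite dE (decal_nth sds) -big_split -sumrB; apply: eq_bigr => a _ /=.
    by rewrite -/(f a); ring.
  by rewrite addrAC -(addrA (decal ds)) -IE; ring.
have := congr1 oddz ddE.
rewrite wE !(oddzD, oddzM) oddz_nat odd_inversions addbb andFb addbF => <-.
move: (odd_perm s) => sgn; parity_table.
Qed.
End PermWord.

Lemma pairwise_filterP (p : pred nat) w :
  pairwise (fun x y => (p x == p y) ==> (x < y)%N) w =
  pairwise ltn (filter p w) && pairwise ltn (filter (predC p) w).
Proof.
elim: w => //= t w ->.
have [pt|npt] := boolP (p t); rewrite /= all_filter.
  by rewrite andbA; congr (_ && _ && _); apply: eq_all => y /=; case: (p y).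
by rewrite andbCA; congr (_ && (_ && _)); apply: eq_all => y /=; case: (p y).
Qed.

Section ShufflePermutations.
Variables i j : nat.

Lemma nth_pword n (s : 'S_n) (a : 'I_n) : nth 0%N (pword s) a = s^-1%g a.
Proof. by rewrite (nth_map a) ?size_enum_ord // nth_ord_enum. Qed.

Lemma pword_inj n : injective (@pword n).
Proof.
move=> s t st; apply: invg_inj; apply/permP => a; apply: val_inj.
by rewrite /= -!nth_pword st.
Qed.

Lemma is_shuffle_pairwise (s : 'S_(i + j)) : is_shuffle s =
  pairwise (fun x y => ((x < i)%N == (y < i)%N) ==> (x < y)%N) (pword s).
Proof.
apply/forallP/(pairwiseP 0%N) => [sh b c|sh a].
  rewrite !inE size_pword => bn cn bc.
  have := forallP (sh (s^-1%g (Ordinal cn))) (s^-1%g (Ordinal bn)).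
  rewrite !permKV /= -[b]/(val (Ordinal bn)) -[c]/(val (Ordinal cn)) !nth_pword /=.
  set x := _ (Ordinal bn); set y := _ (Ordinal cn).
  have : x != y by rewrite (inj_eq perm_inj) -val_eqE /=; lia.
  rewrite -val_eqE /=; lia.
apply/forallP => b; apply/implyP => /andP[ab side].
have : s a != s b by rewrite (inj_eq perm_inj); apply: contraTneq ab => ->; rewrite ltnn.
have := sh (s b) (s a); rewrite !inE size_pword !ltn_ord !nth_pword !permK => /(_ isT isT).
rewrite -val_eqE /=; lia.
Qed.

Lemma mem_shuffles_iota w : (w \in shuffles (iota 0 i) (iota i j)) =
  [&& perm_eq w (iota 0 (i + j)) &
      pairwise (fun x y => ((x < i)%N == (y < i)%N) ==> (x < y)%N) w].
Proof.
have pu : all (fun t => t < i)%N (iota 0 i) by apply/allP => t; rewrite mem_iota.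
have nv : all (predC (fun t => t < i)%N) (iota i j).
  by apply/allP => t; rewrite mem_iota /= -leqNgt => /andP[].
have sorted_iota a b : pairwise ltn (iota a b).
  by rewrite -(sorted_pairwise ltn_trans) iota_ltn_sorted.
rewrite (pairwise_filterP (fun t => t < i)%N); apply/idP/and3P => [wS|[wp lu lv]].
  have := wS; rewrite (mem_shuffles _ pu nv) => /andP[/eqP -> /eqP ->].
  by rewrite !sorted_iota iotaD perm_shuffles.
have eqf (t t' : seq nat) : pairwise ltn t -> pairwise ltn t' -> t =i t' -> t == t'.
  rewrite -!(sorted_pairwise ltn_trans) => ht ht' e; apply/eqP.
  exact: (irr_sorted_eq ltn_trans ltnn).
rewrite (mem_shuffles _ pu nv) !eqf // => t; rewrite mem_filter (perm_mem wp) !mem_iota /=; lia.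
Qed.

Lemma pword_surj n w : perm_eq w (iota 0 n) -> exists s : 'S_n, w = pword s.
Proof.
case: n => [|n] wp.
  by exists 1%g; rewrite /pword (size0nil (size_enum_ord 0)); apply: size0nil; rewrite (perm_size wp).
have sw : size w = n.+1 by rewrite (perm_size wp) size_iota.
have wn (b : 'I_n.+1) : (nth 0%N w b < n.+1)%N.
  have : nth 0%N w b \in w by rewrite mem_nth ?sw.
  by rewrite (perm_mem wp) mem_iota.
pose f (b : 'I_n.+1) := Ordinal (wn b).
have finj : injective f.
  move=> a b /(congr1 val)/eqP /=; rewrite nth_uniq ?sw // ?(perm_uniq wp) ?iota_uniq //.
  by move/eqP/val_inj.
exists (perm finj)^-1%g; apply: (@eq_from_nth _ 0%N); first by rewrite size_pword.
move=> b; rewrite sw => bn.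
by rewrite -[b in RHS]/(val (Ordinal bn)) nth_pword invgK permE.
Qed.

(** Desuspension turns the operator tau of the definition into the recursive shuffle product for the
    suspended parities, on which the transfer is known to vanish. *)
Lemma sum_shuffle_perms (k : fieldType) (V : lmodType k) (G : seq nat -> V) ds :
  size ds = (i + j)%N ->
  \sum_(s : 'S_(i + j) | is_shuffle s)
    ((-1) ^+ s * sg k (koszul_perm s ds) * sg k (decal (perm_seq (0, 0) s ds))) *: G (pword s) =
  sg k (decal ds) *: shuffle (fun t => tdeg [:: nth (0, 0) ds t] + 1) (iota 0 i) G (iota i j).
Proof.
move=> sds; set par := fun t : nat => tdeg _ + 1.
have pw : pairwise ltn (iota 0 i ++ iota i j).
  by rewrite -iotaD -(sorted_pairwise ltn_trans) iota_ltn_sorted.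
rewrite shuffle_shuffles //.
transitivity (sg k (decal ds) *:
    \sum_(w <- [seq pword s | s <- enum (@is_shuffle i j)]) sg k (wsign par w) *: G w).
  rewrite big_map big_enum scaler_sumr; apply: eq_bigr => s _; rewrite scalerA.
  congr (_ *: _); rewrite -mulrA -!sgD !sgE -signr_addb; congr (_ ^+ _).
  by rewrite !oddzD -(oddz_pword s sds) addbC.
congr (_ *: _); apply: perm_big; apply: uniq_perm.
- by rewrite (map_inj_uniq (@pword_inj _)) enum_uniq.
- apply: (@uniq_shuffles (fun t => t < i)%N).
    by apply/allP => t; rewrite mem_iota.
  by apply/allP => t; rewrite mem_iota /= -leqNgt => /andP[].
move=> w; rewrite mem_shuffles_iota; apply/mapP/andP => [[s]|[wp]].
  by rewrite mem_enum => sh ->; rewrite -is_shuffle_pairwise perm_pword.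
have [s ->] := pword_surj wp; rewrite -is_shuffle_pairwise => sh.
by exists s; rewrite ?mem_enum.
Qed.
End ShufflePermutations.

(** * The transferred structure *)

Section ShuffleVanishing.
Variables (k : fieldType) (A : cbba k) (T : transfer_data A).
Hypothesis k2 : (2 : k) != 0.
Local Notation H := (td_space T).
Local Notation Fh := (@Fh k A T).
Local Notation Ph := (@Ph k A T).
Local Notation mh := (@mh k A T).

(** An eigenvector of [hpar] with sign exponent [p] has parity p + 1 in its first component and p in
    its second. With the sign that [hmul] puts on its left factor, commutativity becomes
    antisymmetry. *)
Lemma hmulC p q (x y : A * A) : hpar x = sg k p *: x -> hpar y = sg k q *: y ->
  hmul x y + sg k (p * q) *: hmul y x = 0.
Proof.
move=> hx hy.
have /= x1 := congr1 fst hx; have /= x2 := congr1 snd hx.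
have /= y1 := congr1 fst hy; have /= y2 := congr1 snd hy.
have {}x1 : parity A x.1 = sg k (p + 1) *: x.1.
  by rewrite sgD sg1 mulrN1 scaleNr -x1 opprK.
have {}y1 : parity A y.1 = sg k (q + 1) *: y.1.
  by rewrite sgD sg1 mulrN1 scaleNr -y1 opprK.
have sgz c c' (z : A) : oddz c = ~~ oddz c' -> sg k c *: z + sg k c' *: z = 0.
  by rewrite !sgE => ->; case: (oddz c'); rewrite /= ?expr0 ?expr1 scaleN1r scale1r ?addNr ?subrr.
apply: pair_ext; rewrite /=.
  rewrite x1 y1 !cmulZl (cmul_parity k2 x1 y1) !scalerA -!sgD; apply: sgz.
  rewrite !(oddzD, oddzM, oddz1); parity_table.
rewrite x2 y2 !cmulZl (cmul_parity k2 x1 y2) (cmul_parity k2 x2 y1).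
rewrite scalerBr !scalerA -!sgD.
set a := cmul _ _; set b := cmul y.1 _; set c := sg k _ *: a.
set c1 := sg k _ *: b; set c2 := sg k (p * q) *: b; set c3 := sg k _ *: a.
have -> : c - c1 + (c2 - c3) = (c - c3) - (c1 - c2) by zmodule.
suff [-> ->] : c = c3 /\ c1 = c2 by rewrite !subrr.
by split; congr (_ *: _); apply: sg_eq; rewrite !(oddzD, oddzM, oddz1); parity_table.
Qed.

Section Words.
Variables (ds : seq bidegree) (xs : seq H).
Hypothesis hxs : all_homog ds xs.
Local Notation par := (fun t => tdeg [:: nth (0, 0) ds t] + 1).

Lemma Fh_Ph_shuffle e u v : (0 < size u)%N -> (0 < size v)%N ->
  shuffle par u (fun w => Fh e (map (nth 0 xs) w)) v = 0 /\
  shuffle par u (fun w => Ph e (map (nth 0 xs) w)) v = 0.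
Proof.
move=> u0 v0; pose elt t := cst (nth 0 xs t) : H * H.
have sE t : hpar (elt t) = sg k (par t) *: elt t.
  rewrite /elt hpar_cst /spar; case: (ltnP t (size xs)) => tn; last first.
    by rewrite nth_default // raddf0 oppr0; apply: pair_ext; rewrite /= scaler0.
  have [_ /(_ t tn) /parity_homog ->] := hxs.
  rewrite [sg k (_ + 1)]sgD sg1 mulrN1 tdeg_cons tdeg_nil addr0.
  by apply: pair_ext; rewrite /= ?scaler0 ?scaleNr.
have [FE PE] := shuffle_trF_trP (@hmul_linear_l k A) (@hmul_linear_r k A) (@hpar_linear k A)
  (@hpar_i k A T) (@hpar_mul k A) (@hpar_K k A T) hmulC sE u0 v0.
have mapE w : map elt w = map (@cst k H) (map (nth 0 xs) w) by rewrite -map_comp.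
pose pr : {linear (A * A)%type -> A} := if e then (snd : {linear (A * A)%type -> A}) else (fst : {linear (A * A)%type -> A}).
split.
  have := congr1 pr FE; rewrite raddf0 raddf_shuffle => <-; apply: eq_shuffle => w.
  by rewrite mapE /Fh /pr; case: (e).
have := congr1 pr PE; rewrite raddf0 raddf_shuffle => <-; apply: eq_shuffle => w.
by rewrite mapE /Ph /pr; case: (e).
Qed.
End Words.

Lemma fam_vanishes_on_shuffles (B : bicomplex k) (G : bool -> seq H -> B) :
  (forall e, mlinear (G e)) ->
  (forall e ds xs u v, all_homog ds xs -> (0 < size u)%N -> (0 < size v)%N ->
    shuffle (fun t => tdeg [:: nth (0, 0) ds t] + 1) u (fun w => G e (map (nth 0 xs) w)) v = 0) ->
  vanishes_on_shuffles (fam G).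
Proof.
move=> Gl Gsh i j p q ds xs i0 j0 _ _ sxs hxs; have sds : size ds = (i + j)%N by case: hxs => ->.
pose b : bidegree := ((bideg ds).1 + p, (bideg ds).2 + q).
pose g (w : seq nat) := gcomp (homog_bigrading B) b
  (G false (map (nth 0 xs) w) + G true (map (nth 0 xs) w)).
(* The target bidegree [b] and the binomial coefficient are invariant under permutation, so one
   linear map can be pulled out; the factors that depend on [s] are those handled by
   [sum_shuffle_perms]. *)
transitivity (\sum_(s : 'S_(i + j) | is_shuffle s)
    sg k 'C((i + j).-1, 2)%:Z *: (((-1) ^+ s * sg k (koszul_perm s ds) *
      sg k (decal (perm_seq (0, 0) s ds))) *: g (pword s))).
  apply: eq_bigr => s _.
  have hs : all_homog (perm_seq (0, 0) s ds) (perm_seq 0 s xs).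
    rewrite !perm_seq_pword; split=> [|c]; first by rewrite size_map [RHS]size_map.
    rewrite size_map size_pword => cn.
    rewrite !(nth_map 0%N) ?size_pword //; have [_] := hxs; apply.
    by rewrite sxs -[c]/(val (Ordinal cn)) nth_pword ltn_ord.
  rewrite (fam_homog Gl _ _ _ hs).
  rewrite /fsign sgD.
  rewrite [LHS]scalerA.
  rewrite [RHS]scalerA.
  congr (_ *: _).
    by rewrite mulrCA mulrA.
  have -> : bideg (perm_seq (0, 0) s ds) = bideg ds.
    have dsE : perm_eq (perm_seq (0, 0) s ds) ds.
      rewrite perm_seq_pword -[X in perm_eq _ X](mkseq_nth (0, 0)) sds; apply: perm_map.
      exact: perm_pword.
    by rewrite /bideg; congr (_, _); apply: perm_big.
  by rewrite perm_seq_pword.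
rewrite -scaler_sumr sum_shuffle_perms // -raddf_shuffle shuffleD !Gsh ?size_iota //.
by rewrite addr0 raddf0 !scaler0.
Qed.

Lemma transferred_Cinf : pluripotential_Cinf (fam mh).
Proof.
split; first exact: transferred_Ainf.
apply: fam_vanishes_on_shuffles => [e|e ds xs u v hxs u0 v0]; first exact: mh_mlinear.
by rewrite -(raddf_shuffle _ (td_proj T)) (Fh_Ph_shuffle hxs e u0 v0).2 raddf0.
Qed.

Lemma transferred_Cinf_weak_equivalence :
  pluripotential_Cinf_weak_equivalence (fam mh) (@cbba_operations k A) (fam Fh).
Proof.
split; first split; first exact: transferred_morphism.
  apply: fam_vanishes_on_shuffles => [e|e ds xs u v hxs u0 v0]; first exact: Fh_mlinear.
  exact: (Fh_Ph_shuffle hxs e u0 v0).1.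
have -> : (fun x => fam Fh 1 0 0 [:: x]) = td_incl T by apply: boolp.funext => x; exact: fam_Fh1.
exact: td_weak_equivalence.
Qed.
End ShuffleVanishing.

Theorem theorem2p34 (k : fieldType) (char0 : [pchar k]%R =i pred0) (A : cbba k) :
  exists (H : bicomplex k) (nu : operations H H) (g : operations H A),
    minimal H /\ pluripotential_Cinf nu /\
    pluripotential_Cinf_weak_equivalence nu (@cbba_operations k A) g.
Proof.
have k2 : (2 : k) != 0 by move/pcharf0P: char0 => ->.
have [T] := transfer_data_exists A.
exists (td_space T), (fam (@mh k A T)), (fam (@Fh k A T)); split; first exact: td_minimal.
by split; [apply: transferred_Cinf|apply: transferred_Cinf_weak_equivalence].
Qed.
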